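(* Let $G$ be a metric graph, with each edge of length one, that can be obtained from a vertex by iteratively attaching (i) an edge along a vertex or (ii) a $k$-cycle graph along a vertex or a single edge. Then $\mathrm{VR}(G;r)\simeq\bigvee_{i=1}^n \mathrm{VR}(C_{k_i};r)$ for $r\ge 1$, where $n$ is the number of times operation (ii) is performed, $k_i$ are the corresponding cycle lengths, and $C_{k_i}$ is a loop of length $k_i$.
   Context: A metric graph is a graph in which each edge is assigned a positive finite length; it is regarded as the metric space of all points (not only vertices), with the distance between two points being the infimum of lengths of paths between them. A $k$-cycle graph is a simple cycle with $k$ vertices and $k$ edges (here each edge of length one); the value of $k$ may differ between attachments. $C_k$ denotes the corresponding metric circle of circumference $k$ with its geodesic metric. The Vietoris--Rips complex of a metric space $Z$ is $\mathrm{VR}(Z;r)=\{\text{finite }\sigma\subseteq Z\mid \mathrm{diam}(\sigma)\le r\}$, and $\simeq$ denotes homotopy equivalence of geometric realizations. An empty wedge sum is a point. *)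

(* Defs.v *)
From HB Require Import structures.
From mathcomp Require Import all_boot all_order all_algebra.
From mathcomp Require Import all_classical all_reals all_analysis.
From mathcomp Require Import homotopy.
Set Implicit Arguments.
Unset Strict Implicit.
Unset Printing Implicit Defensive.
Import Order.TTheory GRing.Theory Num.Theory.
Import numFieldNormedType.Exports.
Local Open Scope classical_set_scope.
Local Open Scope ring_scope.

Section Homotopy.
Context (R : realType).

Definition homotopic (X Y : topologicalType) (f g : X -> Y) : Prop :=
  exists H : X * R -> Y,
    [/\ {within [set: X] `*` `[0, 1], continuous H},
        forall x, H (x, 0) = f x & forall x, H (x, 1) = g x].

Definition homotopy_equivalent (X Y : topologicalType) : Prop :=
  exists (f : X -> Y) (g : Y -> X),
    [/\ continuous f, continuous g,
        homotopic (g \o f) idfun & homotopic (f \o g) idfun].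

End Homotopy.

(* The library's [wedge] of the empty family is the empty space, whereas an
   empty wedge sum of pointed spaces is a point. *)
Definition finite_wedge (n : nat) (X : 'I_n -> topologicalType)
    (p : forall i, X i) : topologicalType :=
  if n == 0%N then (discrete_topology unit : topologicalType) else wedge p.

Section Realization.
Context (R : realType) (Z : choiceType) (K : set (set Z)).

Definition support_of (t : Z -> R) : set Z := [set z | t z != 0].

(* Barycentric coordinates. The simplices of [K] are meant to be finite, so
   that the sum below is a finite one; the empty simplex carries no point. *)
Definition realization : Type :=
  {t : Z -> R | [/\ forall z, 0 <= t z, K (support_of t) &
                    \sum_(z \in [set: Z]) t z = 1]}.

HB.instance Definition _ := gen_eqMixin realization.
HB.instance Definition _ := gen_choiceMixin realization.

(* Weak (coherent) topology: [U] is open when it meets every closed simplex in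
   a relatively open set, the topology of a closed simplex being the Euclidean
   one, given here by the sup distance between barycentric coordinates. *)
Definition realization_open (U : set realization) : Prop :=
  forall s, K s -> forall t, U t -> support_of (sval t) `<=` s ->
  exists2 e : R, 0 < e &
    forall t' : realization, support_of (sval t') `<=` s ->
      (forall z, `|sval t z - sval t' z| < e) -> U t'.

Let realization_openT : realization_open setT.
Proof. by move=> s _ t _ _; exists 1. Qed.

Let realization_openI : setI_closed realization_open.
Proof.
move=> A B oA oB s Ks t [At Bt] ts.
have [a a0 ha] := oA s Ks t At ts; have [b b0 hb] := oB s Ks t Bt ts.
exists (Num.min a b); first by rewrite lt_min a0.
move=> t' t's tt'; split; [apply: ha|apply: hb] => // z;
  by have := tt' z; rewrite lt_min => /andP[].
Qed.

Let realization_open_bigU (I : Type) (f : I -> set realization) :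
  (forall i, realization_open (f i)) -> realization_open (\bigcup_i f i).
Proof.
move=> of_ s Ks t [i _ fit] ts; have [e e0 he] := of_ i s Ks t fit ts.
by exists e => // t' t's tt'; exists i => //; exact: he.
Qed.

HB.instance Definition _ := isOpenTopological.Build realization
  realization_openT realization_openI realization_open_bigU.

Definition is_vertex (t : realization) : Prop := exists z, sval t z = 1.

End Realization.

Section VietorisRips.
Context (R : realType) (Z : Type) (d : Z -> Z -> R).

Definition diam (s : set Z) : R := sup [set d p.1 p.2 | p in s `*` s].

Definition vietoris_rips (r : R) : set (set Z) :=
  [set s | finite_set s /\ diam s <= r].

End VietorisRips.

Section Circle.
Context (R : realType) (k : nat).

(* The quotient of the line by [k] times the integers, on its fundamental domain. *)
Definition circle : choiceType := {x : R | 0 <= x < k%:R}.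

Definition circle_dist (x y : circle) : R :=
  Num.min `|val x - val y| (k%:R - `|val x - val y|).

End Circle.

(* A finite simple graph on [V] is given by its set [E] of edges, which are
   two-element subsets of [V]. *)
Section MetricGraph.
Context (R : realType) (V : finType) (E : {set {set V}}).

Definition gsupport (x : {ffun V -> R}) : {set V} := [set v | x v != 0]%SET.

(* The point of the edge [[set u; v]] at distance [t] from [u] is the function
   with value [1 - t] at [u], [t] at [v] and [0] elsewhere. *)
Definition graph_point : choiceType :=
  {x : {ffun V -> R} | [&& [forall v, 0 <= x v], \sum_v x v == 1 &
    (#|gsupport x| == 1%N) || (gsupport x \in E)]}.

Definition same_edge (x y : graph_point) : bool :=
  [exists e in E, (gsupport (val x) \subset e) && (gsupport (val y) \subset e)].

(* Distance along an edge that contains both points: the two nonzero terms of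
   the sum are equal. *)
Definition edge_dist (x y : graph_point) : R :=
  (\sum_v `|val x v - val y v|) / 2.

Definition path_length (x : graph_point) (p : seq graph_point) : R :=
  \sum_(s <- zip (x :: p) p) edge_dist s.1 s.2.

(* Paths are concatenations of finitely many segments, each inside an edge. *)
Definition graph_dist (x y : graph_point) : R :=
  inf [set path_length x p | p in [set p | path same_edge x p /\ last x p = y]].

End MetricGraph.

Section Attachments.
Context (V : finType).
Local Open Scope set_scope.

Definition cycle_edges (c : seq V) : {set {set V}} :=
  [set [set x; next c x] | x in c].

(* [attachments S E ks]: the graph with vertex set [S] and edge set [E] is
   obtained from a vertex by iterated attachments, [ks] being the lengths of the
   attached cycles, in order. Attaching a cycle along a subgraph means adding a
   cycle of the ambient vertex type that meets the current graph exactly in that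
   subgraph. *)
Inductive attachments : {set V} -> {set {set V}} -> seq nat -> Prop :=
| attach_start v : attachments [set v] finset.set0 [::]
| attach_edge S E ks u w :
    attachments S E ks -> u \in S -> w \notin S ->
    attachments (w |: S) ([set u; w] |: E) ks
| attach_cycle_vertex S E ks c v :
    attachments S E ks -> (3 <= size c)%N -> uniq c ->
    [set x in c] :&: S = [set v] ->
    attachments (S :|: [set x in c]) (E :|: cycle_edges c) (rcons ks (size c))
| attach_cycle_edge S E ks c u v :
    attachments S E ks -> (3 <= size c)%N -> uniq c ->
    [set u; v] \in E -> [set u; v] \in cycle_edges c ->
    [set x in c] :&: S = [set u; v] ->
    attachments (S :|: [set x in c]) (E :|: cycle_edges c) (rcons ks (size c)).

End Attachments.

(* Main.v *)
(* Say that K collapses to K' when, for sets P1, P2, P3 of vertices and a partial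
   map f on vertices, s u f(s) is in K for every simplex s of K that meets all
   three sets, and K' consists of the simplices that miss one of them. If m is
   the least of the three masses of a point t, then moving the mass min(t z, m)
   from each vertex z to f z (discarding it when f z is undefined) and normalizing
   annihilates one of the three sets: this is a deformation retraction of |K| onto
   |K'|. All homotopy equivalences between complexes are zigzags of collapses.

   Let C be attached to G along a vertex u or an edge uv. A simplex of VR(G u C)
   with points strictly on both sides is within r of u, or within r of v; pushing
   first to v, then to u, leaves VR(G) u VR(C). A clone of C then replaces C: the
   part of the clone over the shared edge is joined to it by a simplex, which
   collapses to an edge, and this edge slides to the base points and is contracted.
   Inductively VR(G) becomes a union of the VR(C_i) that share one vertex.

   The path metric enters only as the largest pseudometric that is bounded by the
   length of each segment of an edge. *)

(* The bound [1 <= r] enters because an edge has diameter 1. The shared edge therefore spans a full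
   simplex in both complexes, its points lie within r of both u and v, and any two points of one
   edge form a simplex, so that a bridge can slide along edges.

   Which of u and v is near a given simplex cannot be chosen continuously. Hence the third set of a
   collapse: the points far from u, whose presence leaves only v.

   G and C may meet in a whole edge, and the prescribed base point of a circle need not lie where
   the cycle was attached. The bridge between G and the clone is therefore slid at both of its ends
   before it is contracted. Clones need fresh vertices, so all complexes live on one ambient type:
   the functions on V together with disjoint copies of the circles. Cycles are detached from the
   last to the first, since only the last one is known to meet the rest in a vertex or an edge.

   For the weak topology, continuity is checked on each closed simplex: finitely many target
   simplices and coordinates that are Lipschitz in the point and the time suffice. *)
Require Import Defs.
From HB Require Import structures.
From mathcomp Require Import all_boot all_order all_algebra.
From mathcomp Require Import all_classical all_reals all_analysis.
From mathcomp Require Import homotopy.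
From mathcomp Require Import ring lra.
Set Implicit Arguments.
Unset Strict Implicit.
Unset Printing Implicit Defensive.
Import Order.TTheory GRing.Theory Num.Theory.
Import numFieldNormedType.Exports.
Local Open Scope ring_scope.

Local Open Scope classical_set_scope.

(** * Homotopy equivalence *)

Section HomotopyEquivalence.
Context (R : realType).

Lemma le01_0 : 0 <= (0 : R) <= 1.
Proof. by rewrite lexx ler01. Qed.

Lemma le01_1 : 0 <= (1 : R) <= 1.
Proof. by rewrite lexx ler01. Qed.

Definition clamp (s : R) : R := Num.max 0 (Num.min s 1).

Lemma clamp_itv s : 0 <= clamp s <= 1.
Proof. by rewrite /clamp le_max lexx ge_max ler01 ge_min lexx orbT. Qed.

Lemma clamp_id s : 0 <= s <= 1 -> clamp s = s.
Proof. by case/andP=> s0 s1; rewrite /clamp min_l // max_r. Qed.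

Lemma clamp_lip s s' e : `|s - s'| <= e -> `|clamp s - clamp s'| <= e.
Proof.
rewrite /clamp !ler_norml => /andP[h1 h2].
have m1 : Num.max 0 1 = 1 :> R by rewrite max_r.
by case: (leP s 1) => ?; case: (leP s' 1) => ?; rewrite ?m1;
  case: (leP 0 s) => ?; case: (leP 0 s') => ?; apply/andP; split; lra.
Qed.

Lemma clamp_continuous : continuous clamp.
Proof.
move=> s; apply/cvgrPdist_le => e e0; near=> s'.
by apply: clamp_lip; near: s'; apply: cvgr_dist_le => //; exact: cvg_id.
Unshelve. all: by end_near. Qed.

Lemma continuous_fst (X Y : topologicalType) : continuous (@fst X Y).
Proof. by move=> [x y]; exact: cvg_fst. Qed.

Lemma continuous_snd (X Y : topologicalType) : continuous (@snd X Y).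
Proof. by move=> [x y]; exact: cvg_snd. Qed.

Lemma continuous_pair (X Y Z : topologicalType) (f : X -> Y) (g : X -> Z) :
  continuous f -> continuous g -> continuous (fun x => (f x, g x)).
Proof. by move=> cf cg x; apply: cvg_pair; [exact: cf|exact: cg]. Qed.

Lemma continuous_comp2 (X Y Z : topologicalType) (f : X -> Y) (g : Y -> Z) :
  continuous f -> continuous g -> continuous (fun x => g (f x)).
Proof. by move=> cf cg x; apply: continuous_comp; [exact: cf|exact: cg]. Qed.

(** The definition asks for continuity only within the unit interval. Precomposing the time with
    [clamp] gives a map continuous on all of [X * R], which spares subspace topologies from here
    on. *)
Lemma homotopicP (X Y : topologicalType) (f g : X -> Y) :
  homotopic R f g <-> exists H : X * R -> Y,
    [/\ continuous H, forall x, H (x, 0) = f x & forall x, H (x, 1) = g x].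
Proof.
split=> -[H [cH H0 H1]]; last first.
  by exists H; split=> //; exact: continuous_subspaceT.
exists (fun p => H (p.1, clamp p.2)); split.
- move=> [x s]; have Axs : ([set: X] `*` `[0, 1]) (x, clamp s).
    by split=> //=; rewrite in_itv /= clamp_itv.
  have cc : continuous (fun p : X * R => (p.1, clamp p.2)).
    apply: continuous_pair; first exact: continuous_fst.
    exact: continuous_comp2 (@continuous_snd _ _) clamp_continuous.
  have hH := (subspace_continuousP _ _).1 cH _ Axs.
  apply: cvg_comp hH => U HU; have := cc (x, s) _ HU.
  apply: (@filterS _ (nbhs (x, s))) => p /= Up; apply: Up; split=> //=.
  by rewrite in_itv /= clamp_itv.
- by move=> x /=; rewrite clamp_id ?H0 // lexx ler01.
- by move=> x /=; rewrite clamp_id ?H1 // lexx ler01.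
Qed.

Lemma homotopic_refl (X Y : topologicalType) (f : X -> Y) :
  continuous f -> homotopic R f f.
Proof.
move=> cf; apply/homotopicP; exists (f \o fst); split=> //.
exact: continuous_comp2 (@continuous_fst _ _) cf.
Qed.

Lemma homotopic_trans (X Y : topologicalType) (f g h : X -> Y) :
  homotopic R f g -> homotopic R g h -> homotopic R f h.
Proof.
move=> /homotopicP[H [cH H0 H1]] /homotopicP[K [cK K0 K1]]; apply/homotopicP.
pose a (p : X * R) := (p.1, p.2 * 2); pose b (p : X * R) := (p.1, p.2 * 2 - 1).
have ca : continuous (H \o a).
  apply: continuous_comp2 cH; apply: continuous_pair; first exact: continuous_fst.
  by move=> p; apply: cvgMr_tmp; exact: continuous_snd.
have cb : continuous (K \o b).
  apply: continuous_comp2 cK; apply: continuous_pair; first exact: continuous_fst.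
  by move=> p; apply: cvgB; [apply: cvgMr_tmp; exact: continuous_snd|exact: cvg_cst].
exists (fun p => if p.2 <= 2^-1 then (H \o a) p else (K \o b) p); split; last 2 first.
- by move=> x /=; rewrite invr_ge0 ler0n /a /= mul0r H0.
- move=> x /=; rewrite ifF; last by apply/negbTE; rewrite -ltNge; lra.
  by rewrite /b /= (_ : 1 * 2 - 1 = 1 :> R) ?K1 //; lra.
move=> p U /= HU; have Fp : Filter (nbhs p) by exact: nbhs_filter.
have [lt|gt|eq] := ltgtP p.2 2^-1.
- move: HU; rewrite (ltW lt) => /(ca p U) HU.
  have lt' : nbhs p [set q | q.2 < 2^-1].
    apply: (continuous_snd (x := p) (t := [set x | x < 2^-1])).
    by apply: open_nbhs_nbhs; split => //; exact: open_lt.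
  by apply: (@filterS2 _ _ Fp _ _ _ _ HU lt') => q /= Hq qs; rewrite (ltW qs).
- move: HU; rewrite leNgt gt /= => /(cb p U) HU.
  have gt' : nbhs p [set q | 2^-1 < q.2].
    apply: (continuous_snd (x := p) (t := [set x | 2^-1 < x])).
    by apply: open_nbhs_nbhs; split => //; exact: open_gt.
  by apply: (@filterS2 _ _ Fp _ _ _ _ HU gt') => q /= Hq qs; rewrite leNgt qs.
(* At time 1/2 both halves take the value of [g], so the neighbourhoods pulled back through [H \o a]
   and [K \o b] can be intersected. *)
- move: HU; rewrite eq lexx => HU.
  have e1 : (K \o b) p = (H \o a) p.
    rewrite /a /b /= eq (_ : 2^-1 * 2 = 1); last by lra.
    by rewrite subrr K0 H1.
  have KU : nbhs ((K \o b) p) U by rewrite e1.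
  by apply: (@filterS2 _ _ Fp _ _ _ _ (ca p U HU) (cb p U KU)) => q /= Hq Kq; case: ifP.
Qed.

Lemma homotopic_compl (X Y Z : topologicalType) (f g : X -> Y) (h : Y -> Z) :
  continuous h -> homotopic R f g -> homotopic R (h \o f) (h \o g).
Proof.
move=> ch /homotopicP[H [cH H0 H1]]; apply/homotopicP.
exists (h \o H); split=> [p|x|x] /=; rewrite ?H0 ?H1 //.
by apply: continuous_comp; [exact: cH|exact: ch].
Qed.

Lemma homotopic_compr (X Y Z : topologicalType) (f g : Y -> Z) (h : X -> Y) :
  continuous h -> homotopic R f g -> homotopic R (f \o h) (g \o h).
Proof.
move=> ch /homotopicP[H [cH H0 H1]]; apply/homotopicP.
exists (H \o (fun p => (h p.1, p.2))); split=> [p|x|x] /=; rewrite ?H0 ?H1 //.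
move: p; apply: continuous_comp2 cH; apply: continuous_pair; last exact: continuous_snd.
exact: continuous_comp2 (@continuous_fst _ _) ch.
Qed.

Lemma homotopy_equivalent_refl (X : topologicalType) : homotopy_equivalent R X X.
Proof.
by exists idfun, idfun; split; try (by move=> ?; exact: cvg_id);
  apply: homotopic_refl => ?; exact: cvg_id.
Qed.

Lemma homotopy_equivalent_sym (X Y : topologicalType) :
  homotopy_equivalent R X Y -> homotopy_equivalent R Y X.
Proof. by move=> [f [g [? ? ? ?]]]; exists g, f; split. Qed.

Lemma homotopy_equivalent_trans (X Y Z : topologicalType) :
  homotopy_equivalent R X Y -> homotopy_equivalent R Y Z ->
  homotopy_equivalent R X Z.
Proof.
move=> [f [g [cf cg gf fg]]] [h [k [ch ck kh hk]]].
exists (h \o f), (g \o k); split.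
- by move=> x; apply: continuous_comp; [exact: cf|exact: ch].
- by move=> x; apply: continuous_comp; [exact: ck|exact: cg].
- apply: (homotopic_trans _ gf).
  exact: (homotopic_compl cg (homotopic_compr cf kh)).
- apply: (homotopic_trans _ hk).
  exact: (homotopic_compl ch (homotopic_compr ck fg)).
Qed.

Lemma homeo_homotopy_equivalent (X Y : topologicalType) (f : X -> Y) (g : Y -> X) :
  continuous f -> continuous g -> cancel f g -> cancel g f ->
  homotopy_equivalent R X Y.
Proof.
move=> cf cg fK gK; exists f, g; split=> //.
- rewrite (_ : g \o f = idfun); last by apply/funext => x /=; rewrite fK.
  by apply: homotopic_refl => ?; exact: cvg_id.
- rewrite (_ : f \o g = idfun); last by apply/funext => x /=; rewrite gK.
  by apply: homotopic_refl => ?; exact: cvg_id.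
Qed.

End HomotopyEquivalence.

(** * Continuity of maps between realizations *)

Section Realization.
Context (R : realType) (Z : choiceType).
Implicit Types (K L : set (set Z)) (s : set Z).

Definition complex K :=
  (forall s, K s -> finite_set s) /\ (forall s s', K s -> s' `<=` s -> K s').

Lemma realization_eq K (t t' : realization R K) :
  (forall z, sval t z = sval t' z) -> t = t'.
Proof.
case: t t' => [t p] [t' p'] /= /funext E; rewrite E in p *.
by congr exist; exact: Prop_irrelevance.
Qed.

Lemma fsum_seq (g : Z -> R) (r : seq Z) : uniq r ->
  (forall z, g z != 0 -> z \in r) ->
  \sum_(z \in [set: Z]) g z = \sum_(z <- r) g z.
Proof.
move=> ur gr; rewrite (fsbigE r) //.
  by apply: eq_bigl => z; rewrite in_setT.
by move=> z _ zr; apply: contraNeq zr => /gr.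
Qed.

Lemma finite_uniq_seq s : finite_set s -> exists2 r : seq Z, uniq r & s = [set` r].
Proof.
move=> /finite_seqP[r ->]; exists (undup r); first exact: undup_uniq.
by apply/seteqP; split=> z /=; rewrite mem_undup.
Qed.

Lemma realization_ge0 K (t : realization R K) z : 0 <= sval t z.
Proof. by case: t => t []. Qed.

Lemma realization_simplex K (t : realization R K) : K (support_of (sval t)).
Proof. by case: t => t []. Qed.

Lemma realization_sum1 K (t : realization R K) (r : seq Z) : uniq r ->
  support_of (sval t) `<=` [set` r] -> \sum_(z <- r) sval t z = 1.
Proof.
move=> ur tr; rewrite -(fsum_seq ur); last by move=> z tz; exact: tr.
by case: t {tr} => t [].
Qed.

Lemma realization_le1 K (t : realization R K) z :
  complex K -> sval t z <= 1.
Proof.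
move=> [fK _]; have [r ur tr] := finite_uniq_seq (fK _ (realization_simplex t)).
have tr' : support_of (sval t) `<=` [set` r] by rewrite tr.
apply: le_trans (_ : \sum_(z0 <- r) sval t z0 <= _); last by rewrite realization_sum1.
have [zr|zr] := boolP (z \in r).
  rewrite (bigD1_seq z) //= lerDl sumr_ge0 // => ? _; exact: realization_ge0.
have -> : sval t z = 0 by apply: contraNeq zr => /tr'.
by rewrite sumr_ge0 // => ? _; exact: realization_ge0.
Qed.

(** Weak openness tests one simplex that contains the point. A map may send a closed simplex into a
    union of several simplices, so one radius is needed for all [tau i], including those that do not
    contain [p]. *)
Lemma realization_open_near L (U : set (realization R L)) (p : realization R L)
    (N : nat) (tau : nat -> set Z) :
  open U -> U p -> (forall i, (i < N)%N -> L (tau i)) ->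
  exists2 e : R, 0 < e & forall p' : realization R L,
    (exists2 i, (i < N)%N & support_of (sval p') `<=` tau i) ->
    (forall z, `|sval p z - sval p' z| < e) -> U p'.
Proof.
move=> oU Up; elim: N => [_|N IH Ltau]; first by exists 1 => // p' [].
have [|e e0 he] := IH; first by move=> i iN; apply: Ltau; rewrite ltnS ltnW.
have [e' e'0 he'] : exists2 e' : R, 0 < e' & forall p' : realization R L,
    support_of (sval p') `<=` tau N ->
    (forall z, `|sval p z - sval p' z| < e') -> U p'.
  have [ptau|] := pselect (support_of (sval p) `<=` tau N).
    exact: (oU _ (Ltau N (ltnSn N)) p Up ptau).
  (* Some z outside [tau N] carries mass of [p], while every [p'] supported in [tau N] has none
     there. The radius [sval p z] makes the condition vacuous. *)
  move=> /existsNP[z /not_implyP[pz tz]]; exists (sval p z).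
    by rewrite lt_def pz realization_ge0.
  move=> p' p't /(_ z); suff -> : sval p' z = 0.
    by rewrite subr0 ger0_norm ?realization_ge0 // ltxx.
  by apply/eqP; apply: contra_notT tz => /p't.
exists (Num.min e e'); first by rewrite lt_min e0.
move=> p' [i + p'i] hp; rewrite ltnS leq_eqVlt => /predU1P[iN|iN].
  by apply: he'; [rewrite -iN|move=> z; have := hp z; rewrite lt_min => /andP[]].
by apply: he; [exists i|move=> z; have := hp z; rewrite lt_min => /andP[]].
Qed.

(** * Lipschitz functions on a closed simplex times the unit interval *)

(** One constant bounds both the values and the slope; boundedness is what makes a product Lipschitz
    again. *)
Definition lip K s (u : realization R K -> R -> R) :=
  exists C : R, 0 <= C /\ forall t x, support_of (sval t) `<=` s -> 0 <= x <= 1 ->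
    `|u t x| <= C /\ forall t' x' e, support_of (sval t') `<=` s -> 0 <= x' <= 1 ->
      (forall z, `|sval t z - sval t' z| <= e) -> `|x - x'| <= e ->
      `|u t x - u t' x'| <= C * e.

Section Lip.
Context (K : set (set Z)) (s : set Z).
Implicit Types u v : realization R K -> R -> R.

Lemma lip_coord z : complex K -> lip s (fun (t : realization R K) _ => sval t z).
Proof.
move=> cK; exists 1; split=> // t x ts _; split.
  by rewrite ger0_norm ?realization_ge0 // realization_le1.
by move=> t' x' e _ _ h _; rewrite mul1r.
Qed.

Lemma lip_time : lip s (fun (_ : realization R K) x => x).
Proof.
exists 1; split=> // t x _ /andP[x0 x1]; split; first by rewrite ger0_norm.
by move=> *; rewrite mul1r.
Qed.

Lemma lip_cst c : lip s (fun (_ : realization R K) _ => c).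
Proof.
exists `|c|; split=> // t x _ _; split=> // t' x' e _ _ _ xx'.
by rewrite subrr normr0 mulr_ge0 // (le_trans _ xx').
Qed.

Lemma lip_ext u v : (forall t x, support_of (sval t) `<=` s -> 0 <= x <= 1 -> u t x = v t x) ->
  lip s u -> lip s v.
Proof.
move=> E [C [C0 h]]; exists C; split=> // t x ts hx; rewrite -!E //.
have [h1 h2] := h t x ts hx; split=> // t' x' e t's hx' *.
by rewrite -!E //; exact: h2.
Qed.

Lemma lipD u v : lip s u -> lip s v -> lip s (fun t x => u t x + v t x).
Proof.
move=> [C [C0 h]] [D [D0 k]]; exists (C + D); split; first exact: addr_ge0.
move=> t x ts hx; have [h1 h2] := h t x ts hx; have [k1 k2] := k t x ts hx.
split; first by rewrite (le_trans (ler_normD _ _)) // lerD.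
move=> t' x' e t's hx' *; rewrite mulrDl opprD addrACA (le_trans (ler_normD _ _)) //.
by apply: lerD; [exact: h2|exact: k2].
Qed.

Lemma lipN u : lip s u -> lip s (fun t x => - u t x).
Proof.
move=> [C [C0 h]]; exists C; split=> // t x ts hx; have [h1 h2] := h t x ts hx.
split; first by rewrite normrN.
by move=> *; rewrite -opprD normrN; exact: h2.
Qed.

Lemma lip_norm u : lip s u -> lip s (fun t x => `|u t x|).
Proof.
move=> [C [C0 h]]; exists C; split=> // t x ts hx; have [h1 h2] := h t x ts hx.
split; first by rewrite normr_id.
by move=> *; rewrite (le_trans (ler_dist_dist _ _)) //; exact: h2.
Qed.

Lemma lipM u v : lip s u -> lip s v -> lip s (fun t x => u t x * v t x).
Proof.
(* One [C * D] bounds the values, the other two bound the two terms of the product rule. *)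
move=> [C [C0 h]] [D [D0 k]]; exists (C * D + C * D + C * D); split.
  by rewrite !addr_ge0 ?mulr_ge0.
move=> t x ts hx; have [h1 h2] := h t x ts hx; have [k1 k2] := k t x ts hx.
split.
  by rewrite normrM -addrA (le_trans (ler_pM _ _ h1 k1)) // lerDl addr_ge0 ?mulr_ge0.
move=> t' x' e t's hx' tt' xx'; have e0 : 0 <= e by rewrite (le_trans _ xx').
have [h1' _] := h t' x' t's hx'; have [k1' _] := k t' x' t's hx'.
have -> : u t x * v t x - u t' x' * v t' x' =
  (u t x - u t' x') * v t x + u t' x' * (v t x - v t' x').
  by ring.
rewrite (le_trans (ler_normD _ _)) // !normrM.
have a1 : `|u t x - u t' x'| * `|v t x| <= C * e * D by apply: ler_pM => //; exact: h2.
have a2 : `|u t' x'| * `|v t x - v t' x'| <= C * (D * e) by apply: ler_pM => //; exact: k2.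
have : 0 <= C * D * e by rewrite !mulr_ge0.
rewrite !mulrDl; move: a1 a2; rewrite mulrA (mulrAC C e); lra.
Qed.

(** The formula min(u, v) = (u + v - |u - v|) / 2 reduces this to sums and absolute values. *)
Lemma lip_min u v : lip s u -> lip s v -> lip s (fun t x => Num.min (u t x) (v t x)).
Proof.
move=> lu lv; have lD := lipD (lipD lu lv) (lipN (lip_norm (lipD lu (lipN lv)))).
apply: (lip_ext _ (lipM lD (lip_cst 2^-1))) => t x _ _ /=.
by rewrite Num.Theory.minr_absE.
Qed.

Lemma lip_sum (r : seq Z) (u : Z -> realization R K -> R -> R) :
  (forall z, z \in r -> lip s (u z)) -> lip s (fun t x => \sum_(z <- r) u z t x).
Proof.
elim: r => [_|a r IH h].
  by apply: (lip_ext _ (lip_cst 0)) => t x _ _; rewrite big_nil.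
have lr := IH (fun z zr => h z (mem_behead (s := a :: r) zr)).
apply: (lip_ext _ (lipD (h a (mem_head _ _)) lr)) => t x _ _.
by rewrite big_cons.
Qed.

Lemma lip_inv u c : 0 < c ->
  (forall t x, support_of (sval t) `<=` s -> 0 <= x <= 1 -> c <= u t x) ->
  lip s u -> lip s (fun t x => (u t x)^-1).
Proof.
move=> c0 uc [C [C0 h]]; have ci : 0 <= c^-1 by rewrite invr_ge0 ltW.
exists (c^-1 + c^-1 * c^-1 * C); split.
  by rewrite addr_ge0 // !mulr_ge0.
have iv t x : support_of (sval t) `<=` s -> 0 <= x <= 1 ->
    0 < u t x /\ (u t x)^-1 <= c^-1.
  move=> ts hx; have u0 : 0 < u t x by rewrite (lt_le_trans c0) ?uc.
  by split=> //; rewrite lef_pV2 ?posrE ?uc.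
move=> t x ts hx; have [_ h2] := h t x ts hx; have [u0 ui] := iv t x ts hx.
split.
  by rewrite ger0_norm ?invr_ge0 ?(ltW u0) // (le_trans ui) // lerDl !mulr_ge0.
move=> t' x' e t's hx' tt' xx'; have e0 : 0 <= e by rewrite (le_trans _ xx').
have [u0' ui'] := iv t' x' t's hx'.
have -> : (u t x)^-1 - (u t' x')^-1 = (u t x)^-1 * (u t' x')^-1 * (u t' x' - u t x).
  by field; rewrite (lt0r_neq0 u0) (lt0r_neq0 u0').
rewrite !normrM distrC [`|(u t x)^-1|]ger0_norm ?invr_ge0 ?(ltW u0) //.
rewrite [`|(u t' x')^-1|]ger0_norm ?invr_ge0 ?(ltW u0') //.
apply: (@le_trans _ _ (c^-1 * c^-1 * (C * e))).
  apply: ler_pM => //; first by rewrite mulr_ge0 ?invr_ge0 ?(ltW u0) ?(ltW u0').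
    by apply: ler_pM => //; rewrite invr_ge0 ltW.
  exact: h2.
by rewrite mulrDl mulrA lerDr mulr_ge0.
Qed.

End Lip.

End Realization.

Section Continuity.
Context (R : realType) (Z Z' : choiceType).
Implicit Types (K : set (set Z)) (L : set (set Z')) (s : set Z).

(* Each point (t, x) has a product neighbourhood by the tube lemma, applied to
   a compact interval around x. *)
Lemma realization_homotopy_continuous K L (H : realization R K -> R -> realization R L) :
  (forall s, K s -> exists (N : nat) (tau : nat -> set Z') (r : seq Z'),
    [/\ forall i, (i < N)%N -> L (tau i),
        forall t x, support_of (sval t) `<=` s -> 0 <= x <= 1 ->
          exists2 i, (i < N)%N & support_of (sval (H t x)) `<=` tau i,
        forall t x, support_of (sval t) `<=` s -> 0 <= x <= 1 ->
          support_of (sval (H t x)) `<=` [set` r] &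
        forall z, lip s (fun t x => sval (H t x) z)]) ->
  continuous (fun p : realization R K * R => H p.1 (clamp p.2)).
Proof.
move=> hH.
(* Coordinates outside [r] vanish, so the finitely many Lipschitz constants add up to one that
   serves every coordinate; the extra 1 makes it positive. *)
have {}hH s : K s -> exists (N : nat) (tau : nat -> set Z') (C : R),
    [/\ forall i, (i < N)%N -> L (tau i),
        forall t x, support_of (sval t) `<=` s ->
          exists2 i, (i < N)%N & support_of (sval (H t (clamp x))) `<=` tau i, 0 < C &
        forall t x t' x' e z, support_of (sval t) `<=` s -> support_of (sval t') `<=` s ->
         (forall z, `|sval t z - sval t' z| <= e) -> `|x - x'| <= e ->
         `|sval (H t (clamp x)) z - sval (H t' (clamp x')) z| <= C * e].
  move=> /hH[N [tau [r [tauL Htau Hr /choice[C hC]]]]].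
  have C0 z : 0 <= C z by case: (hC z).
  exists N, tau, (1 + \sum_(z <- undup r) C z); split => //.
  - by move=> t x ts; apply: Htau => //; exact: clamp_itv.
  - by rewrite ltr_wpDr // sumr_ge0.
  - move=> t x t' x' e z ts t's tt' xx'.
    have e0 : 0 <= e by rewrite (le_trans _ xx').
    have [zr|zr] := boolP (z \in r); last first.
      have H0 t1 x1 : support_of (sval t1) `<=` s -> sval (H t1 (clamp x1)) z = 0.
        by move=> t1s; apply: contraNeq zr => /(Hr _ _ t1s (clamp_itv _)).
      by rewrite !H0 // subrr normr0 mulr_ge0 // addr_ge0 ?sumr_ge0.
    have [_ h] := hC z; have [_ h2] := h t (clamp x) ts (clamp_itv _).
    apply: (le_trans (h2 t' (clamp x') e t's (clamp_itv _) tt' (clamp_lip xx'))).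
    apply: ler_wpM2r => //; rewrite ler_wpDl //.
    by rewrite (bigD1_seq z) ?mem_undup ?undup_uniq //= lerDl sumr_ge0.
move=> [t0 x0] U /=; rewrite nbhsE => -[V [oV Vt0] VU].
have oV' : realization_open V by [].
have [d d0 hd] : exists2 d, 0 < d & forall x, `|x0 - x| <= d -> V (H t0 (clamp x)).
  have [N [tau [C [tauL Htau C0 HC]]]] := hH _ (realization_simplex t0).
  have [e e0 he] := realization_open_near oV Vt0 tauL.
  (* Half of [e / C] turns the weak Lipschitz bound into the strict one that openness asks for. *)
  exists (e / (C + C)); first by rewrite divr_gt0 // addr_gt0.
  move=> x xd; apply: he; first exact: Htau.
  move=> z; have t00 z0 : `|sval t0 z0 - sval t0 z0| <= e / (C + C).
    by rewrite subrr normr0 divr_ge0 ?addr_ge0 // ltW.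
  apply: (le_lt_trans (HC _ _ _ _ _ _ _ _ t00 xd)) => //.
  rewrite mulrCA gtr_pMr // ltr_pdivrMr ?addr_gt0 // mul1r.
  by rewrite ltrDl.
pose J := `[x0 - d, x0 + d]%classic.
have Jd x : J x <-> `|x0 - x| <= d.
  by rewrite /J /= in_itv /= ler_norml; split=> /andP[? ?]; apply/andP; split; lra.
pose A : set (realization R K) := [set t | forall x, J x -> V (H t (clamp x))].
have oA : open A.
  move=> s Ks t At ts.
  have [N [tau [C [tauL Htau C0 HC]]]] := hH _ Ks.
  (* [P e x] says that the radius [e] works at time [x]. Compactness of [J] replaces radii that
     depend on the time by a single one. *)
  pose P (e x : R) := forall t' : realization R K, support_of (sval t') `<=` s ->
    (forall z, `|sval t z - sval t' z| < e) -> V (H t' (clamp x)).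
  have : \forall e \near 0^'+, J `<=` P e.
    apply: ((compact_near_coveringP _).1 (@segment_compact _ _ _)).
    move=> x Jx; have [e e0 he] := realization_open_near oV (At x Jx) tauL.
    pose n := e / (C + C).
    have n0 : 0 < n by rewrite divr_gt0 // addr_gt0.
    exists ([set x' | `|x - x'| < n], [set e' | e' < n]) => /=.
      split; last exact: nbhs_right_lt.
      by apply/nbhs_normP; exists n.
    move=> [x' e'] /= [xx' e'n] t' t's tt'; apply: he; first exact: Htau.
    move=> z; apply: (@le_lt_trans _ _ (C * n)).
      by apply: HC => //; [move=> z'; rewrite ltW // (lt_trans (tt' z'))|exact: ltW].
    rewrite /n mulrCA gtr_pMr // ltr_pdivrMr ?addr_gt0 // mul1r.
    by rewrite ltrDl.
  move=> near0.
  have [e [e0 he]] := @filter_ex _ _ _ _ (filterI (@nbhs_right_gt R 0) near0).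
  by exists e => // t' t's tt' x Jx; apply: he.
have At0 : A t0 by move=> x /Jd; exact: hd.
exists (A, J) => /=; last by move=> [t x] [/= At Jx]; apply: VU; apply: At.
split; first by apply: open_nbhs_nbhs; split.
by apply/nbhs_normP; exists d => // x /= xd; apply/Jd; exact: ltW.
Qed.

Lemma realization_map_continuous K L (f : realization R K -> realization R L) :
  (forall s, K s -> exists (N : nat) (tau : nat -> set Z') (r : seq Z'),
    [/\ forall i, (i < N)%N -> L (tau i),
        forall t, support_of (sval t) `<=` s ->
          exists2 i, (i < N)%N & support_of (sval (f t)) `<=` tau i,
        forall t, support_of (sval t) `<=` s ->
          support_of (sval (f t)) `<=` [set` r] &
        forall z, lip s (fun t _ => sval (f t) z)]) ->
  continuous f.
Proof.
move=> hf; have cH := @realization_homotopy_continuous K L (fun t _ => f t).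
have c0 : continuous (fun t : realization R K => (t, 0 : R)).
  by apply: (@continuous_pair _ _ _ idfun) => [?|]; [exact: cvg_id|exact: cst_continuous].
apply: (continuous_comp2 c0 (g := fun p => f p.1)).
apply: cH => s Ks; have [N [tau [r [h1 h2 h3 h4]]]] := hf s Ks.
by exists N, tau, r; split=> // *; [exact: h2|exact: h3].
Qed.

End Continuity.

(** * Collapses *)

Section Collapse.
Context (R : realType) (Z : choiceType).
Implicit Types (s : set Z).

Definition partial_image (f : Z -> option Z) s : set Z :=
  [set z | exists2 y, s y & f y = Some z].

Definition meets s (P : set Z) := exists2 z, s z & P z.
Definition misses s (P : set Z) := forall z, s z -> ~ P z.

Lemma misses_meets s P : ~ meets s P -> misses s P.
Proof. by move=> h z sz Pz; apply: h; exists z. Qed.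

Lemma partial_image_seq f (r : seq Z) : partial_image f [set` r] = [set` pmap f r].
Proof.
apply/seteqP; split=> z /=.
  move=> [y yr fy]; rewrite mem_pmap; apply/mapP; exists y => //; exact/esym.
by rewrite mem_pmap => /mapP[y yr fy]; exists y.
Qed.

Variables (K : set (set Z)) (cK : complex K) (f : Z -> option Z) (P1 P2 P3 : set Z).
Hypothesis push : forall s, K s -> meets s P1 -> meets s P2 -> meets s P3 ->
  K (s `|` partial_image f s).
(** Moved mass lands outside the three sets, so these only lose mass. Mass taken from [P1] is never
    discarded, which keeps the total mass away from 0. *)
Hypothesis push_out : forall y z, f y = Some z -> [/\ ~ P1 z, ~ P2 z & ~ P3 z].
Hypothesis push_def : forall z, P1 z -> f z <> None.

Let L : set (set Z) := [set s | K s /\ [\/ misses s P1, misses s P2 | misses s P3]].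
Local Notation real := (realization R K).
Implicit Types (t : real) (x : R).

Let mass (P : set Z) t : R := \sum_(z \in [set: Z]) (if z \in P then sval t z else 0).
Let m t := Num.min (mass P1 t) (Num.min (mass P2 t) (mass P3 t)).
(** Time runs backwards: nothing is moved at [x = 1], and the full amount is moved at [x = 0], where
    the image lies in [L]. *)
Let cut t x z := Num.min (sval t z) ((1 - x) * m t).
Let w t x z := sval t z - cut t x z +
  \sum_(y \in [set: Z]) (if f y == Some z then cut t x y else 0).
Let W t x := \sum_(y \in [set: Z]) (sval t y - (if f y == None then cut t x y else 0)).

Section OnSimplex.
Variables (r : seq Z) (ur : uniq r).

Local Lemma mass_seq P t : support_of (sval t) `<=` [set` r] ->
  mass P t = \sum_(z <- r) (if z \in P then sval t z else 0).
Proof.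
move=> tr; rewrite /mass (fsum_seq ur) // => z.
by case: ifP => _ h; [exact: tr|rewrite eqxx in h].
Qed.

Local Lemma mass_ge0 P t : support_of (sval t) `<=` [set` r] -> 0 <= mass P t.
Proof.
by move=> /mass_seq ->; apply: sumr_ge0 => z _; case: ifP => // _; exact: realization_ge0.
Qed.

Local Lemma le_mass P t z : support_of (sval t) `<=` [set` r] -> P z -> sval t z <= mass P t.
Proof.
move=> tr Pz; have [zr|zr] := boolP (z \in r); last first.
  have -> : sval t z = 0 by apply: contraNeq zr => /tr.
  exact: mass_ge0.
rewrite mass_seq // (bigD1_seq z) //= mem_set // lerDl sumr_ge0 // => y _.
by case: ifP => // _; exact: realization_ge0.
Qed.

Local Lemma mass_misses P t : support_of (sval t) `<=` [set` r] ->
  misses (support_of (sval t)) P -> mass P t = 0.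
Proof.
move=> tr tP; rewrite mass_seq // big1 // => z _; case: ifP => // /set_mem Pz.
by apply/eqP; apply: contraPT Pz => /tP.
Qed.

Local Lemma mass_meets P t : support_of (sval t) `<=` [set` r] ->
  mass P t != 0 -> meets (support_of (sval t)) P.
Proof.
move=> tr; apply: contra_neqP => h; apply: mass_misses => //.
exact: misses_meets.
Qed.

Local Lemma m_ge0 t : support_of (sval t) `<=` [set` r] -> 0 <= m t.
Proof. by move=> tr; rewrite /m !le_min !mass_ge0. Qed.

Local Lemma cut_ge0 t x z : support_of (sval t) `<=` [set` r] -> 0 <= x <= 1 -> 0 <= cut t x z.
Proof.
move=> tr /andP[x0 x1]; rewrite /cut le_min realization_ge0 mulr_ge0 ?m_ge0 //.
by rewrite subr_ge0.
Qed.

Local Lemma cut_le t x z : cut t x z <= sval t z.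
Proof. by rewrite /cut ge_min lexx. Qed.

Local Lemma cut_out t x z : support_of (sval t) `<=` [set` r] -> 0 <= x <= 1 ->
  sval t z = 0 -> cut t x z = 0.
Proof.
move=> tr hx t0; apply/eqP; rewrite eq_le cut_ge0 // andbT.
by rewrite -t0 cut_le.
Qed.

Local Lemma cut_supp t x z : support_of (sval t) `<=` [set` r] -> 0 <= x <= 1 ->
  cut t x z != 0 -> support_of (sval t) z.
Proof. by move=> tr hx; apply: contra_neq => /cut_out ->. Qed.

Local Lemma w_seq t x z : support_of (sval t) `<=` [set` r] -> 0 <= x <= 1 ->
  w t x z = sval t z - cut t x z + \sum_(y <- r) (if f y == Some z then cut t x y else 0).
Proof.
move=> tr hx; rewrite /w (fsum_seq ur) // => y.
by case: ifP => _ h; [exact: (tr _ (cut_supp tr hx h))|rewrite eqxx in h].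
Qed.

Local Lemma W_seq t x : support_of (sval t) `<=` [set` r] -> 0 <= x <= 1 ->
  W t x = \sum_(y <- r) (sval t y - (if f y == None then cut t x y else 0)).
Proof.
move=> tr hx; rewrite /W (fsum_seq ur) // => y h; apply: (tr); apply: contraNneq h => t0.
by rewrite t0 cut_out // if_same subrr.
Qed.

Local Lemma w_ge0 t x z : support_of (sval t) `<=` [set` r] -> 0 <= x <= 1 -> 0 <= w t x z.
Proof.
move=> tr hx; rewrite w_seq // addr_ge0 ?subr_ge0 ?cut_le // sumr_ge0 // => y _.
by case: ifP => // _; exact: cut_ge0.
Qed.

Local Lemma w_supp t x z : support_of (sval t) `<=` [set` r] -> 0 <= x <= 1 -> w t x z != 0 ->
  (support_of (sval t) `|` partial_image f (support_of (sval t))) z.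
Proof.
move=> tr hx; rewrite w_seq //; have [t0|tz _] := eqVneq (sval t z) 0; last by left.
rewrite t0 cut_out // subrr add0r => h; right; apply: contrapT => h'.
move/eqP: h; apply; apply: big1 => y _; case: eqP => // fy.
by apply/eqP/negPn/negP => hc; apply: h'; exists y => //; exact: (cut_supp tr hx hc).
Qed.

(** After exchanging the two sums, the mass cut from [y] reappears at the value of [f y] and
    cancels, except where [f] is undefined. *)
Local Lemma sum_w t x (r' : seq Z) : uniq r' -> {subset r <= r'} -> {subset pmap f r <= r'} ->
  support_of (sval t) `<=` [set` r] -> 0 <= x <= 1 ->
  \sum_(z <- r') w t x z = W t x.
Proof.
move=> ur' rr' fr' tr hx.
have -> : \sum_(z <- r') w t x z = \sum_(z <- r') (sval t z - cut t x z) +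
    \sum_(y <- r) \sum_(z <- r') (if f y == Some z then cut t x y else 0).
  rewrite exchange_big /= -big_split /=; apply: eq_bigr => z _; exact: w_seq.
have -> : \sum_(z <- r') (sval t z - cut t x z) = \sum_(z <- r) (sval t z - cut t x z).
  have h z : sval t z - cut t x z != 0 -> z \in r.
    move=> h; apply: (tr); apply: contraNneq h => t0.
    by rewrite t0 cut_out // subrr.
  by rewrite -(fsum_seq ur h) (fsum_seq ur') // => z /h /rr'.
rewrite W_seq // -big_split /= big_seq [RHS]big_seq; apply: eq_bigr => y yr.
case fy: (f y) => [z|] /=.
  have zr' : z \in r' by apply: fr'; rewrite mem_pmap; apply/mapP; exists y.
  rewrite (bigD1_seq z) //= eqxx big1 ?addr0 ?subr0 ?subrK // => z' /negbTE z'z.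
  by case: eqP => // -[zz]; rewrite zz eqxx in z'z.
by rewrite big1 ?addr0.
Qed.

(** Two bounds compete: [W] is at least [m], because the mass of [P1] survives, and at least 1 - N m
    for N = [size r], because each vertex loses at most [m]. Whichever side of 1 / (N + 1) contains
    [m], one of them gives 1 / (N + 1). *)
Local Lemma W_lower t x : support_of (sval t) `<=` [set` r] -> 0 <= x <= 1 ->
  ((size r).+1%:R)^-1 <= W t x.
Proof.
move=> tr hx; have [x0 x1] := andP hx.
have m0 := m_ge0 tr.
have cm z : cut t x z <= m t.
  rewrite /cut ge_min; apply/orP; right.
  by apply: ler_piMl => //; rewrite gerBl.
have Wm : m t <= W t x.
  rewrite (@le_trans _ _ (mass P1 t)) ?ge_min ?lexx // mass_seq // W_seq //.
  apply: ler_sum => y _; case: ifP => [/set_mem/push_def|_].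
    by case: (f y) => // z _ /=; rewrite subr0.
  by rewrite subr_ge0; case: ifP => _; rewrite ?cut_le ?realization_ge0.
have W1 : 1 - (size r)%:R * m t <= W t x.
  rewrite W_seq // sumrB (realization_sum1 ur tr) lerD2l lerN2.
  rewrite -sum1_size natr_sum mulr_suml; apply: ler_sum => y _; rewrite mul1r.
  by case: ifP.
set N := (size r)%:R in W1 *; have N0 : 0 <= N :> R by rewrite ler0n.
have [h|h] := leP ((size r).+1%:R)^-1 (m t); first exact: le_trans Wm.
apply: le_trans W1; set c := (_ %:R)^-1 in h *.
have e : c * N + c = 1.
  by rewrite -[X in _ + X]mulr1 -mulrDr natr1 mulVf // pnatr_eq0.
have : N * m t <= N * c by apply: ler_wpM2l => //; exact: ltW.
by rewrite [N * c]mulrC; lra.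
Qed.

Local Lemma lip_mass P : K [set` r] -> lip [set` r] (fun t _ => mass P t).
Proof.
move=> Kr; apply: (lip_ext (u := fun t _ => \sum_(z <- r) (if z \in P then sval t z else 0))).
  by move=> t x tr _; rewrite mass_seq.
apply: (lip_sum (u := fun z t _ => if z \in P then sval t z else 0)) => z _.
by case: (z \in P); [exact: lip_coord|exact: lip_cst].
Qed.

Local Lemma lip_cut z : K [set` r] -> lip [set` r] (fun t x => cut t x z).
Proof.
move=> Kr; apply: lip_min; first exact: lip_coord.
apply: lipM.
  by apply: lipD; [exact: lip_cst|apply: lipN; exact: lip_time].
by apply: lip_min; [exact: lip_mass|apply: lip_min; exact: lip_mass].
Qed.

Local Lemma lip_H z : K [set` r] -> lip [set` r] (fun t x => w t x z / W t x).
Proof.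
move=> Kr; apply: lipM.
  apply: (lip_ext (u := fun t x => sval t z - cut t x z +
      \sum_(y <- r) (if f y == Some z then cut t x y else 0))).
    by move=> t x tr hx; rewrite w_seq.
  apply: lipD.
    by apply: lipD; [exact: lip_coord|apply: lipN; exact: lip_cut].
  apply: (lip_sum (u := fun y t x => if f y == Some z then cut t x y else 0)) => y _.
  by case: (f y == Some z); [exact: lip_cut|exact: lip_cst].
apply: (@lip_inv _ _ _ _ _ (((size r).+1%:R)^-1)).
- by rewrite invr_gt0 ltr0n.
- exact: W_lower.
- apply: (lip_ext (u := fun t x =>
    \sum_(y <- r) (sval t y - (if f y == None then cut t x y else 0)))).
    by move=> t x tr hx; rewrite W_seq.
  apply: (lip_sum (u := fun y t x => sval t y - (if f y == None then cut t x y else 0))) => y _.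
  apply: lipD; first exact: lip_coord.
  by apply: lipN; case: (f y == None); [exact: lip_cut|exact: lip_cst].
Qed.

Local Lemma m_meets t : support_of (sval t) `<=` [set` r] -> m t != 0 ->
  [/\ meets (support_of (sval t)) P1, meets (support_of (sval t)) P2 &
      meets (support_of (sval t)) P3].
Proof.
move=> tr mt0.
have : 0 < m t by rewrite lt_def mt0 m_ge0.
by rewrite /m !lt_min => /and3P[h1 h2 h3]; split; apply: mass_meets => //; rewrite lt0r_neq0.
Qed.

Local Lemma w_m0 t x z : support_of (sval t) `<=` [set` r] -> 0 <= x <= 1 ->
  (1 - x) * m t = 0 -> w t x z = sval t z.
Proof.
move=> tr hx m0; have c0 y : cut t x y = 0 by rewrite /cut m0 min_r // realization_ge0.
by rewrite w_seq // c0 subr0 big1 ?addr0 // => y _; rewrite c0 if_same.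
Qed.

Local Lemma W_m0 t x : support_of (sval t) `<=` [set` r] -> 0 <= x <= 1 ->
  (1 - x) * m t = 0 -> W t x = 1.
Proof.
move=> tr hx m0; have c0 y : cut t x y = 0 by rewrite /cut m0 min_r // realization_ge0.
rewrite W_seq //; apply: etrans (realization_sum1 ur tr); apply: eq_bigr => y _.
by rewrite c0 if_same subr0.
Qed.

Local Lemma w_K t x : support_of (sval t) `<=` [set` r] -> 0 <= x <= 1 ->
  K (support_of (w t x)).
Proof.
move=> tr hx; have [m0|m0] := eqVneq ((1 - x) * m t) 0.
  rewrite (_ : w t x = sval t); first exact: realization_simplex.
  by apply/funext => z; exact: w_m0.
have mt0 : m t != 0 by apply: contraNneq m0 => ->; rewrite mulr0.
have [h1 h2 h3] := m_meets tr mt0.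
apply: (cK.2 _ _ (push (realization_simplex t) h1 h2 h3)) => z.
exact: w_supp.
Qed.

(** For the set [P] whose mass is [m t], each vertex carries at most [m t], so its cut is its whole
    coordinate, and [push_out] brings nothing back. *)
Local Lemma w_L t : support_of (sval t) `<=` [set` r] -> L (support_of (w t 0)).
Proof.
move=> tr; have h01 : 0 <= (0 : R) <= 1 by exact: (le01_0 R).
split; first exact: w_K.
have key P : m t = mass P t -> (forall y z, f y = Some z -> ~ P z) ->
    misses (support_of (w t 0)) P.
  move=> mP fP z; rewrite /support_of /= => wz Pz; move/eqP: wz; apply.
  rewrite w_seq // {1}/cut subr0 mul1r mP min_l ?le_mass // subrr add0r.
  by apply: big1 => y _; case: eqP => // /fP.
have : [\/ m t = mass P1 t, m t = mass P2 t | m t = mass P3 t].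
  by rewrite /m; case: leP => ?; [constructor 1|case: leP => ?; [constructor 2|constructor 3]].
by case=> mP; [constructor 1|constructor 2|constructor 3]; apply: key => // y z /push_out[].
Qed.

Local Lemma W_gt0 t x : support_of (sval t) `<=` [set` r] -> 0 <= x <= 1 -> 0 < W t x.
Proof. by move=> tr hx; apply: lt_le_trans (W_lower tr hx); rewrite invr_gt0 ltr0n. Qed.

Local Lemma h_support t x : support_of (sval t) `<=` [set` r] -> 0 <= x <= 1 ->
  support_of (fun z => w t x z / W t x) = support_of (w t x).
Proof.
move=> tr hx; apply/seteqP; split=> z; rewrite /support_of /= mulf_eq0 invr_eq0.
  by rewrite negb_or => /andP[].
by move=> h; rewrite negb_or h lt0r_neq0 ?W_gt0.
Qed.

Local Lemma h_sum1 t x : support_of (sval t) `<=` [set` r] -> 0 <= x <= 1 ->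
  \sum_(z \in [set: Z]) (w t x z / W t x) = 1.
Proof.
move=> tr hx; pose r' := undup (r ++ pmap f r).
have rr' : {subset r <= r'} by move=> z zr; rewrite mem_undup mem_cat zr.
have fr' : {subset pmap f r <= r'} by move=> z zr; rewrite mem_undup mem_cat zr orbT.
rewrite (fsum_seq (undup_uniq (r ++ pmap f r))).
  rewrite -mulr_suml sum_w ?undup_uniq // divff // lt0r_neq0 //; exact: W_gt0.
move=> z; rewrite mulf_eq0 negb_or => /andP[/(w_supp tr hx) wz _].
case: wz => [/tr/rr'//|[y /tr /= yr fy]]; apply: fr'.
by rewrite mem_pmap; apply/mapP; exists y.
Qed.

Local Lemma h_realization t x : support_of (sval t) `<=` [set` r] -> 0 <= x <= 1 ->
  [/\ forall z, 0 <= w t x z / W t x, K (support_of (fun z => w t x z / W t x)) &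
      \sum_(z \in [set: Z]) (w t x z / W t x) = 1].
Proof.
move=> tr hx; split.
- by move=> z; rewrite divr_ge0 ?w_ge0 // ltW // W_gt0.
- by rewrite h_support //; exact: w_K.
- exact: h_sum1.
Qed.

Local Lemma h_realizationL t : support_of (sval t) `<=` [set` r] ->
  [/\ forall z, 0 <= w t 0 z / W t 0, L (support_of (fun z => w t 0 z / W t 0)) &
      \sum_(z \in [set: Z]) (w t 0 z / W t 0) = 1].
Proof.
have h01 : 0 <= (0 : R) <= 1 by exact: (le01_0 R).
move=> tr; have [h1 h2 h3] := h_realization tr h01; split=> //.
by rewrite h_support //; exact: w_L.
Qed.

End OnSimplex.

Let h_point t x : 0 <= x <= 1 ->
  [/\ forall z, 0 <= w t x z / W t x, K (support_of (fun z => w t x z / W t x)) &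
      \sum_(z \in [set: Z]) (w t x z / W t x) = 1].
Proof.
move=> hx; have [r ur tr] := finite_uniq_seq (cK.1 _ (realization_simplex t)).
by apply: (h_realization ur) => //; rewrite tr.
Qed.

Let h_pointL t :
  [/\ forall z, 0 <= w t 0 z / W t 0, L (support_of (fun z => w t 0 z / W t 0)) &
      \sum_(z \in [set: Z]) (w t 0 z / W t 0) = 1].
Proof.
have [r ur tr] := finite_uniq_seq (cK.1 _ (realization_simplex t)).
by apply: (h_realizationL ur) => //; rewrite tr.
Qed.

Let H t x : real := exist _ _ (h_point t (clamp_itv x)).
Let F t : realization R L := exist _ _ (h_pointL t).

Let L_K s : L s -> K s. Proof. by case. Qed.
Let incl (t : realization R L) : real :=
  exist _ (sval t) (let: And3 p q r := svalP t in And3 p (L_K q) r).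

(** On a simplex that meets all three sets the whole homotopy stays in its union with its image; on
    any other simplex [m] vanishes and nothing moves. *)
Let simplex_hull s (r : seq Z) : uniq r -> s = [set` r] -> K s ->
  exists2 s', K s' & forall t x, support_of (sval t) `<=` s -> 0 <= x <= 1 ->
    support_of (w t x) `<=` s' /\ s `<=` s'.
Proof.
move=> ur sr Ks.
have [[h1 h2 h3]|hN] := pselect [/\ meets s P1, meets s P2 & meets s P3].
  exists (s `|` partial_image f s); first exact: push.
  move=> t x ts hx; split=> [z wz|]; last exact: subsetUl.
  have tr : support_of (sval t) `<=` [set` r] by rewrite -sr.
  have [/ts|[y /ts sy fy]] := w_supp ur tr hx wz; [by left|by right; exists y].
exists s => // t x ts hx; split=> // z; rewrite /support_of /=.
have tr : support_of (sval t) `<=` [set` r] by rewrite -sr.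
rewrite (w_m0 ur) //; first exact: ts.
have -> : m t = 0; last by rewrite mulr0.
apply: contrapT => /eqP /(m_meets ur tr)[[z1 ? ?] [z2 ? ?] [z3 ? ?]]; apply: hN.
by split; [exists z1|exists z2|exists z3] => //; exact: ts.
Qed.

Let H_continuous : continuous (fun p : real * R => H p.1 (clamp p.2)).
Proof.
apply: realization_homotopy_continuous => s Ks.
have [r ur sr] := finite_uniq_seq (cK.1 _ Ks).
have [s' Ks' hs'] := simplex_hull ur sr Ks.
have [r' ur' sr'] := finite_uniq_seq (cK.1 _ Ks').
have supp t x : support_of (sval t) `<=` s -> 0 <= x <= 1 -> support_of (sval (H t x)) `<=` s'.
  move=> ts hx; rewrite /H /= (h_support ur) ?clamp_itv -?sr //.
  exact: (hs' _ _ ts (clamp_itv _)).1.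
exists 1%N, (fun=> s'), r'; split=> //.
- by move=> t x ts hx; exists 0%N => //; exact: supp.
- by move=> t x ts hx; rewrite -sr'; exact: supp.
- move=> z; rewrite sr; apply: (lip_ext _ (lip_H ur z _)); last by rewrite -sr.
  by move=> t x tr hx; rewrite /= clamp_id.
Qed.

Let F_continuous : continuous F.
Proof.
apply: realization_map_continuous => s Ks.
have [r ur sr] := finite_uniq_seq (cK.1 _ Ks).
have [s' Ks' hs'] := simplex_hull ur sr Ks.
have [r' ur' sr'] := finite_uniq_seq (cK.1 _ Ks').
have h01 : 0 <= (0 : R) <= 1 by exact: (le01_0 R).
have supp t : support_of (sval t) `<=` s -> support_of (sval (F t)) `<=` s'.
  move=> ts; rewrite /F /= (h_support ur) -?sr //.
  exact: (hs' _ _ ts h01).1.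
(* The retraction need not send a simplex into a single simplex of [L]: which set is annihilated
   depends on the point. Removing each set from [s'] gives three simplices that cover all cases. *)
exists 3%N, (fun i => s' `\` (if i is 0%N then P1 else if i is 1%N then P2 else P3)), r'; split.
- move=> i i3; split; first by apply: (cK.2 _ _ Ks'); exact: subDsetl.
  by case: i i3 => [|[|[|]]] // _; [constructor 1|constructor 2|constructor 3] => z [].
- move=> t ts; have [_ hm] := realization_simplex (F t); have st := supp _ ts.
  by case: hm => hm; [exists 0%N|exists 1%N|exists 2%N] => // z sz; split;
    [exact: st|exact: hm|exact: st|exact: hm|exact: st|exact: hm].
- by move=> t ts; rewrite -sr'; exact: supp.
- move=> z; have [|C [C0 hC]] := lip_H ur z; first by rewrite -sr.
  exists C; split=> // t x; rewrite sr => tr hx.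
  have [h1 h2] := hC t 0 tr h01; split=> // t' x' e t'r hx' tt' xx'.
  apply: h2 => //; rewrite subrr normr0; exact: le_trans xx'.
Qed.

Let incl_continuous : continuous incl.
Proof.
apply: realization_map_continuous => s [Ks hs].
have [r ur sr] := finite_uniq_seq (cK.1 _ Ks).
exists 1%N, (fun=> s), r; split=> //; first by move=> t ts; exists 0%N.
  by move=> t ts; rewrite -sr.
move=> z; apply: lip_coord; split=> [s0 [/(cK.1 s0)]//|s0 s1 [Ks0 hs0] s10].
split; first exact: cK.2 Ks0 s10.
by case: hs0 => h; [constructor 1|constructor 2|constructor 3] => y /s10; exact: h.
Qed.

Let H1 t x : (1 - x) * m t = 0 -> 0 <= x <= 1 -> forall z, sval (H t x) z = sval t z.
Proof.
move=> h hx z; rewrite /H /= clamp_id //.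
have [r ur tr] := finite_uniq_seq (cK.1 _ (realization_simplex t)).
have tr' : support_of (sval t) `<=` [set` r] by rewrite tr.
by rewrite (w_m0 ur) // (W_m0 ur) // divr1.
Qed.

Theorem collapse (L' : set (set Z)) :
  (forall s, L' s <-> K s /\ [\/ misses s P1, misses s P2 | misses s P3]) ->
  homotopy_equivalent R (realization R K) (realization R L').
Proof.
move=> LL'; have -> : L' = L by apply/seteqP; split=> s /LL'.
have h01 : 0 <= (0 : R) <= 1 by exact: (le01_0 R).
have h11 : 0 <= (1 : R) <= 1 by exact: (le01_1 R).
exists F, incl; split=> //.
- apply/homotopicP; exists (fun p => H p.1 (clamp p.2)); split=> //.
  + by move=> t; apply: realization_eq => z /=; rewrite clamp_id ?clamp_id.
  + move=> t; apply: realization_eq => z; rewrite [clamp _]clamp_id // H1 //.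
    by rewrite subrr mul0r.
- rewrite (_ : F \o incl = idfun); first by apply: homotopic_refl => ?; exact: cvg_id.
  apply/funext => t; apply: realization_eq => z /=.
  have [r ur tr] := finite_uniq_seq (cK.1 _ (realization_simplex (incl t))).
  have tr' : support_of (sval (incl t)) `<=` [set` r] by rewrite tr.
  have m0 : m (incl t) = 0.
    apply: contrapT => /eqP /(m_meets ur tr')[[z1 ? ?] [z2 ? ?] [z3 ? ?]].
    by have [_ [h|h|h]] := realization_simplex t; [apply: (h z1)|apply: (h z2)|apply: (h z3)].
  by rewrite (w_m0 ur) ?(W_m0 ur) ?m0 ?mulr0 // divr1.
Qed.

End Collapse.

(** * Moves between complexes *)

Section Moves.
Context (R : realType) (Z : choiceType).
Implicit Types (K L : set (set Z)) (s Q : set Z).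

Definition heq K L := homotopy_equivalent R (realization R K) (realization R L).

Lemma complexU K L : complex K -> complex L -> complex (K `|` L).
Proof.
move=> [fK dK] [fL dL]; split=> [s [/fK|/fL]//|s s' [Ks|Ls] ss'].
  by left; exact: dK ss'.
by right; exact: dL ss'.
Qed.

Definition full Q : set (set Z) := [set s | finite_set s /\ s `<=` Q].

Lemma full_complex Q : complex (full Q).
Proof.
split=> [s []//|s s' [fs sQ] s's]; split; first exact: sub_finite_set fs.
exact: subset_trans sQ.
Qed.

(** Vertices with the same image under [g] become interchangeable, so a simplex may contain a vertex
    together with its clone. *)
Definition pull (g : Z -> Z) K Q : set (set Z) :=
  [set s | [/\ finite_set s, s `<=` Q & K (g @` s)]].

Lemma pull_complex g K Q : complex K -> complex (pull g K Q).
Proof.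
move=> [_ dK]; split=> [s []//|s s' [fs sQ Ks] s's]; split.
- exact: sub_finite_set fs.
- exact: subset_trans sQ.
- by apply: dK Ks _; exact: image_subset.
Qed.

Lemma heq_trans K L M : heq K L -> heq L M -> heq K M.
Proof. exact: homotopy_equivalent_trans. Qed.

Lemma heq_sym K L : heq K L -> heq L K.
Proof. exact: homotopy_equivalent_sym. Qed.

Lemma collapse_pair K L (f : Z -> option Z) (P Q : set Z) : complex K ->
  (forall s, K s -> meets s P -> meets s Q -> K (s `|` partial_image f s)) ->
  (forall y z, f y = Some z -> ~ P z /\ ~ Q z) ->
  (forall z, P z -> f z <> None) ->
  (forall s, L s <-> K s /\ (misses s P \/ misses s Q)) -> heq K L.
Proof.
move=> cK push out def LE; apply: (@collapse R Z K cK f P Q Q) => //.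
- by move=> s Ks h1 h2 _; exact: push.
- by move=> y z /out[].
- move=> s; rewrite LE; split=> -[Ks h]; split=> //.
    by case: h; [constructor 1|constructor 2].
  by case: h => ?; [left|right|right].
Qed.

Lemma collapse_to v K L (P Q : set Z) : complex K ->
  (forall s, K s -> meets s P -> meets s Q -> K (s `|` [set v])) ->
  ~ P v -> ~ Q v ->
  (forall s, L s <-> K s /\ (misses s P \/ misses s Q)) -> heq K L.
Proof.
move=> cK push Pv Qv; apply: (collapse_pair (f := fun=> Some v)) => //.
  move=> s Ks sP sQ; apply: (cK.2 _ _ (push s Ks sP sQ)) => z [|[y _ [<-]]]; first by left.
  by right.
by move=> y z [<-].
Qed.

(** * Replacing one of two overlapping complexes by a disjoint clone joined by an edge *)

Section Separate.
Variables (X Y B : set Z) (KX KY : set (set Z)) (phi pi : Z -> Z) (u : Z).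
Hypotheses (cX : complex KX) (cY : complex KY).
Hypotheses (KX_sub : forall s, KX s -> s `<=` X) (KY_sub : forall s, KY s -> s `<=` Y).
Hypotheses (phiB : forall y, Y y -> B (phi y)) (phiK : forall y, Y y -> pi (phi y) = y).
Hypotheses (piY : forall z, B z -> Y (pi z)).
Hypotheses (BX : forall z, B z -> ~ X z) (BY : forall z, B z -> ~ Y z).
Hypothesis (pi_out : forall z, ~ B z -> pi z = z).
Hypothesis (fullX : full (X `&` Y) `<=` KX) (fullY : full (X `&` Y) `<=` KY).
Hypotheses (Xu : X u) (Yu : Y u).

Let pipi z : pi (pi z) = pi z.
Proof.
apply: pi_out => Bpz; have [/piY Yz|Bz] := pselect (B z); first exact: BY Yz.
by apply: (Bz); rewrite -(pi_out Bz).
Qed.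

Let phiA : set Z := [set z | B z /\ X (pi z)].

Let pull_sub s s' Q : pull pi KY Q s -> finite_set s' -> s' `<=` Q ->
  (forall z, s' z -> (pi @` s) (pi z)) -> pull pi KY Q s'.
Proof.
by move=> [fs sQ Ks] fs' s'Q h; split=> //; apply: (cY.2 _ _ Ks) => _ [z s'z <-]; exact: h.
Qed.

Let finite_partial_image f s : finite_set s -> finite_set (partial_image f s).
Proof.
move=> /finite_seqP[r ->]; rewrite partial_image_seq; exact: finite_seq.
Qed.

(** A collapse read backwards: [pi] pushes every clone onto its original, and the simplices without
    clones remain. *)
Let clone_in : heq (KX `|` KY) (KX `|` pull pi KY (Y `|` B)).
Proof.
apply: heq_sym; apply: (@collapse_pair _ _ (Some \o pi) B B).
- by apply: complexU => //; exact: pull_complex.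
- move=> s [KXs|Ms] [z sz Bz] _; first by case: (BX Bz); exact: KX_sub sz.
  right; apply: (pull_sub Ms).
  + by rewrite finite_setU; split; [case: Ms|apply: finite_partial_image; case: Ms].
  + move=> y [|[x sx [<-]]]; first by case: Ms => _ + _; exact.
    by have [/piY ?|/pi_out->] := pselect (B x); [left|case: Ms => _ + _; exact].
  + move=> y [|[x sx [<-]]]; first by move=> sy; exists y.
    by exists x => //; rewrite pipi.
- move=> y z [<-]; have [/piY Yy|By] := pselect (B y).
    by split=> /BY.
  by rewrite pi_out.
- by [].
- move=> s; split.
    move=> [KXs|KYs].
      by split; [left|left=> z /(KX_sub KXs) Xz /BX].
    have Bs : misses s B by move=> z /(KY_sub KYs) Yz /BY.
    split; last by left.
    right; split; first exact: cY.1 KYs.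
      by move=> z /(KY_sub KYs); left.
    by apply: (cY.2 _ _ KYs) => _ [z sz <-]; rewrite pi_out //; exact: Bs.
  move=> [[KXs|[fs sQ KYs] h]]; first by left.
  have Bs : misses s B by case: h.
  right; apply: (cY.2 _ _ KYs) => z sz; exists z => //; apply: pi_out; exact: Bs.
Qed.

(** Now the originals outside [X] are pushed onto their clones, so that only the shared originals
    survive next to [B]. *)
Let clone_remove : heq (KX `|` pull pi KY (Y `|` B)) (KX `|` pull pi KY ((X `&` Y) `|` B)).
Proof.
pose P := Y `\` X; pose f z := Some (if pselect (P z) then phi z else z).
apply: (@collapse_pair _ _ f P P).
- by apply: complexU => //; exact: pull_complex.
- move=> s [KXs|Ms] [z sz Pz] _; first by case: Pz => _ []; exact: KX_sub sz.
  right; apply: (pull_sub Ms).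
  + by rewrite finite_setU; split; [case: Ms|apply: finite_partial_image; case: Ms].
  + have sQ y : s y -> (Y `|` B) y by case: Ms => _ + _; exact.
    move=> y [/sQ//|[x /sQ Qx [<-]]]; case: pselect => /= [[Yx _]|_] //; right; exact: phiB.
  + move=> y [|[x sx [<-]]]; first by move=> sy; exists y.
    by exists x => //; case: pselect => /= [[Yx _]|_] //; rewrite phiK //; apply: pi_out => /BY.
- move=> y z [<-]; suff : ~ P (if pselect (P y) then phi y else y) by [].
  by case: pselect => //= -[Yy _] [/(BY (phiB Yy))].
- by [].
- move=> s; split.
    move=> [KXs|[fs sQ KYs]].
      by split; [left|left=> z /(KX_sub KXs) Xz []].
    split; first by right; split=> // z /sQ[[]|]; [left|right].
    by left=> z /sQ[[Xz _] []|/BY h []].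
  move=> [[KXs|[fs sQ KYs] h]]; first by left.
  have Ps : misses s P by case: h.
  right; split=> // z sz; have [Yz|] := sQ z sz; last by right.
  by left; split=> //; apply: contrapT => Xz; apply: (Ps z sz).
Qed.

(** This uses a partial [f]: shared vertices move to their clones and all other cut mass is
    discarded. Leaving it in place would make vertices of [Q] targets, which [collapse_pair]
    forbids. The simplices that miss [Q] form a full simplex because of [fullY]. *)
Let clone_split : heq (KX `|` pull pi KY ((X `&` Y) `|` B))
  (KX `|` pull pi KY B `|` full ((X `&` Y) `|` phiA)).
Proof.
pose P := X `&` Y; pose Q := B `\` phiA.
pose f z := if pselect (P z) then Some (phi z) else None.
apply: (@collapse_pair _ _ f P Q).
- by apply: complexU => //; exact: pull_complex.
- move=> s [KXs _ [z sz [/BX[]]]|Ms _ _]; first exact: KX_sub sz.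
  right; apply: (pull_sub Ms).
  + by rewrite finite_setU; split; [case: Ms|apply: finite_partial_image; case: Ms].
  + move=> y [|[x sx]]; first by case: Ms => _ + _; exact.
    by rewrite /f; case: pselect => /= [[_ Yx] [<-]|//]; right; exact: phiB.
  + move=> y [|[x sx]]; first by move=> sy; exists y.
    rewrite /f; case: pselect => /= [[Xx Yx] [<-]|//].
    by rewrite phiK //; exists x => //; apply: pi_out => /BX.
- move=> y z; rewrite /f; case: pselect => /= [[Xy Yy] [<-]|//]; split.
    by move=> [/(BX (phiB Yy))].
  by move=> [_ []]; split; [exact: phiB|rewrite phiK].
- by move=> z Pz; rewrite /f; case: pselect.
- move=> s; split.
    move=> [[KXs|[fs sB KYs]]|[fs sQ]].
    + by split; [left|right=> z /(KX_sub KXs) Xz [/BX]].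
    + split; first by right; split=> // z /sB; right.
      by left=> z /sB /BX h [].
    + split; last by right=> z /sQ[[Xz _] [/BX]|? []].
      right; split=> //; first by move=> z /sQ[|[]]; [left|right].
      apply: fullY; split; first exact: finite_image.
      move=> _ [z /sQ + <-] => -[[Xz Yz]|[Bz Xz]]; last by split=> //; exact: piY.
      by rewrite pi_out // => /BX.
  move=> [[KXs|[fs sQ KYs] [h|h]]]; first by left; left.
    left; right; split=> // z sz; case: (sQ z sz) => // Pz; by case: (h z sz).
  right; split=> // z sz; have [|Bz] := sQ z sz; first by left.
  by right; apply: contrapT => h'; apply: (h z sz).
Qed.

(** The joining simplex is a cone with apex [u]. Its faces without clones are already in [KX] by
    [fullX]. *)
Let shrink_source : heq (KX `|` pull pi KY B `|` full ((X `&` Y) `|` phiA))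
  (KX `|` pull pi KY B `|` full ([set u] `|` phiA)).
Proof.
apply: (@collapse_to u _ _ ((X `&` Y) `\ u) B).
- by apply: complexU; [apply: complexU => //; exact: pull_complex|exact: full_complex].
- move=> s [[KXs|[fs sB KYs]]|[fs sQ]] [z sz [[Xz _] zu]] [y sy By].
  + by case: (BX By); exact: KX_sub sy.
  + by case: (BX (sB _ sz)).
  + right; split; first by rewrite finite_setU; split=> //; exact: finite_set1.
    by move=> x [/sQ//|->]; left.
- by case=> _ /(_ erefl).
- by move/BX.
- move=> s; split.
    move=> [[KXs|[fs sB KYs]]|[fs sQ]].
    + by split; [left; left|right=> z /(KX_sub KXs) Xz /BX].
    + by split; [left; right|left=> z /sB /BX h [[]]].
    + split; first by right; split=> // z /sQ[->|]; [left|right].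
      by left=> z /sQ[-> [_ /(_ erefl)]|[/BX h _] [[]]].
  move=> [[[KXs|Ms]|[fs sQ]] h]; [by left; left|by left; right|].
  case: h => h.
    right; split=> // z sz; have [Az|] := sQ z sz; last by right.
    by left; apply: contrapT => zu; apply: (h z sz).
  left; left; apply: fullX; split=> // z sz.
  by have [//|[Bz _]] := sQ z sz; case: (h z sz).
Qed.

(** Likewise with apex [phi u]: the faces that avoid [u] are already in the clone, by [fullY]. *)
Let shrink_target : heq (KX `|` pull pi KY B `|` full ([set u] `|` phiA))
  (KX `|` pull pi KY B `|` full [set u; phi u]).
Proof.
apply: (@collapse_to (phi u) _ _ [set u] (phiA `\ phi u)).
- by apply: complexU; [apply: complexU => //; exact: pull_complex|exact: full_complex].
- move=> s [[KXs|[fs sB KYs]]|[fs sQ]] [z sz zu] [y sy [[By _] _]].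
  + by case: (BX By); exact: KX_sub sy.
  + by case: (BX (sB _ sz)); rewrite zu.
  + right; split; first by rewrite finite_setU; split=> //; exact: finite_set1.
    move=> x [/sQ//|->]; right; split; first exact: phiB.
    by rewrite phiK.
- by move=> h; have := phiB Yu; rewrite h => /BX.
- by case=> _ /(_ erefl).
- move=> s; split.
    move=> [[KXs|[fs sB KYs]]|[fs sQ]].
    + by split; [left; left|right=> z /(KX_sub KXs) Xz [[/BX]]].
    + by split; [left; right|left=> z /sB /BX h zu; apply: h; rewrite zu].
    + split.
        right; split=> // z /sQ[|->]; [by left|right; split; first exact: phiB].
        by rewrite phiK.
      by right=> z /sQ[-> [[/BX]]|-> [_ /(_ erefl)]].
  move=> [[[KXs|Ms]|[fs sQ]] h]; [by left; left|by left; right|].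
  case: h => h.
    left; right; split=> //.
      by move=> z sz; have [zu|[]] := sQ z sz; first by case: (h z sz).
    apply: fullY; split; first exact: finite_image.
    move=> _ [z sz <-]; have [zu|[Bz Xz]] := sQ z sz; first by case: (h z sz).
    by split=> //; exact: piY.
  right; split=> // z sz; have [|Az] := sQ z sz; first by left.
  by right; apply: contrapT => h'; apply: (h z sz).
Qed.

Lemma separate : heq (KX `|` KY) (KX `|` pull pi KY B `|` full [set u; phi u]).
Proof.
apply: (heq_trans clone_in); apply: (heq_trans clone_remove).
apply: (heq_trans clone_split); exact: heq_trans shrink_source shrink_target.
Qed.

End Separate.

(** Being joined by an edge path of [K], encoded by its induction principle, so that any property
    stable under single edges transfers directly. *)
Definition linked K (a b : Z) := forall Q : set Z,
  Q a -> (forall x y, Q x -> K [set x; y] -> Q y) -> Q b.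

(** * Sliding and contracting an edge between two disjoint complexes *)

Section Bridge.
Variables (X B : set Z) (K1 K2 : set (set Z)).
Hypotheses (c1 : complex K1) (c2 : complex K2).
Hypotheses (K1_sub : forall s, K1 s -> s `<=` X) (K2_sub : forall s, K2 s -> s `<=` B).
Hypothesis (BX : forall z, B z -> ~ X z).

Definition bridge a y : set (set Z) := K1 `|` K2 `|` full [set a; y].

(** In the filled triangle the edge from [b] to [y] is free and collapses towards [a]. Exchanging
    [a] and [b] collapses the same triangle to the other bridge, which is how [slide] follows. *)
Let slide_triangle a b y : a != b -> K1 [set a; b] -> K2 [set y] ->
  heq (K1 `|` K2 `|` full [set a; b; y]) (bridge a y).
Proof.
move=> ab Kab Ky; have Xa : X a by apply: (K1_sub Kab); left.
have Xb : X b by apply: (K1_sub Kab); right.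
have By : B y by apply: (K2_sub Ky).
apply: (@collapse_to a _ _ [set b] [set y]).
- by apply: complexU; [exact: complexU|exact: full_complex].
- move=> s [[K1s|K2s]|[fs sQ]] [z sz zb] [x sx xy].
  + by case: (BX By); rewrite -xy; exact: K1_sub sx.
  + by case: (BX (K2_sub K2s sz)); rewrite zb.
  + right; split; first by rewrite finite_setU; split=> //; exact: finite_set1.
    by move=> w [/sQ//|->]; left; left.
- by move/eqP: ab.
- by move=> ay; case: (BX By); rewrite -ay.
- move=> s; split.
    move=> [[K1s|K2s]|[fs sQ]].
    + by split; [left; left|right=> z /(K1_sub K1s) Xz zy; apply: (BX By); rewrite -zy].
    + by split; [left; right|left=> z /(K2_sub K2s) /BX h zb; apply: h; rewrite zb].
    + split; first by right; split=> // z /sQ[->|->]; [left; left|right].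
      left=> z /sQ[->|-> yb]; first by move/eqP: ab.
      by case: (BX By); rewrite yb.
  move=> [[[K1s|K2s]|[fs sQ]] h]; [by left; left|by left; right|].
  case: h => h.
    by right; split=> // z sz; have [[|/(h z sz)//]|] := sQ z sz; [left|right].
  left; left; apply: (c1.2 _ _ Kab) => z sz.
  by have [[|]|/(h z sz)//] := sQ z sz; [left|right].
Qed.

Lemma slide a b y : K1 [set a; b] -> K2 [set y] -> heq (bridge a y) (bridge b y).
Proof.
move=> Kab Ky; have [->|ab] := eqVneq a b; first exact: homotopy_equivalent_refl.
apply: (heq_trans (heq_sym (slide_triangle ab Kab Ky))).
rewrite (setUC [set a]); apply: slide_triangle => //; first by rewrite eq_sym.
by rewrite setUC.
Qed.

Lemma slide_linked a b y : linked K1 a b -> K2 [set y] -> heq (bridge a y) (bridge b y).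
Proof.
move=> lab Ky; apply: (lab (fun b => heq (bridge a y) (bridge b y))).
  exact: homotopy_equivalent_refl.
by move=> x z h Kxz; apply: (heq_trans h); exact: slide.
Qed.

Lemma contract x0 y : K1 [set x0] -> K2 [set y] ->
  heq (bridge x0 y)
    (K1 `|` pull (fun z => if z == x0 then y else z) K2 ((B `\ y) `|` [set x0])).
Proof.
set q := fun z => _; move=> Kx0 Ky.
have Xx0 : X x0 by exact: (K1_sub Kx0).
have By : B y by exact: (K2_sub Ky).
have x0y : x0 != y by apply: contraPneq (BX By) => <-.
have qx0 : q x0 = y by rewrite /q eqxx.
have qB z : B z -> q z = z by rewrite /q; case: eqP => // -> /BX.
(* First [x0] becomes a clone of [y]: a simplex with [x0] and another vertex of [B] can take [y] in,
   and undoing this leaves only the bridge. *)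
apply: (@heq_trans _ (K1 `|` pull q K2 (B `|` [set x0]))).
  apply: heq_sym; apply: (@collapse_to y _ _ [set x0] (B `\ y)).
  - by apply: complexU => //; exact: pull_complex.
  - move=> s [K1s|[fs sQ K2s]] [z sz zx] [w sw [Bw wy]].
      by case: (BX Bw); exact: K1_sub sw.
    right; split.
    + by rewrite finite_setU; split=> //; exact: finite_set1.
    + by move=> v [/sQ//|->]; left.
    + apply: (c2.2 _ _ K2s) => _ [v [sv|->] <-]; first by exists v.
      by exists z => //; rewrite zx qx0 qB.
  - by move=> yx; rewrite yx eqxx in x0y.
  - by case=> _ /(_ erefl).
  - move=> s; split.
      move=> [[K1s|K2s]|[fs sQ]].
      + by split; [left|right=> z /(K1_sub K1s) Xz [/BX]].
      + split; last by left=> z /(K2_sub K2s) /BX h zx; apply: h; rewrite zx.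
        right; split; [exact: c2.1 K2s|by move=> z /(K2_sub K2s); left|].
        by apply: (c2.2 _ _ K2s) => _ [z sz <-]; rewrite qB //; exact: K2_sub sz.
      + split.
          right; split=> //; first by move=> z /sQ[->|->]; [right|left].
          by apply: (c2.2 _ _ Ky) => _ [z /sQ[->|->] <-]; rewrite ?qx0 ?qB.
        by right=> z /sQ[-> [/BX]|-> [_ /(_ erefl)]].
    move=> [[K1s|[fs sQ K2s]] h]; first by left; left.
    case: h => h.
      left; right; apply: (c2.2 _ _ K2s) => z sz; exists z => //; apply: qB.
      by have [//|/(h z sz)] := sQ z sz.
    right; split=> // z sz; have [Bz|] := sQ z sz; last by left.
    by right; apply: contrapT => zy; apply: (h z sz).
apply: (@collapse_to x0 _ _ [set y] [set y]).
- by apply: complexU => //; exact: pull_complex.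
- move=> s [K1s|[fs sQ K2s]] [z sz zy] _.
    by case: (BX By); rewrite -zy; exact: K1_sub sz.
  right; split.
  + by rewrite finite_setU; split=> //; exact: finite_set1.
  + by move=> v [/sQ//|->]; right.
  + apply: (c2.2 _ _ K2s) => _ [v [sv|->] <-]; first by exists v.
    by exists z => //; rewrite zy qx0 qB.
- by move/eqP: x0y.
- by move/eqP: x0y.
- move=> s; split.
    move=> [K1s|[fs sQ K2s]].
      by split; [left|left=> z /(K1_sub K1s) Xz zy; apply: (BX By); rewrite -zy].
    split; first by right; split=> // z /sQ[[]|]; [left|right].
    by left=> z /sQ[[_ zy]//|->]; move/eqP: x0y.
  move=> [[K1s|[fs sQ K2s]] h]; [by left|right; split=> // z sz].
  by have [Bz|] := sQ z sz; [left; split=> // zy; case: h => h; exact: h zy|right].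
Qed.

End Bridge.

(** * Reattaching the clone at prescribed base points *)

Section Attach.
Variables (X Y B : set Z) (KX KY : set (set Z)) (phi pi : Z -> Z) (u x0 y0 : Z).
Hypotheses (cX : complex KX) (cY : complex KY).
Hypotheses (KX_sub : forall s, KX s -> s `<=` X) (KY_sub : forall s, KY s -> s `<=` Y).
Hypotheses (phiB : forall y, Y y -> B (phi y)) (phiK : forall y, Y y -> pi (phi y) = y).
Hypotheses (piY : forall z, B z -> Y (pi z)).
Hypotheses (BX : forall z, B z -> ~ X z) (BY : forall z, B z -> ~ Y z).
Hypothesis (pi_out : forall z, ~ B z -> pi z = z).
Hypothesis (fullX : full (X `&` Y) `<=` KX) (fullY : full (X `&` Y) `<=` KY).
Hypotheses (Xu : X u) (Yu : Y u) (ux : linked KX u x0) (uy : linked KY u y0).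
Hypotheses (Kx0 : KX [set x0]) (Ky0 : KY [set y0]).

Lemma detach : heq (KX `|` KY)
  (KX `|` pull (fun z => pi (if z == x0 then phi y0 else z)) KY
            ((B `\ phi y0) `|` [set x0])).
Proof.
apply: (heq_trans (separate cX cY KX_sub KY_sub phiB phiK piY BX BY pi_out fullX fullY Xu Yu)).
have cP : complex (pull pi KY B) by exact: pull_complex.
have P_sub s : pull pi KY B s -> s `<=` B by case.
have Yy0 : Y y0 by exact: (KY_sub Ky0).
have Pphi y : KY [set y] -> pull pi KY B [set phi y].
  move=> Ky; have Yy : Y y by exact: (KY_sub Ky).
  split; [exact: finite_set1|by move=> _ ->; exact: phiB|].
  by rewrite image_set1 phiK.
have Ku : KY [set u] by apply: fullY; split; [exact: finite_set1|move=> _ ->].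
apply: (heq_trans (slide_linked cX cP KX_sub P_sub BX ux (Pphi u Ku))).
have swap a y : bridge KX (pull pi KY B) a y = bridge (pull pi KY B) KX y a.
  by rewrite /bridge (setUC KX) (setUC [set a]).
have XB z : X z -> ~ B z by move=> Xz /BX.
(* An edge path from [u] to [y0] in [KY] lifts along [phi] to the clone. *)
have lP : linked (pull pi KY B) (phi u) (phi y0).
  move=> Q Qu hQ; apply: (uy (Q := [set y | Y y /\ Q (phi y)]) _ _).2 => // x y [Yx Qx] Kxy.
  have Yy : Y y by apply: (KY_sub Kxy); right.
  split=> //; apply: (hQ _ _ Qx); split.
  - by rewrite finite_setU; split; exact: finite_set1.
  - by move=> _ [->|->]; exact: phiB.
  - by rewrite image_setU !image_set1 !phiK.
rewrite swap; apply: (heq_trans (slide_linked cP cX P_sub KX_sub XB lP Kx0)).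
rewrite -swap; apply: (heq_trans (contract cX cP KX_sub P_sub BX Kx0 (Pphi y0 Ky0))).
set q := fun z => _; set Q := (B `\ phi y0) `|` [set x0].
rewrite (_ : pull q (pull pi KY B) Q = pull (pi \o q) KY Q); first exact: homotopy_equivalent_refl.
apply/seteqP; split=> s [fs sQ Ks]; split=> //.
  by case: Ks => _ _; rewrite image_comp.
split; [exact: finite_image| |by rewrite -image_comp in Ks].
move=> _ [z /sQ[[Bz _]|->] <-]; rewrite /q ?eqxx; last exact: phiB.
by case: eqP => // _; exact: phiB.
Qed.

End Attach.

(** * Removing the simplices with vertices strictly on both sides *)

Section Mixed.
Variables (X Y : set Z) (d : Z -> Z -> R) (r : R) (D : set (set Z)) (u v : Z).

Definition rips (Q : set Z) : set (set Z) :=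
  [set s | [/\ finite_set s, s `<=` Q & forall x y, s x -> s y -> d x y <= r]].

Lemma rips_complex Q : complex (rips Q).
Proof.
split=> [s []//|s s' [fs sQ sd] s's]; split.
- exact: sub_finite_set fs.
- exact: subset_trans sQ.
- by move=> x y /s's sx /s's sy; exact: sd.
Qed.

Hypotheses (cD : complex D) (DY : forall s, D s -> misses s (Y `\` X)).
Hypotheses (Xu : X u) (Yu : Y u) (Xv : X v) (Yv : Y v).
Hypotheses (duu : d u u <= r) (dvv : d v v <= r) (dvu : d v u <= r) (duv : d u v <= r).
Hypothesis near_uv : forall s, rips (X `|` Y) s -> meets s (X `\` Y) -> meets s (Y `\` X) ->
  (forall z, s z -> d z u <= r /\ d u z <= r) \/ (forall z, s z -> d z v <= r /\ d v z <= r).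

Let add_center s c : rips (X `|` Y) s -> (X `|` Y) c -> d c c <= r ->
  (forall z, s z -> d z c <= r /\ d c z <= r) -> rips (X `|` Y) (s `|` [set c]).
Proof.
move=> [fs sQ sd] Qc dc h; split.
- by rewrite finite_setU; split=> //; exact: finite_set1.
- by move=> z [/sQ//|->].
- by move=> x y [sx|->] [sy|->] //; [exact: sd|exact: (h _ sx).1|exact: (h _ sy).2].
Qed.

(** A mixed simplex that meets [far] is left with the second alternative of [near_uv], so [v] can
    join it. The mixed simplices that survive the first collapse miss [far], hence lie within [r] of
    [u], and are coned off there. *)
Lemma unmix : heq (rips (X `|` Y) `|` D) (rips X `|` rips Y `|` D).
Proof.
pose far := [set z | ~ (d z u <= r /\ d u z <= r)].
pose K1 := (rips (X `|` Y) `&`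
  [set s | [\/ misses s (X `\` Y), misses s (Y `\` X) | misses s far]]) `|` D.
have cR : complex (rips (X `|` Y)) by exact: rips_complex.
have c1 : complex K1.
  apply: complexU => //; split=> [s [/cR.1//]|s s' [Rs h] s's].
  split; first exact: cR.2 s's.
  by case: h => h; [constructor 1|constructor 2|constructor 3] => z /s's; exact: h.
apply: (@heq_trans _ K1).
  apply: (@collapse R Z _ _ (fun=> Some v) (X `\` Y) (Y `\` X) far) => //.
  - exact: complexU.
  - move=> s [Rs|Ds] h1 h2 [z sz fz]; last by case: h2 => w sw /(DY Ds sw).
    left; have [h|h] := near_uv Rs h1 h2; first by case: fz; exact: h.
    apply: (cR.2 _ _ (add_center Rs _ dvv h)); first by left.
    by move=> w [sw|[y _ [<-]]]; [left|right].
  - by move=> y z [<-]; split=> [[]|[]|/(_ (conj dvu duv))].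
  - move=> s; split.
      by move=> [[Rs h]|Ds]; split; [left|exact: h|right|constructor 2; exact: DY].
    by move=> [[Rs|Ds] h]; [left|right].
apply: (@collapse_to u _ _ (X `\` Y) (Y `\` X)) => //.
- move=> s [[Rs h]|Ds] h1 h2; last by case: h2 => w sw /(DY Ds sw).
  have hfar : misses s far.
    case: h => // h'; [by case: h1 => z sz /(h' z sz)|by case: h2 => z sz /(h' z sz)].
  left; split; last first.
    by constructor 3 => z [/hfar//|->]; rewrite /far /= => /(_ (conj duu duu)).
  apply: add_center => //; first by left.
  by move=> z /hfar /contrapT.
- by case.
- by case.
- move=> s; split.
    move=> [[Rs|Rs]|Ds]; last by split; [right|right; exact: DY].
      have [fs sX sd] := Rs; have h : misses s (Y `\` X) by move=> z /sX Xz [].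
      split; last by right.
      left; split; last by constructor 2.
      by split=> // z /sX; left.
    have [fs sY sd] := Rs; have h : misses s (X `\` Y) by move=> z /sY Yz [].
    split; last by left.
    left; split; last by constructor 1.
    by split=> // z /sY; right.
  move=> [[[[fs sQ sd] _]|Ds] h]; last by right.
  case: h => h; [left; right|left; left]; split=> // z sz;
    by case: (sQ z sz) => // Qz; apply: contrapT => ?; apply: (h z sz).
Qed.

End Mixed.

End Moves.

(** * Path metrics of graphs *)

Ltac min_lra :=
  move=> *; repeat match goal with |- context [Num.min ?a ?b] => case: (leP a b) => ? end; lra.

Section GraphMetric.
Context (R : realType) (V : finType).
Local Notation pt := {ffun V -> R}.
Implicit Types (x y z : pt) (u v w : V) (S : {set V}) (E : {set {set V}}) (P Q : set pt).

Definition delta u : pt := [ffun v => (v == u)%:R].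

Definition l1_half x y : R := (\sum_v `|x v - y v|) / 2.

(** Points are functions on all of [V], so the points of a subgraph are literally points of the
    larger graph and no inclusion maps are needed. *)
Definition graph_points S E : set pt :=
  [set x : pt | [/\ forall v, 0 <= x v, \sum_v x v = 1, gsupport x \subset S &
               (#|gsupport x| == 1)%N || (gsupport x \in E)]].

Definition on_edge E x y :=
  exists2 e, e \in E & (gsupport x \subset e) /\ (gsupport y \subset e).

Definition pseudo P (d : pt -> pt -> R) :=
  (forall x, P x -> d x x = 0) /\
  (forall x y z, P x -> P y -> P z -> d x z <= d x y + d y z).

Definition short P E (d : pt -> pt -> R) :=
  forall x y, P x -> P y -> on_edge E x y -> d x y <= l1_half x y.

(* The path metric is characterized as the largest (possibly asymmetric)
   pseudometric bounded by the length of each edge segment. *)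
Definition path_metric S E (d : pt -> pt -> R) :=
  [/\ forall e, e \in E -> #|e| = 2%N /\ e \subset S,
      pseudo (graph_points S E) d, short (graph_points S E) E d &
      forall rho, pseudo (graph_points S E) rho -> short (graph_points S E) E rho ->
        forall x y, graph_points S E x -> graph_points S E y -> rho x y <= d x y].

Lemma gsupport_delta u : gsupport (delta u) = [set u]%SET.
Proof.
by apply/setP => v; rewrite !inE ffunE pnatr_eq0 eqb0 negbK.
Qed.

Lemma delta_points S E u : u \in S -> graph_points S E (delta u).
Proof.
move=> uS; split.
- by move=> v; rewrite ffunE ler0n.
- rewrite (bigD1 u) //= ffunE eqxx big1 ?addr0 // => v vu.
  by rewrite ffunE (negbTE vu).
- by rewrite gsupport_delta finset.sub1set.
- by rewrite gsupport_delta cards1.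
Qed.

Lemma points_sub_sum S E x (A : {set V}) : graph_points S E x -> gsupport x \subset A ->
  \sum_(v in A) x v = 1.
Proof.
move=> [_ x1 _ _] xA; rewrite -x1 [RHS](bigID (mem A)) /= [X in _ + X]big1 ?addr0 // => v vA.
by apply: contraNeq vA => xv; apply: (fintype.subsetP xA); rewrite inE.
Qed.

Lemma points_delta S E x u : graph_points S E x -> gsupport x \subset [set u]%SET ->
  x = delta u.
Proof.
move=> Px xu; have xu1 : x u = 1.
  by have := points_sub_sum Px xu; rewrite big_set1.
apply/ffunP => v; rewrite ffunE; have [->//|vu] := eqVneq v u.
apply: contraNeq vu => xv; have : v \in gsupport x by rewrite inE.
by move/(fintype.subsetP xu); rewrite inE.
Qed.

Lemma points_pair S E x u v : graph_points S E x -> u != v ->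
  gsupport x \subset [set u; v]%SET -> x u + x v = 1.
Proof.
move=> Px uv xuv; have := points_sub_sum Px xuv.
by rewrite big_setU1 ?inE //= big_set1.
Qed.

Lemma l1_half_ge0 x y : 0 <= l1_half x y.
Proof. by rewrite divr_ge0 ?sumr_ge0. Qed.

Lemma l1_halfC x y : l1_half x y = l1_half y x.
Proof. by rewrite /l1_half; congr (_ / 2); apply: eq_bigr => v _; rewrite distrC. Qed.

Lemma l1_halfxx x : l1_half x x = 0.
Proof. by rewrite /l1_half big1 ?mul0r // => v _; rewrite subrr normr0. Qed.

Lemma l1_half_triangle x y z : l1_half x z <= l1_half x y + l1_half y z.
Proof.
rewrite /l1_half -mulrDl ler_pM2r ?invr_gt0 ?ltr0n // -big_split /=.
by apply: ler_sum => v _; exact: ler_distD.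
Qed.

(** The differences of coordinates sum to 0, so the one at [u] is balanced by the others and counts
    at least twice in the total. *)
Lemma l1_half_coord S E x y u : graph_points S E x -> graph_points S E y ->
  `|x u - y u| <= l1_half x y.
Proof.
move=> [_ x1 _ _] [_ y1 _ _]; rewrite /l1_half ler_pdivlMr ?ltr0n // mulr_natr mulr2n.
rewrite (bigD1 u) //= lerD2l.
have : \sum_v (x v - y v) = 0 by rewrite sumrB x1 y1 subrr.
rewrite (bigD1 u) //= => /eqP; rewrite addr_eq0 => /eqP ->.
by rewrite normrN; exact: ler_norm_sum.
Qed.

Lemma l1_half_le1 S E x y : graph_points S E x -> graph_points S E y -> l1_half x y <= 1.
Proof.
move=> [x0 x1 _ _] [y0 y1 _ _]; rewrite /l1_half ler_pdivrMr ?ltr0n // mul1r.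
rewrite (_ : 2 = \sum_v (x v + y v)); last by rewrite big_split /= x1 y1.
apply: ler_sum => v _; rewrite (le_trans (ler_normB _ _)) //.
by rewrite !ger0_norm.
Qed.

Lemma l1_half_pair S E x y u v : graph_points S E x -> graph_points S E y -> u != v ->
  gsupport x \subset [set u; v]%SET -> gsupport y \subset [set u; v]%SET ->
  l1_half x y = `|x u - y u|.
Proof.
move=> Px Py uv xuv yuv; rewrite /l1_half (bigID (mem [set u; v]%SET)) /=.
rewrite [X in _ + X]big1 ?addr0.
  rewrite big_setU1 ?inE //= big_set1.
  have := points_pair Px uv xuv; have := points_pair Py uv yuv => ey ex.
  have -> : x v - y v = - (x u - y u) by lra.
  by rewrite normrN; field.
move=> w wuv; have h p : gsupport p \subset [set u; v]%SET -> p w = 0.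
  by move=> puv; apply: contraNeq wuv => pw; apply: (fintype.subsetP puv); rewrite inE.
by rewrite !h // subrr normr0.
Qed.

Lemma on_edgeC E x y : on_edge E x y -> on_edge E y x.
Proof. by move=> [e eE []]; exists e. Qed.

Section PathMetric.
Variables (S : {set V}) (E : {set {set V}}) (d : pt -> pt -> R).
Hypothesis dm : path_metric S E d.
Local Notation P := (graph_points S E).

Lemma path_metric_ge0 x y : P x -> P y -> 0 <= d x y.
Proof.
case: dm => _ _ _ dmax Px Py.
have p0 : pseudo P (fun _ _ => 0 : R) by split=> // a b c _ _ _; rewrite addr0.
by apply: (dmax _ p0) => // a b _ _ _; exact: l1_half_ge0.
Qed.

(** Maximality of [d] is applied to [d] with its arguments exchanged. *)
Lemma path_metricC x y : P x -> P y -> d x y = d y x.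
Proof.
suff h x' y' : P x' -> P y' -> d y' x' <= d x' y'.
  by move=> Px Py; apply/eqP; rewrite eq_le !h.
case: dm => _ [d0 dt] ds dmax Px Py.
apply: (dmax (fun a b => d b a)) => //.
  by split=> // a b c Pa Pb Pc; rewrite addrC dt.
by move=> a b Pa Pb /on_edgeC ab; rewrite l1_halfC ds.
Qed.

(** The difference of the coordinates at [u] is itself a pseudometric bounded by edge lengths, so
    maximality gives this lower bound for [d]. *)
Lemma path_metric_coord u x y : P x -> P y -> `|x u - y u| <= d x y.
Proof.
case: dm => _ _ _ dmax Px Py; apply: (dmax (fun a b => `|a u - b u|)) => //.
  by split=> *; [rewrite subrr normr0|exact: ler_distD].
by move=> a b Pa Pb _; exact: l1_half_coord Pa Pb.
Qed.

Lemma path_metric_pair u v x y : P x -> P y -> [set u; v]%SET \in E ->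
  gsupport x \subset [set u; v]%SET -> gsupport y \subset [set u; v]%SET ->
  d x y = l1_half x y.
Proof.
move=> Px Py uvE xuv yuv; case: (dm) => wf _ ds _.
have uv : u != v by have [] := wf _ uvE; rewrite cards2; case: eqP.
apply/eqP; rewrite eq_le ds //=; last by exists [set u; v]%SET.
by rewrite (l1_half_pair Px Py uv xuv yuv) path_metric_coord.
Qed.

(** If [Q] failed at [y], a one-way toll of [d x y + 1] for leaving [Q] would be an asymmetric
    pseudometric that vanishes on edge segments and exceeds [d] at [x] and [y]. *)
Lemma path_metric_connected (Q : set pt) x y : P x -> P y -> Q x ->
  (forall a b, P a -> P b -> on_edge E a b -> Q a -> Q b) -> Q y.
Proof.
move=> Px Py Qx Qedge; apply: contrapT => Qy; case: dm => _ _ _ dmax.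
pose rho a b : R := if `[<Q a /\ ~ Q b>] then d x y + 1 else 0.
have d0 := path_metric_ge0 Px Py.
have rho0 a b : 0 <= rho a b by rewrite /rho; case: ifP => // _; lra.
have : rho x y <= d x y.
  apply: dmax => //; last first.
    move=> a b Pa Pb ab; rewrite /rho ifF ?l1_half_ge0 //.
    by apply/asboolPn => -[Qa]; apply; exact: Qedge ab Qa.
  split=> [a _|a b c _ _ _]; first by rewrite /rho ifF //; apply/asboolPn => -[].
  have := rho0 a b; have := rho0 b c; rewrite {3}/rho.
  case: asboolP => [[Qa Qc] *|_ *]; last by lra.
  have [Qb|Qb] := pselect (Q b).
    have -> : rho b c = d x y + 1 by rewrite /rho ifT //; apply/asboolP.
    by lra.
  have -> : rho a b = d x y + 1 by rewrite /rho ifT //; apply/asboolP.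
  by lra.
rewrite /rho ifT; last by apply/asboolP.
by lra.
Qed.

End PathMetric.

(** * Gluing two pseudometrics along two points *)

Section Glue.
Variables (P Q : set pt) (dP dQ : pt -> pt -> R) (p q : pt).
Hypotheses (pP : pseudo P dP) (pQ : pseudo Q dQ).
Hypotheses (Pp : P p) (Pq : P q) (Qp : Q p) (Qq : Q q).
Hypothesis PQ : forall x, P x -> Q x -> x = p \/ x = q.
Hypotheses (dpq : dP p q = dQ p q) (dqp : dP q p = dQ q p).

Definition glue x y : R :=
  if `[<P x>] then
    if `[<P y>] then dP x y else Num.min (dP x p + dQ p y) (dP x q + dQ q y)
  else
    if `[<P y>] then Num.min (dQ x p + dP p y) (dQ x q + dP q y) else dQ x y.

Lemma glueP x y : P x -> P y -> glue x y = dP x y.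
Proof. by move=> /asboolT Px /asboolT Py; rewrite /glue Px Py. Qed.

Lemma glue_mixed x y : P x -> ~ P y ->
  glue x y = Num.min (dP x p + dQ p y) (dP x q + dQ q y).
Proof. by move=> /asboolT Px /asboolF Py; rewrite /glue Px Py. Qed.

Lemma glue_mixedC x y : ~ P x -> P y ->
  glue x y = Num.min (dQ x p + dP p y) (dQ x q + dP q y).
Proof. by move=> /asboolF Px /asboolT Py; rewrite /glue Px Py. Qed.

Let dPpp : dP p p = 0. Proof. exact: pP.1. Qed.
Let dPqq : dP q q = 0. Proof. exact: pP.1. Qed.
Let dQpp : dQ p p = 0. Proof. exact: pQ.1. Qed.
Let dQqq : dQ q q = 0. Proof. exact: pQ.1. Qed.

Lemma glueQ x y : Q x -> Q y -> glue x y = dQ x y.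
Proof.
move=> Qx Qy; rewrite /glue; case: asboolP => [Px|nPx]; case: asboolP => [Py|nPy] //.
- by case: (PQ Px Qx) => ->; case: (PQ Py Qy) => ->; rewrite ?dPpp ?dPqq ?dQpp ?dQqq.
- have h1 := pQ.2 _ _ _ Qp Qq Qy; have h2 := pQ.2 _ _ _ Qq Qp Qy.
  by case: (PQ Px Qx) => ->; rewrite ?dPpp ?dPqq ?dpq ?dqp; min_lra.
- have h1 := pQ.2 _ _ _ Qx Qp Qq; have h2 := pQ.2 _ _ _ Qx Qq Qp.
  by case: (PQ Py Qy) => ->; rewrite ?dPpp ?dPqq ?dpq ?dqp; min_lra.
Qed.

Lemma glue_pseudo : pseudo (P `|` Q) glue.
Proof.
split=> [x [Px|Qx]|x y z PQx PQy PQz].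
- by rewrite glueP // pP.1.
- by rewrite glueQ // pQ.1.
have QnP a : (P `|` Q) a -> ~ P a -> Q a by case.
have tP := pP.2; have tQ := pQ.2.
rewrite /glue; case: asboolP => [Px|/(QnP _ PQx) Qx];
  case: asboolP => [Pz|/(QnP _ PQz) Qz]; case: asboolP => [Py|/(QnP _ PQy) Qy].
- exact: tP.
(* The detour through [y] on the other side enters and leaves by [p] or [q]. A return to the same
   gate costs nothing less than 0, and a passage between the gates costs at least the same distance
   in [P]. *)
- have := tP _ _ _ Px Pp Pz; have := tP _ _ _ Px Pq Pz.
  have := tP _ _ _ Px Pp Pq; have := tP _ _ _ Px Pq Pp.
  have := tP _ _ _ Pp Pq Pz; have := tP _ _ _ Pq Pp Pz.
  have := tQ _ _ _ Qp Qy Qp; have := tQ _ _ _ Qp Qy Qq.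
  have := tQ _ _ _ Qq Qy Qp; have := tQ _ _ _ Qq Qy Qq.
  rewrite -?dpq -?dqp ?dQpp ?dQqq.
  by min_lra.
- have := tP _ _ _ Px Py Pp; have := tP _ _ _ Px Py Pq.
  by min_lra.
- have := tQ _ _ _ Qp Qy Qz; have := tQ _ _ _ Qq Qy Qz.
  by min_lra.
- have := tP _ _ _ Pp Py Pz; have := tP _ _ _ Pq Py Pz.
  by min_lra.
- have := tQ _ _ _ Qx Qy Qp; have := tQ _ _ _ Qx Qy Qq.
  by min_lra.
- have := tQ _ _ _ Qx Qp Qz; have := tQ _ _ _ Qx Qq Qz.
  have := tQ _ _ _ Qx Qp Qq; have := tQ _ _ _ Qx Qq Qp.
  have := tQ _ _ _ Qp Qq Qz; have := tQ _ _ _ Qq Qp Qz.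
  have := tP _ _ _ Pp Py Pp; have := tP _ _ _ Pp Py Pq.
  have := tP _ _ _ Pq Py Pp; have := tP _ _ _ Pq Py Pq.
  rewrite ?dpq ?dqp ?dPpp ?dPqq.
  by min_lra.
- exact: tQ.
Qed.

End Glue.

End GraphMetric.

(** * Attaching along a vertex or an edge *)

Section AttachMetric.
Context (R : realType) (V : finType).
Local Notation pt := {ffun V -> R}.
Implicit Types (x y z : pt) (u v w a b : V) (S : {set V}) (E : {set {set V}}) (P Q : set pt).
Local Notation delta := (@delta R V).
Local Notation graph_points := (@graph_points R V).

Lemma points_card_le S E x : (forall e, e \in E -> #|e| = 2%N /\ e \subset S) ->
  graph_points S E x -> (#|gsupport x| <= 2)%N.
Proof. by move=> wf [_ _ _ /orP[/eqP->//|/wf[-> _]]]. Qed.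

(** Graphs attached along an edge share the whole edge. Without its interior the first graph meets
    the second only in the endpoints, as gluing requires. *)
Definition off_open_edge S E a b : set pt :=
  [set x | graph_points S E x /\ (gsupport x \subset [set a; b]%SET -> x = delta a \/ x = delta b)].

Lemma support_edge S E x e : (forall e, e \in E -> #|e| = 2%N /\ e \subset S) ->
  graph_points S E x -> e \in E -> gsupport x \subset e ->
  (exists2 w, w \in e & x = delta w) \/ gsupport x = e.
Proof.
move=> wf Px eE xe; case: (Px) => _ _ _ /orP[/cards1P[w xw]|xE].
  left; exists w; first by apply: (fintype.subsetP xe); rewrite xw inE.
  by apply: (points_delta Px); rewrite xw.
by right; apply/eqP; rewrite eqEcard xe (wf _ xE).1 (wf _ eE).1.
Qed.

Lemma delta_sub a b w : w \in [set a; b]%SET -> delta w = delta a \/ delta w = delta b.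
Proof. by rewrite !inE => /orP[]/eqP->; [left|right]. Qed.

Section Through.
Variables (S : {set V}) (E : {set {set V}}) (d : pt -> pt -> R).
Hypothesis dm : path_metric S E d.
Local Notation P := (graph_points S E).

(** The metric [d] restricted to the edge and [d] restricted to the complement of its interior are
    glued at the endpoints. The result only allows routes through [a] or [b], and maximality bounds
    it by [d]. *)
Lemma path_metric_through a b x y : [set a; b]%SET \in E -> P x -> P y ->
  ~ (gsupport x \subset [set a; b]%SET) -> gsupport y \subset [set a; b]%SET ->
  Num.min (d x (delta a) + d (delta a) y) (d x (delta b) + d (delta b) y) <= d x y.
Proof.
move=> abE Px Py xab yab; have [wf [d0 dt] ds dmax] := dm.
have abS := (wf _ abE).2.
have Pa : P (delta a) by apply/delta_points/(fintype.subsetP abS); rewrite !inE eqxx.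
have Pb : P (delta b) by apply/delta_points/(fintype.subsetP abS); rewrite !inE eqxx orbT.
pose P1 := off_open_edge S E a b.
pose Q1 := [set x : pt | P x /\ gsupport x \subset [set a; b]%SET].
have P1P x' : P1 x' -> P x' by case.
have Q1P x' : Q1 x' -> P x' by case.
have sub Q' : (forall x', Q' x' -> P x') -> pseudo Q' d.
  by move=> Q'P; split=> [x' /Q'P|x' y' z' /Q'P ? /Q'P ? /Q'P ?]; [exact: d0|exact: dt].
have P1a : P1 (delta a) by split=> // _; left.
have P1b : P1 (delta b) by split=> // _; right.
have Q1a : Q1 (delta a) by split=> //; rewrite gsupport_delta finset.sub1set !inE eqxx.
have Q1b : Q1 (delta b) by split=> //; rewrite gsupport_delta finset.sub1set !inE eqxx orbT.
have PQ x' : P1 x' -> Q1 x' -> x' = delta a \/ x' = delta b.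
  by move=> [_ h] [_ /h].
have PQE : P1 `|` Q1 = P.
  apply/seteqP; split=> [x' [[]|[]]//|x' Px'].
  by have [h|h] := pselect (gsupport x' \subset [set a; b]%SET); [right|left; split].
have gp := glue_pseudo (sub _ P1P) (sub _ Q1P) P1a P1b Q1a Q1b PQ erefl erefl.
rewrite PQE in gp.
have P1x : P1 x by split.
(* A segment lies in the edge ab, or in another edge and then off the interior of ab. *)
have gs : short P E (glue P1 d d (delta a) (delta b)).
  move=> x' y' Px' Py' xye; have [e eE [xe ye]] := xye.
  have [h|h] := pselect (Q1 x' /\ Q1 y').
    by case: h => Qx' Qy'; rewrite (glueQ (sub _ P1P) (sub _ Q1P)) // ds.
  have eab : e != [set a; b]%SET.
    by apply/eqP => eab; apply: h; rewrite /Q1 /= -eab.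
  have P1e z' : P z' -> gsupport z' \subset e -> P1 z'.
    move=> Pz ze; split=> // zab.
    have [[w wab ->]|zabE] := support_edge wf Pz abE zab; first exact: delta_sub.
    case/negP: eab; rewrite eq_sym -zabE eqEcard ze (wf _ eE).1 zabE.
    by rewrite (wf _ abE).1.
  by rewrite glueP ?ds //; exact: P1e.
have := dmax _ gp gs x y Px Py.
have [P1y _|P1y] := pselect (P1 y); last by rewrite glue_mixed.
have [_ /(_ yab)[]->] := P1y; rewrite d0 // addr0 ge_min lexx ?orbT //.
Qed.

End Through.

Section Attach.
Variables (S1 S2 : {set V}) (E1 E2 : {set {set V}}) (d1 d2 : pt -> pt -> R) (a b : V).
Hypotheses (m1 : path_metric S1 E1 d1) (m2 : path_metric S2 E2 d2).
Hypothesis S12 : S1 :&: S2 = [set a; b]%SET.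
Hypothesis abE : a = b \/ [set a; b]%SET \in E1 /\ [set a; b]%SET \in E2.
Local Notation G1 := (graph_points S1 E1).
Local Notation G2 := (graph_points S2 E2).
Local Notation G := (graph_points (S1 :|: S2) (E1 :|: E2)).
Local Notation P1 := (off_open_edge S1 E1 a b).

Definition attach_metric := glue P1 d1 d2 (delta a) (delta b).
Local Notation d := attach_metric.

Let wf1 : forall e, e \in E1 -> #|e| = 2%N /\ e \subset S1. Proof. by case: m1. Qed.
Let wf2 : forall e, e \in E2 -> #|e| = 2%N /\ e \subset S2. Proof. by case: m2. Qed.
Let wf : forall e, e \in E1 :|: E2 -> #|e| = 2%N /\ e \subset S1 :|: S2.
Proof.
move=> e; rewrite inE => /orP[/wf1[-> h]|/wf2[-> h]]; split=> //; apply: fintype.subset_trans h _.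
  exact: finset.subsetUl.
exact: finset.subsetUr.
Qed.

Let aS1 : a \in S1. Proof. by have /setP/(_ a) := S12; rewrite !inE eqxx => /andP[]. Qed.
Let bS1 : b \in S1. Proof. by have /setP/(_ b) := S12; rewrite !inE eqxx orbT => /andP[]. Qed.
Let aS2 : a \in S2. Proof. by have /setP/(_ a) := S12; rewrite !inE eqxx => /andP[]. Qed.
Let bS2 : b \in S2. Proof. by have /setP/(_ b) := S12; rewrite !inE eqxx orbT => /andP[]. Qed.

Lemma attach_points1 : G1 `<=` G.
Proof.
move=> x [x0 x1 xS xE]; split=> //; first by rewrite (fintype.subset_trans xS) // finset.subsetUl.
by case/orP: xE => xE; apply/orP; [left|right]; rewrite // inE xE.
Qed.

Lemma attach_points2 : G2 `<=` G.
Proof.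
move=> x [x0 x1 xS xE]; split=> //; first by rewrite (fintype.subset_trans xS) // finset.subsetUr.
by case/orP: xE => xE; apply/orP; [left|right]; rewrite // inE xE orbT.
Qed.

Lemma attach_pointsU : G = G1 `|` G2.
Proof.
apply/seteqP; split=> x; last by case; [exact: attach_points1|exact: attach_points2].
move=> [x0 x1 xS /orP[/cards1P[w xw]|]].
  move: xS; rewrite xw finset.sub1set inE => /orP[]wS; [left|right];
    by split=> //; rewrite xw ?finset.sub1set ?cards1.
by rewrite inE => /orP[xE|xE]; [left|right]; split=> //; rewrite ?xE ?orbT //;
  [have [] := wf1 xE|have [] := wf2 xE].
Qed.

Lemma attach_pointsI x : G1 x -> G2 x -> gsupport x \subset [set a; b]%SET.
Proof. by move=> [_ _ h1 _] [_ _ h2 _]; rewrite -S12 finset.subsetI h1. Qed.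

Let shared (S : {set V}) (E : {set {set V}}) x :
  (forall e, e \in E -> #|e| = 2%N /\ e \subset S) -> graph_points S E x ->
  gsupport x \subset [set a; b]%SET ->
  (exists2 w, w \in [set a; b]%SET & x = delta w) \/
  [/\ gsupport x = [set a; b]%SET, [set a; b]%SET \in E1 & [set a; b]%SET \in E2].
Proof.
move=> wfE Gx xab; have [_ _ _ /orP[/cards1P[w xw]|xE]] := Gx.
  left; exists w; first by apply: (fintype.subsetP xab); rewrite xw inE.
  by apply: (points_delta Gx); rewrite xw.
right; have xabE : gsupport x = [set a; b]%SET.
  by apply/eqP; rewrite eqEcard xab (wfE _ xE).1 cards2; case: (a != b).
case: abE => [ab|[]//]; have := (wfE _ xE).1.
by rewrite xabE ab finset.setUid cards1.
Qed.

Lemma attach_points12 x : G1 x -> gsupport x \subset [set a; b]%SET -> G2 x.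
Proof.
move=> G1x xab; have [[w wab ->]|[xabE _ abE2]] := shared wf1 G1x xab.
  by apply: delta_points; move: wab; rewrite -S12 inE => /andP[].
by have [x0 x1 _ xE] := G1x; split=> //; rewrite xabE ?abE2 ?orbT // (wf2 abE2).2.
Qed.

Lemma attach_points21 x : G2 x -> gsupport x \subset [set a; b]%SET -> G1 x.
Proof.
move=> G2x xab; have [[w wab ->]|[xabE abE1 _]] := shared wf2 G2x xab.
  by apply: delta_points; move: wab; rewrite -S12 inE => /andP[].
by have [x0 x1 _ xE] := G2x; split=> //; rewrite xabE ?abE1 ?orbT // (wf1 abE1).2.
Qed.

Let P1G1 : P1 `<=` G1. Proof. by move=> x []. Qed.

Let G1a : G1 (delta a). Proof. exact: delta_points. Qed.
Let G1b : G1 (delta b). Proof. exact: delta_points. Qed.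
Let G2a : G2 (delta a). Proof. exact: delta_points. Qed.
Let G2b : G2 (delta b). Proof. exact: delta_points. Qed.
Let P1a : P1 (delta a). Proof. by split=> //; left. Qed.
Let P1b : P1 (delta b). Proof. by split=> //; right. Qed.

Let G1P1 x : G1 x -> P1 x \/ G2 x /\ ~ P1 x.
Proof.
move=> G1x; have [?|nP1] := pselect (P1 x); [by left|right; split=> //].
apply: attach_points12 => //; apply/negP => /negP h; apply: nP1; split=> // xab.
by rewrite xab in h.
Qed.

Let PQ x : P1 x -> G2 x -> x = delta a \/ x = delta b.
Proof. by move=> [G1x h] G2x; apply: h; exact: attach_pointsI. Qed.

Let PU : P1 `|` G2 = G.
Proof.
rewrite attach_pointsU; apply/seteqP; split=> x [|]; try by right.
  by move=> [? _]; left.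
by move=> /G1P1[|[]]; [left|right].
Qed.

Let pp1 : pseudo G1 d1. Proof. by case: m1. Qed.
Let pp2 : pseudo G2 d2. Proof. by case: m2. Qed.
Let ppP : pseudo P1 d1.
Proof.
by split=> [x /P1G1|x y z /P1G1 ? /P1G1 ? /P1G1 ?]; [exact: pp1.1|exact: pp1.2].
Qed.

Let ab_sub w : w \in [set a; b]%SET -> gsupport (delta w) \subset [set a; b]%SET.
Proof. by rewrite gsupport_delta finset.sub1set. Qed.

Let aab : a \in [set a; b]%SET. Proof. by rewrite !inE eqxx. Qed.
Let bab : b \in [set a; b]%SET. Proof. by rewrite !inE eqxx orbT. Qed.

Let d12 x y : G1 x -> G1 y -> gsupport x \subset [set a; b]%SET ->
  gsupport y \subset [set a; b]%SET -> d1 x y = d2 x y.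
Proof.
move=> G1x G1y xab yab.
have G2x := attach_points12 G1x xab; have G2y := attach_points12 G1y yab.
case: abE => [ab|[abE1 abE2]].
  have xa : x = delta a by apply: (points_delta G1x); rewrite -(finset.setUid [set a]%SET) {2}ab.
  have ya : y = delta a by apply: (points_delta G1y); rewrite -(finset.setUid [set a]%SET) {2}ab.
  by rewrite xa ya pp1.1 // pp2.1.
by rewrite (path_metric_pair m1 (u := a) (v := b)) // (path_metric_pair m2 (u := a) (v := b)).
Qed.

Let dab : d1 (delta a) (delta b) = d2 (delta a) (delta b).
Proof. by apply: d12 => //; exact: ab_sub. Qed.
Let dba : d1 (delta b) (delta a) = d2 (delta b) (delta a).
Proof. by apply: d12 => //; exact: ab_sub. Qed.

Let dQ x y : G2 x -> G2 y -> d x y = d2 x y.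
Proof. exact: (glueQ ppP pp2 P1a P1b G2a G2b PQ dab dba). Qed.

Let open_edge x : G1 x -> ~ P1 x ->
  [/\ gsupport x = [set a; b]%SET, [set a; b]%SET \in E1 & [set a; b]%SET \in E2].
Proof.
move=> G1x nP; have xab : gsupport x \subset [set a; b]%SET.
  by apply: contrapT => h; apply: nP; split.
by have [[w /delta_sub h xw]|//] := shared wf1 G1x xab; case: nP; split=> // _; rewrite xw.
Qed.

Lemma attach_path_metric : path_metric (S1 :|: S2) (E1 :|: E2) d.
Proof.
have gp := glue_pseudo ppP pp2 P1a P1b G2a G2b PQ dab dba.
rewrite PU in gp; split=> //.
- move=> x y Gx Gy [e]; rewrite inE => /orP[eE1|eE2] [xe ye].
    have G1e z : G z -> gsupport z \subset e -> G1 z.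
      move=> [z0 z1 zS zE] ze; split=> //.
        by rewrite (fintype.subset_trans ze) // (wf1 eE1).2.
      case/orP: zE => [->//|zE]; have := wf zE => -[z2 _].
      suff -> : gsupport z = e by rewrite eE1 orbT.
      by apply/eqP; rewrite eqEcard ze (wf1 eE1).1 z2.
    have G1x := G1e _ Gx xe; have G1y := G1e _ Gy ye.
    have s1 : d1 x y <= l1_half x y by case: m1 => _ _ s1 _; apply: s1 => //; exists e.
    (* A point in the interior of the edge ab forces [e] to be that edge, so both ends of the
       segment also belong to the second graph and [d12] applies. *)
    have open z z' : G1 z -> G1 z' -> gsupport z \subset e -> gsupport z' \subset e ->
        ~ P1 z -> [/\ [set a; b]%SET \in E2, gsupport z \subset [set a; b]%SET &
                      gsupport z' \subset [set a; b]%SET].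
      move=> G1z G1z' ze z'e /(open_edge G1z)[zab abE1 abE2].
      have eab : [set a; b]%SET = e.
        by apply/eqP; rewrite eqEcard -zab ze zab (wf1 eE1).1 (wf1 abE1).1.
      by rewrite eab -{1}eab.
    have [P1x|/(open _ _ G1x G1y xe ye)[abE2 xab yab]] := pselect (P1 x).
      have [P1y|/(open _ _ G1y G1x ye xe)[abE2 yab xab]] := pselect (P1 y).
        by rewrite /d glueP.
      by rewrite dQ -?d12 //; exact: attach_points12.
    by rewrite dQ -?d12 //; exact: attach_points12.
  have G2e z : G z -> gsupport z \subset e -> G2 z.
    move=> [z0 z1 zS zE] ze; split=> //.
      by rewrite (fintype.subset_trans ze) // (wf2 eE2).2.
    case/orP: zE => [->//|zE]; have := wf zE => -[z2 _].
    suff -> : gsupport z = e by rewrite eE2 orbT.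
    by apply/eqP; rewrite eqEcard ze (wf2 eE2).1 z2.
  have G2x := G2e _ Gx xe; have G2y := G2e _ Gy ye.
  by rewrite dQ //; case: m2 => _ _ s2 _; apply: s2 => //; exists e.
- move=> rho [rho0 rhot] rhos.
  (* Restricted to either graph, [rho] is bounded by the metric of that graph; mixed pairs then
     follow by the triangle inequality through [a] and [b]. *)
  have r1 x y : G1 x -> G1 y -> rho x y <= d1 x y.
    case: m1 => _ _ _; apply; first split.
    + by move=> z /attach_points1; exact: rho0.
    + by move=> x' y' z' /attach_points1 ? /attach_points1 ? /attach_points1 ?; exact: rhot.
    + move=> x' y' /attach_points1 ? /attach_points1 ? [e eE h]; apply: rhos => //.
      by exists e => //; rewrite inE eE.
  have r2 x y : G2 x -> G2 y -> rho x y <= d2 x y.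
    case: m2 => _ _ _; apply; first split.
    + by move=> z /attach_points2; exact: rho0.
    + by move=> x' y' z' /attach_points2 ? /attach_points2 ? /attach_points2 ?; exact: rhot.
    + move=> x' y' /attach_points2 ? /attach_points2 ? [e eE h]; apply: rhos => //.
      by exists e => //; rewrite inE eE orbT.
  have Ga := attach_points1 G1a; have Gb := attach_points1 G1b.
  have nP z : G z -> ~ P1 z -> G2 z by rewrite -PU => -[].
  move=> x y Gx Gy; rewrite /d.
  have [Px|nPx] := pselect (P1 x); have [Py|nPy] := pselect (P1 y).
  + by rewrite glueP // r1 //; exact: P1G1.
  + have G1x := P1G1 Px; have G2y := nP _ Gy nPy.
    by rewrite glue_mixed // le_min (le_trans (rhot _ _ _ Gx Ga Gy)) ?lerD ?r1 ?r2 //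
      (le_trans (rhot _ _ _ Gx Gb Gy)) ?lerD ?r1 ?r2.
  + have G1y := P1G1 Py; have G2x := nP _ Gx nPx.
    by rewrite glue_mixedC // le_min (le_trans (rhot _ _ _ Gx Ga Gy)) ?lerD ?r1 ?r2 //
      (le_trans (rhot _ _ _ Gx Gb Gy)) ?lerD ?r1 ?r2.
  + by have G2x := nP _ Gx nPx; have G2y := nP _ Gy nPy; rewrite -/d dQ // r2.
Qed.

Lemma attach_metric2 x y : G2 x -> G2 y -> d x y = d2 x y.
Proof. exact: dQ. Qed.

(** Here [y] is inside the shared edge, which gluing assigns to the second graph, so [d x y] is
    measured through [a] or [b]. By [path_metric_through], [d1] loses nothing on such a route. *)
Let d1_half x y : G1 x -> G1 y -> P1 x -> ~ P1 y -> d x y = d1 x y.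
Proof.
move=> G1x G1y Px nPy; have [yab abE1 abE2] := open_edge G1y nPy.
have yab' : gsupport y \subset [set a; b]%SET by rewrite yab.
rewrite /d glue_mixed // -!d12 ?ab_sub //.
have ta := pp1.2 _ _ _ G1x G1a G1y; have tb := pp1.2 _ _ _ G1x G1b G1y.
apply/eqP; rewrite eq_le [X in _ && X]le_min ta tb !andbT.
have [xab|xab] := pselect (gsupport x \subset [set a; b]%SET).
  by case: Px => _ /(_ xab)[]->; rewrite pp1.1 // add0r ge_min lexx ?orbT.
exact: (path_metric_through m1).
Qed.

Lemma attach_metric1 x y : G1 x -> G1 y -> d x y = d1 x y.
Proof.
move=> G1x G1y.
have [Px|nPx] := pselect (P1 x); have [Py|nPy] := pselect (P1 y).
- by rewrite /d glueP.
- exact: d1_half.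
- rewrite (path_metricC attach_path_metric); [|exact: attach_points1|exact: attach_points1].
  by rewrite (path_metricC m1) //; exact: d1_half.
- have [xab _ _] := open_edge G1x nPx; have [yab _ _] := open_edge G1y nPy.
  by rewrite dQ ?d12 ?xab ?yab //; apply: attach_points12; rewrite ?xab ?yab.
Qed.

Let d1ab : d1 (delta b) (delta a) <= 1.
Proof.
case: abE => [ab|[abE1 _]]; first by rewrite {1}ab pp1.1 // ler01.
rewrite (path_metric_pair m1 (u := a) (v := b)) ?ab_sub //; exact: l1_half_le1 G1b G1a.
Qed.

Lemma attach_metric_edge :
  d (delta a) (delta b) <= 1 /\ d (delta b) (delta a) <= 1.
Proof. by rewrite !attach_metric1 // [X in X <= 1](path_metricC m1) //; split; exact: d1ab. Qed.

Lemma attach_metric_through x y : G1 x -> ~ G2 x -> G2 y -> ~ G1 y ->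
  d x y = Num.min (d x (delta a) + d (delta a) y) (d x (delta b) + d (delta b) y).
Proof.
move=> G1x nG2x G2y nG1y.
rewrite (attach_metric1 G1x G1a) (attach_metric1 G1x G1b).
rewrite (attach_metric2 G2a G2y) (attach_metric2 G2b G2y).
have [P1x|[//]] := G1P1 G1x; rewrite /d glue_mixed // => /P1G1; exact: nG1y.
Qed.

Section Near.
Variables (P Q : set pt) (r : R) (s : set pt).
Hypotheses (sub1 : P = G1 /\ Q = G2 \/ P = G2 /\ Q = G1).
Hypothesis (s_diam : forall x y, s x -> s y -> d x y <= r).

Let dm := attach_path_metric.
Let dC x y : G x -> G y -> d x y = d y x. Proof. exact: path_metricC dm _ _. Qed.
Let d0 x y : G x -> G y -> 0 <= d x y. Proof. exact: path_metric_ge0 dm _ _. Qed.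
Let PG : P `<=` G.
Proof. by case: sub1 => -[-> _]; [exact: attach_points1|exact: attach_points2]. Qed.
Let QG : Q `<=` G.
Proof. by case: sub1 => -[_ ->]; [exact: attach_points2|exact: attach_points1]. Qed.
Let Ga : G (delta a). Proof. exact: attach_points1. Qed.
Let Gb : G (delta b). Proof. exact: attach_points1. Qed.

Let through x y : P x -> ~ Q x -> Q y -> ~ P y ->
  d x y = Num.min (d x (delta a) + d (delta a) y) (d x (delta b) + d (delta b) y).
Proof.
case: sub1 => -[-> ->] h1 h2 h3 h4; first exact: attach_metric_through.
have Gx := attach_points2 h1; have Gy := attach_points1 h3.
by rewrite dC // attach_metric_through // !(dC Gy) // !(dC _ Gx) // addrC [X in Num.min _ X]addrC.
Qed.

Let d_ab : d (delta b) (delta a) <= 1.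
Proof. by rewrite attach_metric1 //; exact: d1ab. Qed.

Local Lemma near_side z1 z2 y : P z1 -> ~ Q z1 -> P z2 -> ~ Q z2 -> Q y -> ~ P y ->
  s z1 -> s z2 -> s y -> r < d z1 (delta a) -> r < d z2 (delta b) -> False.
Proof.
move=> P1z nQ1 P2z nQ2 Qy nPy s1 s2 sy far1 far2.
have Gy := QG Qy; have Gz1 := PG P1z; have Gz2 := PG P2z.
have := s_diam s1 sy; rewrite through // ge_min => /orP[h|h1].
  by have := d0 Ga Gy; lra.
have := s_diam s2 sy; rewrite through // ge_min => /orP[h2|h]; last first.
  by have := d0 Gb Gy; lra.
have [_ [_ dt] _ _] := dm.
have t1 := dt _ _ _ Gz1 Gb Ga; have t2 := dt _ _ _ Gz2 Ga Gb.
have dab' := d_ab; have dba' : d (delta a) (delta b) <= 1 by rewrite dC.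
(* The route from [z2] to [y] passes through [a] and has length at most [r], while [z2] is more than
   [r] from [b] and at most 1 farther from [b] than from [a]. *)
have c1 : d (delta a) y < 1 by lra.
have c2 : d (delta b) y < 1 by lra.
(* If [y] had coordinate 0 at [a], the bound by coordinates would put it at distance at least 1 from
   [a]. *)
have ya : y a != 0.
  apply: contraTneq c1 => y0; rewrite -leNgt.
  by have := path_metric_coord dm a Ga Gy; rewrite y0 ffunE eqxx subr0 normr1.
have yb : y b != 0.
  apply: contraTneq c2 => y0; rewrite -leNgt.
  by have := path_metric_coord dm b Gb Gy; rewrite y0 ffunE eqxx subr0 normr1.
have yab : gsupport y \subset [set a; b]%SET.
  have [ab|ab] := eqVneq a b.
    by have := d0 Gb Gy; move: far1; rewrite ab; lra.
  have : [set a; b]%SET \subset gsupport y.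
    by apply/fintype.subsetP => w; rewrite !inE => /orP[]/eqP->.
  move=> aby; suff -> : gsupport y = [set a; b]%SET by [].
  apply/esym/eqP; rewrite eqEcard aby cards2 ab.
  exact: points_card_le wf Gy.
by apply: nPy; move: Qy; case: sub1 => -[-> ->] Qy;
  [exact: attach_points21|exact: attach_points12].
Qed.

End Near.

(* If z1 is far from a and z2 far from b, both on the same side, then the
   distances from a and b to a point y of s on the other side are less than 1,
   so that y lies on the edge ab. *)
Lemma attach_metric_near (r : R) (s : set pt) x y : 1 <= r -> s `<=` G ->
  (forall x y, s x -> s y -> d x y <= r) ->
  s x -> G1 x -> ~ G2 x -> s y -> G2 y -> ~ G1 y ->
  (forall z, s z -> d z (delta a) <= r /\ d (delta a) z <= r) \/
  (forall z, s z -> d z (delta b) <= r /\ d (delta b) z <= r).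
Proof.
move=> r1 sG sd sx G1x nG2x sy G2y nG1y.
have dm := attach_path_metric.
have Ga : G (delta a) by exact: attach_points1.
have Gb : G (delta b) by exact: attach_points1.
have sym (z w : pt) : G z -> G w -> d z w = d w z by exact: path_metricC.
have ge0 (z w : pt) : G z -> G w -> 0 <= d z w by exact: path_metric_ge0.
suff h : (forall z, s z -> d z (delta a) <= r) \/ (forall z, s z -> d z (delta b) <= r).
  by case: h => h; [left|right] => z sz; rewrite [X in _ /\ X <= _]sym; auto.
apply: contrapT => /not_orP[] /existsNP[z1 /not_implyP[s1 /negP far1]]
  /existsNP[z2 /not_implyP[s2 /negP far2]].
rewrite -ltNge in far1; rewrite -ltNge in far2.
have both_near z : G1 z -> G2 z -> d z (delta a) <= r /\ d z (delta b) <= r.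
  move=> G1z G2z; have zab := attach_pointsI G1z G2z; rewrite !attach_metric1 //.
  case: abE => [ab|[abE1 _]].
    have -> : z = delta a by apply: (points_delta G1z); rewrite -(finset.setUid [set a]%SET) {2}ab.
    by rewrite -ab !pp1.1 //; split; apply: le_trans r1; exact: ler01.
  rewrite !(path_metric_pair m1 (u := a) (v := b)) ?ab_sub //.
  by split; apply: le_trans r1; [exact: l1_half_le1 G1z G1a|exact: l1_half_le1 G1z G1b].
have side z : G z -> (r < d z (delta a) \/ r < d z (delta b)) ->
    G1 z /\ ~ G2 z \/ G2 z /\ ~ G1 z.
  move=> Gz h; have [G1z|nG1z] := pselect (G1 z); have [G2z|nG2z] := pselect (G2 z).
  - by exfalso; have [? ?] := both_near z G1z G2z; case: h => ?; lra.
  - by left.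
  - by right.
  - by move: Gz; rewrite attach_pointsU => -[].
have := side _ (sG _ s1) (or_introl far1); have := side _ (sG _ s2) (or_intror far2).
(* For points on opposite sides the route within [r] uses a single gate, which is then within [r] of
   both. So [z1] and [z2] must lie on the same side. *)
have mixed12 (z w : pt) : s z -> s w -> G1 z -> ~ G2 z -> G2 w -> ~ G1 w ->
    d z (delta a) <= r /\ d w (delta a) <= r \/ d z (delta b) <= r /\ d w (delta b) <= r.
  move=> sz sw h1 h2 h3 h4; have := sd _ _ sz sw.
  have Gz := sG _ sz; have Gw := sG _ sw.
  rewrite attach_metric_through // ge_min (sym _ w) // (sym _ w) //.
  have := ge0 _ _ Gz Ga; have := ge0 _ _ Gz Gb; have := ge0 _ _ Gw Ga; have := ge0 _ _ Gw Gb.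
  by move=> ? ? ? ? /orP[] ?; [left|right]; split; lra.
case=> [[G2' nG2']|[G2' nG2']] [[G1' nG1']|[G1' nG1']].
- exact: (near_side (or_introl (conj erefl erefl)) sd G1' nG1' G2' nG2' G2y nG1y s1 s2 sy far1 far2).
- by case: (mixed12 _ _ s2 s1 G2' nG2' G1' nG1') => -[? ?]; lra.
- by case: (mixed12 _ _ s1 s2 G1' nG1' G2' nG2') => -[? ?]; lra.
- exact: (near_side (or_intror (conj erefl erefl)) sd G1' nG1' G2' nG2' G1x nG2x s1 s2 sx far1 far2).
Qed.

End Attach.
End AttachMetric.

(** * Vertices, edges and cycles *)

Section Pieces.
Context (R : realType) (V : finType).
Local Notation pt := {ffun V -> R}.
Local Notation delta := (@delta R V).
Local Notation graph_points := (@graph_points R V).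

Lemma vertex_path_metric (v : V) :
  path_metric [set v]%SET finset.set0 (fun _ _ : pt => 0).
Proof.
split=> [e||x y _ _ [e]|rho [rho0 _] _ x y Px Py]; try by rewrite inE.
  by split=> // x y z _ _ _; rewrite addr0.
have [_ _ xv _] := Px; have [_ _ yv _] := Py.
by rewrite (points_delta Px xv) (points_delta Py yv) rho0 //; apply: delta_points; rewrite inE.
Qed.

Lemma edge_path_metric (u w : V) : u != w ->
  path_metric [set u; w]%SET [set [set u; w]%SET]%SET (@l1_half R V).
Proof.
move=> uw; split=> [e||//|rho _ rhos x y Px Py].
- by rewrite inE => /eqP->; rewrite cards2 uw.
- by split=> *; [exact: l1_halfxx|exact: l1_half_triangle].
- have [_ _ xS _] := Px; have [_ _ yS _] := Py.
  by apply: rhos => //; exists [set u; w]%SET; rewrite ?inE.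
Qed.

(** * The arc-length parametrization of a cycle *)

Section Cycle.
Variables (c : seq V) (v0 : V).
Hypotheses (c3 : (3 <= size c)%N) (uc : uniq c).
Local Notation k := (size c).
Local Notation G := (graph_points [set x in c]%SET (cycle_edges c)).
Implicit Types (x y : pt) (s t f g : R) (i j : nat).

Let k0 : (0 < k)%N. Proof. exact: leq_trans c3. Qed.
Let k2 : (1 < k)%N. Proof. exact: leq_trans c3. Qed.

Definition cycle_vertex i : V := nth v0 c (i %% k).
Local Notation vert := cycle_vertex.

Lemma cycle_vertex_eq i j : (vert i == vert j) = (i == j %[mod k]).
Proof. by rewrite /vert nth_uniq ?ltn_pmod. Qed.

Lemma cycle_vertex_mem i : vert i \in c.
Proof. by rewrite mem_nth // ltn_pmod. Qed.

Lemma cycle_vertex_succ i j : vert i = vert j -> vert i.+1 = vert j.+1.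
Proof.
move=> /eqP; rewrite cycle_vertex_eq => ij; apply/eqP.
by rewrite cycle_vertex_eq -(addn1 i) -(addn1 j) eqn_modDr.
Qed.

Lemma cycle_vertex_neq1 i : vert i != vert i.+1.
Proof.
by rewrite cycle_vertex_eq -{1}[i]addn0 -[i.+1]addn1 eqn_modDl mod0n modn_small.
Qed.

Lemma cycle_vertex_neq2 i : vert i != vert i.+2.
Proof.
by rewrite cycle_vertex_eq -{1}[i]addn0 -[i.+2]addn2 eqn_modDl mod0n modn_small.
Qed.

Lemma cycle_vertex_period i : vert (i + k) = vert i.
Proof. by apply/eqP; rewrite cycle_vertex_eq modnDr. Qed.

Lemma cycle_vertex_surj v : v \in c -> exists2 i, (i < k)%N & v = vert i.
Proof.
move=> vc; exists (index v c); first by rewrite index_mem.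
by rewrite /vert modn_small ?index_mem // nth_index.
Qed.

Lemma next_cycle_vertex i : next c (vert i) = vert i.+1.
Proof.
have := cycle_vertex_mem i; rewrite next_nth => ->.
rewrite /vert index_uniq ?ltn_pmod //.
case E : c k0 => [//|y p] _; rewrite -E.
have ik : (i %% k < k)%N by rewrite ltn_pmod.
have [h|h] := eqVneq (i %% k).+1 k.
  have -> : (i.+1 %% k = 0)%N by rewrite -addn1 -modnDml addn1 h modnn.
  by rewrite nth_default ?E //; move: h; rewrite E /= => -[->].
have h' : ((i %% k).+1 < k)%N by rewrite ltn_neqAle h.
have -> : (i.+1 %% k = (i %% k).+1)%N by rewrite -addn1 -modnDml addn1 modn_small.
by rewrite E /=; apply: set_nth_default; rewrite E in h'.
Qed.

Lemma cycle_edgesP e :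
  reflect (exists2 i, (i < k)%N & e = [set vert i; vert i.+1]%SET) (e \in cycle_edges c).
Proof.
apply: (iffP imsetP) => [[x xc ->]|[i ik ->]].
  by have [i ik ->] := cycle_vertex_surj xc; exists i => //; rewrite next_cycle_vertex.
by exists (vert i); rewrite ?next_cycle_vertex //; exact: cycle_vertex_mem.
Qed.

Definition cycle_segment i f : pt :=
  [ffun v => (1 - f) * (v == vert i)%:R + f * (v == vert i.+1)%:R].
Local Notation seg := cycle_segment.

Lemma cycle_segment_l i f : seg i f (vert i) = 1 - f.
Proof. by rewrite ffunE eqxx (negbTE (cycle_vertex_neq1 i)) mulr1 mulr0 addr0. Qed.

Lemma cycle_segment_r i f : seg i f (vert i.+1) = f.
Proof. by rewrite ffunE eqxx eq_sym (negbTE (cycle_vertex_neq1 i)) mulr1 mulr0 add0r. Qed.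

Lemma cycle_segment_sub i f : gsupport (seg i f) \subset [set vert i; vert i.+1]%SET.
Proof.
apply/fintype.subsetP => v; rewrite !inE ffunE; apply: contraNT.
by rewrite negb_or => /andP[/negbTE-> /negbTE->]; rewrite !mulr0 addr0.
Qed.

Lemma cycle_segment0 i : seg i 0 = delta (vert i).
Proof. by apply/ffunP => v; rewrite !ffunE subr0 mul1r mul0r addr0. Qed.

Lemma cycle_segment1 i : seg i 1 = delta (vert i.+1).
Proof. by apply/ffunP => v; rewrite !ffunE subrr mul0r mul1r add0r. Qed.

Lemma cycle_segment_points i f : 0 <= f <= 1 -> G (seg i f).
Proof.
have dG j : G (delta (vert j)) by apply: delta_points; rewrite inE cycle_vertex_mem.
case/andP; rewrite le_eqVlt => /predU1P[<- _|f0]; first by rewrite cycle_segment0.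
rewrite le_eqVlt => /predU1P[->|f1]; first by rewrite cycle_segment1.
have supp : gsupport (seg i f) = [set vert i; vert i.+1]%SET.
  apply/eqP; rewrite finset.eqEsubset cycle_segment_sub.
  apply/fintype.subsetP => v; rewrite !inE => /orP[]/eqP->.
    by rewrite cycle_segment_l lt0r_neq0 // subr_gt0.
  by rewrite cycle_segment_r lt0r_neq0.
split.
- move=> v; rewrite ffunE addr_ge0 ?mulr_ge0 ?ler0n //; lra.
- rewrite (bigID (mem [set vert i; vert i.+1]%SET)) /= [X in _ + X]big1 ?addr0.
    rewrite big_setU1 ?inE ?cycle_vertex_neq1 //= big_set1 cycle_segment_l cycle_segment_r.
    by rewrite subrK.
  move=> v; rewrite !inE negb_or ffunE => /andP[/negbTE-> /negbTE->].
  by rewrite !mulr0 addr0.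
- rewrite supp; apply/fintype.subsetP => v; rewrite !inE.
  by move=> /orP[]/eqP->; exact: cycle_vertex_mem.
- by apply/orP; right; rewrite supp; apply/cycle_edgesP; exists (i %% k)%N;
    rewrite ?ltn_pmod // /vert modn_mod -[in RHS]addn1 modnDml addn1.
Qed.

Lemma cycle_segmentE i x : G x -> gsupport x \subset [set vert i; vert i.+1]%SET ->
  x = seg i (x (vert i.+1)) /\ 0 <= x (vert i.+1) <= 1.
Proof.
move=> Gx xe; have xp := points_pair Gx (cycle_vertex_neq1 i) xe.
have [x0 _ _ _] := Gx; have h0 := x0 (vert i); have h1 := x0 (vert i.+1).
split; last by rewrite h1; lra.
apply/ffunP => v; have [->|vi] := eqVneq v (vert i); first by rewrite cycle_segment_l; lra.
have [->|vi1] := eqVneq v (vert i.+1); first by rewrite cycle_segment_r.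
rewrite ffunE (negbTE vi) (negbTE vi1) !mulr0 addr0.
by apply: contraNeq vi => xv; have : v \in gsupport x by [rewrite inE];
  move/(fintype.subsetP xe); rewrite !inE (negbTE vi1) orbF.
Qed.

Definition cycle_param s : pt := seg (Num.truncn s) (s - (Num.truncn s)%:R).
Local Notation gam := cycle_param.

Lemma cycle_paramE i f : 0 <= f <= 1 -> gam (i%:R + f) = seg i f.
Proof.
case/andP=> f0; rewrite le_eqVlt => /predU1P[->|f1].
  rewrite /gam natr1 (@truncn_def _ _ i.+1) ?lexx ?ltr_nat ?ltnSn //.
  by rewrite subrr cycle_segment0 cycle_segment1.
rewrite /gam (@truncn_def _ _ i); first by rewrite [_ + f]addrC addrK.
by rewrite lerDl f0 -natr1 ltrD2l.
Qed.

Lemma nat_frac s : 0 <= s -> exists i f, [/\ s = i%:R + f, 0 <= f & f < 1].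
Proof.
move=> s0; have := truncn_itv s0; rewrite -natr1 => /andP[h1 h2].
by exists (Num.truncn s), (s - (Num.truncn s)%:R); split; lra.
Qed.

Lemma cycle_param_points s : 0 <= s -> G (gam s).
Proof.
move=> /nat_frac[i [f [-> f0 f1]]]; rewrite cycle_paramE ?f0 ?ltW //.
by apply: cycle_segment_points; rewrite f0 ltW.
Qed.

Lemma cycle_param_period s : 0 <= s -> gam (s + k%:R) = gam s.
Proof.
move=> /nat_frac[i [f [-> f0 f1]]]; rewrite addrAC -natrD !cycle_paramE ?f0 ?ltW //.
by rewrite /seg -addSn !cycle_vertex_period.
Qed.

Lemma cycle_param_surj x : G x -> exists2 s, 0 <= s < k%:R & gam s = x.
Proof.
move=> Gx; have [_ _ xS /orP[/cards1P[w xw]|/cycle_edgesP[i ik xE]]] := Gx.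
  have wc : w \in c by move: xS; rewrite xw finset.sub1set inE.
  have [i ik wi] := cycle_vertex_surj wc.
  exists i%:R; first by rewrite ler0n ltr_nat.
  rewrite -[i%:R]addr0 cycle_paramE ?lexx ?ler01 // cycle_segment0 -wi.
  by apply/esym/(points_delta Gx); rewrite xw.
have xe : gsupport x \subset [set vert i; vert i.+1]%SET by rewrite xE.
have [xs /andP[f0 f1]] := cycle_segmentE Gx xe.
have xi : vert i \in gsupport x by rewrite xE !inE eqxx.
have fl : x (vert i.+1) < 1.
  rewrite lt_def f1 andbT; apply: contraTneq xi => e.
  by rewrite inE negbK {1}xs cycle_segment_l -e subrr.
exists (i%:R + x (vert i.+1)); last by rewrite cycle_paramE ?f0.
rewrite addr_ge0 //=; apply: (@lt_le_trans _ _ (i.+1%:R)); last by rewrite ler_nat.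
by rewrite -natr1 ltrD2l.
Qed.

Lemma cycle_param_inj s t : 0 <= s < k%:R -> 0 <= t < k%:R -> gam s = gam t -> s = t.
Proof.
case/andP=> + + /andP[+ +].
move=> /nat_frac[i [f [-> f0 f1]]] sk /nat_frac[j [g [-> g0 g1]]] tk.
have ik : (i < k)%N by rewrite -(ltr_nat R); lra.
have jk : (j < k)%N by rewrite -(ltr_nat R); lra.
rewrite !cycle_paramE ?f0 ?g0 ?ltW // => E.
have [ij|ij] := eqVneq (vert i) (vert j).
  have : i = j by move/eqP: ij; rewrite cycle_vertex_eq !modn_small // => /eqP.
  move=> e; move: E; rewrite e => /(congr1 (fun x : pt => x (vert j.+1))).
  by rewrite !cycle_segment_r => ->.
have h1 := congr1 (fun x : pt => x (vert i)) E; have h2 := congr1 (fun x : pt => x (vert j)) E.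
rewrite /= cycle_segment_l ffunE (negbTE ij) mulr0 add0r in h1.
rewrite /= cycle_segment_l ffunE eq_sym (negbTE ij) mulr0 add0r in h2.
(* Two distinct half-open edges with a common point would each start where the other ends, so a
   vertex would equal its second successor, which is impossible for at least three vertices. *)
have [e1|e1] := eqVneq (vert i) (vert j.+1); last by move: h1; rewrite (negbTE e1) mulr0; lra.
have [e2|e2] := eqVneq (vert j) (vert i.+1); last by move: h2; rewrite (negbTE e2) mulr0; lra.
by have := cycle_vertex_neq2 i; rewrite {1}e1 (cycle_vertex_succ e2) eqxx.
Qed.

Definition arc s t : R := Num.min `|s - t| (k%:R - `|s - t|).
Definition cycle_pos x : R := xget 0 [set s | 0 <= s < k%:R /\ gam s = x].
Local Notation pos := cycle_pos.
Definition cycle_metric x y : R := arc (pos x) (pos y).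

Lemma cycle_posP x : G x -> 0 <= pos x < k%:R /\ gam (pos x) = x.
Proof.
by move=> /cycle_param_surj[s sk sx]; rewrite /pos; case: xgetP => [? -> //|/(_ s)[]].
Qed.

Lemma cycle_paramK s : 0 <= s < k%:R -> pos (gam s) = s.
Proof.
move=> sk; have s0 : 0 <= s by case/andP: sk.
by have [h1 h2] := cycle_posP (cycle_param_points s0); apply: cycle_param_inj.
Qed.

Lemma arc_triangle s t w : 0 <= s < k%:R -> 0 <= t < k%:R -> 0 <= w < k%:R ->
  arc s w <= arc s t + arc t w.
Proof.
move=> /andP[s0 sk] /andP[t0 tk] /andP[w0 wk]; rewrite /arc.
have h1 := ler_distD t s w; have h2 := ler_distD w s t; have h3 := ler_distD s t w.
rewrite (distrC w t) in h2; rewrite (distrC t s) in h3.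
(* Three points on a segment of length k have pairwise distances of total at most 2k; this settles
   the case where both short arcs on the right wrap around. *)
have h4 : `|s - t| + `|t - w| + `|s - w| <= 2 * k%:R.
  by case: (lerP w s) => ?; case: (lerP t s) => ?; case: (lerP w t) => ?; lra.
move: `|s - w| `|s - t| `|t - w| h1 h2 h3 h4 => ? ? ? ? ? ? ?; min_lra.
Qed.

(** Allowing the parameter k, which names the same point as 0, lets the last edge be treated like
    the others. *)
Lemma cycle_metric_param s t : 0 <= s <= k%:R -> 0 <= t <= k%:R ->
  cycle_metric (gam s) (gam t) = arc s t.
Proof.
have gk : gam k%:R = gam 0 by rewrite -[k%:R]add0r cycle_param_period.
have kR : 0 < k%:R :> R by rewrite ltr0n.
have p0 : pos (gam 0) = 0 by rewrite cycle_paramK // lexx.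
move=> /andP[s0]; rewrite le_eqVlt => /predU1P[->|sk] /andP[t0];
  rewrite le_eqVlt => /predU1P[->|tk]; rewrite /cycle_metric ?gk ?p0 ?cycle_paramK ?s0 ?t0 //.
- by rewrite /arc !subrr.
- rewrite /arc sub0r normrN ger0_norm // ger0_norm ?subr_ge0 ?ltW // minC.
  by congr Num.min; lra.
- rewrite /arc subr0 ger0_norm // ler0_norm ?subr_le0 ?ltW // minC.
  by congr Num.min; lra.
Qed.

Section Max.
Variable rho : pt -> pt -> R.
Hypotheses (rp : pseudo G rho) (rs : forall i f g, 0 <= f <= 1 -> 0 <= g <= 1 ->
  rho (seg i f) (seg i g) <= `|f - g|).

Let gN i : G (gam i%:R). Proof. exact: cycle_param_points. Qed.

Let rho_step i f g : 0 <= f <= 1 -> 0 <= g <= 1 ->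
  rho (gam (i%:R + f)) (gam (i%:R + g)) <= `|f - g|.
Proof. by move=> hf hg; rewrite !cycle_paramE //; exact: rs. Qed.

Let rho_nat i n : rho (gam i%:R) (gam (i + n)%:R) <= n%:R.
Proof.
elim: n => [|n IH]; first by rewrite addn0 rp.1.
apply: le_trans (rp.2 _ _ _ (gN i) (gN (i + n)) (gN (i + n.+1))) _.
rewrite -natr1 lerD // -[X in gam X]addr0 addnS -[X in rho _ (gam X)]natr1.
by apply: le_trans (rho_step _ _ _) _; rewrite ?lexx ?ler01 // sub0r normrN normr1.
Qed.

(** The path is cut at whole parameters. The parameter [t] has no upper bound, so arcs that pass the
    starting vertex are covered. *)
Lemma cycle_param_le s t : 0 <= s -> s <= t -> rho (gam s) (gam t) <= t - s.
Proof.
move=> s0 st; have t0 := le_trans s0 st.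
have Gs := cycle_param_points s0; have Gt := cycle_param_points t0.
have [i [f [se f0 f1]]] := nat_frac s0; have [j [g [te g0 g1]]] := nat_frac t0.
have ij : (i <= j)%N by rewrite -ltnS -(ltr_nat R) -natr1; lra.
move: ij; rewrite leq_eqVlt => /predU1P[ij|ij].
  have := rho_step i (f := f) (g := g); rewrite f0 g0 (ltW f1) (ltW g1) => /(_ isT isT).
  move: st; rewrite se te ij => st; rewrite ler0_norm; lra.
have e1 : rho (gam s) (gam i.+1%:R) <= 1 - f.
  have := rho_step i (f := f) (g := 1); rewrite f0 ler01 lexx (ltW f1) natr1 -se => /(_ isT isT).
  by rewrite ler0_norm; lra.
have e2 : rho (gam i.+1%:R) (gam j%:R) <= j%:R - i%:R - 1.
  have := rho_nat i.+1 (j - i.+1); rewrite subnKC // natrB // -[i.+1%:R in X in _ <= X]natr1; lra.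
have e3 : rho (gam j%:R) (gam t) <= g.
  have := rho_step j (f := 0) (g := g); rewrite lexx ler01 g0 (ltW g1) addr0 -te => /(_ isT isT).
  by rewrite sub0r normrN ger0_norm.
have t1 := rp.2 _ _ _ Gs (gN i.+1) Gt; have t2 := rp.2 _ _ _ (gN i.+1) (gN j) Gt.
lra.
Qed.

End Max.

Lemma cycle_path_metric : path_metric [set x in c]%SET (cycle_edges c) cycle_metric.
Proof.
split.
- move=> e /cycle_edgesP[i ik ->]; rewrite cards2 cycle_vertex_neq1; split=> //.
  by apply/fintype.subsetP => v; rewrite !inE => /orP[]/eqP->; exact: cycle_vertex_mem.
- split=> [x Gx|x y z /cycle_posP[? _] /cycle_posP[? _] /cycle_posP[? _]].
    by rewrite /cycle_metric /arc subrr normr0 subr0 min_l // ler0n.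
  exact: arc_triangle.
- move=> x y Gx Gy [e /cycle_edgesP[i ik ->]] [xe ye].
  rewrite (l1_half_pair Gx Gy (u := vert i.+1) (v := vert i)); last 3 first.
    by rewrite eq_sym cycle_vertex_neq1.
    by rewrite finset.setUC.
    by rewrite finset.setUC.
  have [ex fx] := cycle_segmentE Gx xe; have [ey gy] := cycle_segmentE Gy ye.
  rewrite ex ey !cycle_segment_r.
  rewrite -!cycle_paramE //.
  have in_itv f : 0 <= f <= 1 -> 0 <= i%:R + f <= k%:R.
    have : (i.+1%:R : R) <= k%:R by rewrite ler_nat.
    by rewrite -natr1 => ? /andP[? ?]; have := ler0n R i => ?; apply/andP; split; lra.
  rewrite cycle_metric_param.
  + rewrite /arc ge_min; apply/orP; left.
    by rewrite (_ : i%:R + _ - _ = x (vert i.+1) - y (vert i.+1)) //; lra.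
  + exact: (in_itv _ fx).
  + exact: (in_itv _ gy).
- move=> rho rp rs x y Gx Gy.
  have [/andP[s0 sk] gs] := cycle_posP Gx; have [/andP[t0 tk] gt] := cycle_posP Gy.
  have r1 i f g : 0 <= f <= 1 -> 0 <= g <= 1 -> rho (seg i f) (seg i g) <= `|f - g|.
    move=> hf hg; have G1 := cycle_segment_points i hf; have G2 := cycle_segment_points i hg.
    apply: le_trans (rs _ _ G1 G2 _) _.
      exists [set vert i; vert i.+1]%SET; last by split; exact: cycle_segment_sub.
      by apply/cycle_edgesP; exists (i %% k)%N;
        rewrite ?ltn_pmod // /vert modn_mod -[in RHS]addn1 modnDml addn1.
    rewrite (l1_half_pair G1 G2 (u := vert i.+1) (v := vert i)) ?cycle_segment_r //.
    + by rewrite eq_sym cycle_vertex_neq1.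
    + by rewrite finset.setUC cycle_segment_sub.
    + by rewrite finset.setUC cycle_segment_sub.
  (* Since [rho] may be asymmetric, arcs traversed against the orientation are handled by its
     transpose. *)
  pose rho' x y := rho y x.
  have rp' : pseudo G rho'.
    by split=> [z|z1 z2 z3 ? ? ?]; [exact: rp.1|rewrite addrC; exact: rp.2].
  have r1' i f g : 0 <= f <= 1 -> 0 <= g <= 1 -> rho' (seg i f) (seg i g) <= `|f - g|.
    by move=> hf hg; rewrite /rho' distrC; exact: r1.
  rewrite /cycle_metric -{1}gs -{1}gt; move: (pos x) (pos y) s0 sk t0 tk => s t s0 sk t0 tk.
  have [st|ts] := leP s t.
    have h1 := cycle_param_le rp r1 s0 st.
    (* This is the complementary arc, from [t] up to [s + k]. *)
    have h2 : rho (gam s) (gam t) <= s + k%:R - t.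
      rewrite -(cycle_param_period s0); apply: (cycle_param_le rp' r1') => //.
      by rewrite (le_trans (ltW tk)) // lerDr.
    by rewrite /arc le_min ler0_norm; [apply/andP; split; lra|lra].
  have h1 := cycle_param_le rp' r1' t0 (ltW ts).
  have h2 : rho (gam s) (gam t) <= t + k%:R - s.
    rewrite -(cycle_param_period t0); apply: (cycle_param_le rp r1) => //.
    by rewrite (le_trans (ltW sk)) // lerDr.
  by rewrite /rho' in h1; rewrite /arc le_min ger0_norm; [apply/andP; split; lra|lra].
Qed.

End Cycle.
End Pieces.

(** * Embedded complexes and wedges *)

Section Embedding.
Context (R : realType) (Z1 Z2 : choiceType) (h : Z1 -> Z2).
Hypothesis hI : injective h.
Implicit Types (K : set (set Z1)) (L : set (set Z2)).

Definition partial_inverse (z' : Z2) : option Z1 :=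
  if pselect (exists z, h z = z') is left p then Some (sval (cid p)) else None.

Lemma partial_inverseK z : partial_inverse (h z) = Some z.
Proof.
rewrite /partial_inverse; case: pselect => [p|[]]; last by exists z.
by congr Some; apply: hI; case: (cid p).
Qed.

Lemma partial_inverse_Some z' z : partial_inverse z' = Some z -> h z = z'.
Proof. by rewrite /partial_inverse; case: pselect => // p [<-]; case: (cid p). Qed.

Definition extend (t : Z1 -> R) (z' : Z2) : R :=
  if partial_inverse z' is Some z then t z else 0.

Lemma extendK t z : extend t (h z) = t z.
Proof. by rewrite /extend partial_inverseK. Qed.

Lemma extend_support t : support_of (extend t) = h @` support_of t.
Proof.
apply/seteqP; split=> z'; last by move=> [z tz <-]; rewrite /support_of /= extendK.
rewrite /support_of /extend /=; case E: (partial_inverse z') => [z|]; last by rewrite eqxx.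
by move=> tz; exists z => //; exact: partial_inverse_Some.
Qed.

Lemma sum_extend (t : Z2 -> R) (r : seq Z1) : uniq r ->
  support_of t `<=` h @` [set` r] ->
  \sum_(z \in [set: Z2]) t z = \sum_(z <- r) t (h z).
Proof.
move=> ur tr; rewrite (@fsum_seq _ _ _ (map h r)) ?map_inj_uniq //.
  by rewrite big_map.
by move=> z /tr[z1 z1r <-]; exact: map_f.
Qed.

Section Maps.
Variables (K : set (set Z1)) (L : set (set Z2)) (cK : complex K).
Hypothesis hKL : forall s, K s -> L (h @` s).

Lemma embed_proof (t : realization R K) :
  [/\ forall z, 0 <= extend (sval t) z, L (support_of (extend (sval t))) &
      \sum_(z \in [set: Z2]) extend (sval t) z = 1].
Proof.
split.
- by move=> z; rewrite /extend; case: partial_inverse => // z1; exact: realization_ge0.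
- by rewrite extend_support; apply: hKL; exact: realization_simplex.
have [r ur tr] := finite_uniq_seq (cK.1 _ (realization_simplex t)).
rewrite (sum_extend ur); last by rewrite extend_support tr.
under eq_bigr do rewrite extendK.
by apply: realization_sum1 => //; rewrite tr.
Qed.

Definition embed (t : realization R K) : realization R L := exist _ _ (embed_proof t).

Lemma embed_continuous : continuous embed.
Proof.
apply: realization_map_continuous => s Ks.
have [r ur sr] := finite_uniq_seq (cK.1 _ Ks).
exists 1%N, (fun=> h @` s), (map h r); split.
- by move=> i _; exact: hKL.
- by move=> t ts; exists 0%N => //=; rewrite extend_support; exact: image_subset.
- move=> t ts /= z'; rewrite extend_support => -[z /ts sz <-] /=.
  by apply: map_f; rewrite sr in sz.
- move=> z' /=; rewrite /extend; case: (partial_inverse z') => [z|]; last exact: lip_cst.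
  exact: lip_coord.
Qed.

Lemma restrict_proof (t : realization R L) (s : set Z1) :
  K s -> support_of (sval t) `<=` h @` s ->
  [/\ forall z, 0 <= sval t (h z), K (support_of (fun z => sval t (h z))) &
      \sum_(z \in [set: Z1]) sval t (h z) = 1].
Proof.
move=> Ks ts; have ths : support_of (fun z => sval t (h z)) `<=` s.
  by move=> z /ts[z1 sz1 /hI <-].
split; [by move=> z; exact: realization_ge0|exact: cK.2 Ks ths|].
have [r ur sr] := finite_uniq_seq (cK.1 _ Ks).
rewrite (fsum_seq ur); last by move=> z /ths; rewrite sr.
rewrite -(sum_extend ur) -?sr //; by case: t {ts ths} => t [].
Qed.

Definition restrict (t : realization R L) s (Ks : K s) (ts : support_of (sval t) `<=` h @` s) :
  realization R K := exist _ _ (restrict_proof Ks ts).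

Lemma restrictK t s Ks ts : embed (@restrict t s Ks ts) = t.
Proof.
apply: realization_eq => z /=; rewrite /extend.
case E : (partial_inverse z) => [z1|] /=; first by rewrite (partial_inverse_Some E).
apply/esym/eqP; apply: contrapT => /negP /ts[z1 _ z1z].
by move: E; rewrite -z1z partial_inverseK.
Qed.

End Maps.

(** The simplex used by [restrict] comes from choice, but the coordinates of the result do not
    depend on it, which yields continuity of the inverse. *)
Lemma relabel K L : complex K -> (forall s', L s' <-> exists2 s, K s & s' = h @` s) ->
  homotopy_equivalent R (realization R K) (realization R L).
Proof.
move=> cK LE; have hKL s : K s -> L (h @` s) by move=> Ks; apply/LE; exists s.
have back (t : realization R L) : exists s, K s /\ support_of (sval t) `<=` h @` s.
  have /LE[s Ks ts] := realization_simplex t; exists s; split=> //.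
  by rewrite ts.
pose g t := restrict cK (svalP (cid (back t))).1 (svalP (cid (back t))).2.
have gE t z : sval (g t) z = sval t (h z) by [].
have gc : continuous g.
  apply: realization_map_continuous => s' /LE[s Ks ->].
  have [r ur sr] := finite_uniq_seq (cK.1 _ Ks).
  have supp t : support_of (sval t) `<=` h @` s -> support_of (sval (g t)) `<=` s.
    by move=> ts z tz; have [z1 sz1 /hI <-] := ts (h z) tz.
  exists 1%N, (fun=> s), r; split=> //.
  - by move=> t ts; exists 0%N => //; exact: supp.
  - by move=> t ts; rewrite -sr; exact: supp.
  - move=> z; apply: lip_coord; split=> [s1 /LE[s2 /(cK.1 s2)]|s1 s2 /LE[s3 Ks3 ->] s2s].
      by move=> fs ->; exact: finite_image.
    apply/LE; exists (h @^-1` s2).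
      by apply: cK.2 Ks3 _ => z1 /s2s[z2 ? /hI <-].
    apply/seteqP; split=> z1; last by move=> [z2 ? <-].
    by move=> h1; have [z2 ? E] := s2s _ h1; exists z2; rewrite ?/preimage /= ?E.
have ec := @embed_continuous _ _ cK hKL.
apply: (@homeo_homotopy_equivalent _ _ _ _ _ ec gc).
  by move=> t; apply: realization_eq => z; rewrite gE /= extendK.
by move=> t; exact: restrictK.
Qed.

End Embedding.

Section Rips.
Context (R : realType).

Lemma vietoris_ripsE (Z : Type) (d : Z -> Z -> R) (r : R) (s : set Z) : 0 <= r ->
  vietoris_rips d r s <-> finite_set s /\ forall x y, s x -> s y -> d x y <= r.
Proof.
move=> r0; rewrite /vietoris_rips /diam /=; set D := [set _ | p in _].
split=> -[fs h]; split=> //.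
  move=> x y sx sy; apply: le_trans h; apply: ub_le_sup; last by exists (x, y).
  have : finite_set D by apply: finite_image; exact: finite_setX.
  move=> /finite_seqP[l ->]; exists (\sum_(z <- undup l) `|z|) => z /= zl.
  rewrite (bigD1_seq z) ?mem_undup ?undup_uniq //=.
  by rewrite (le_trans (ler_norm z)) // lerDl sumr_ge0.
(* The empty simplex has diameter 0, the default value of [sup]; here [0 <= r] is used. *)
have [s0|/set0P[x sx]] := eqVneq s set0.
  by rewrite /D s0 setX0 image_set0 sup0.
apply: ge_sup; first by exists (d x x), (x, x).
by move=> _ [[y z] [/= sy sz] <-]; exact: h.
Qed.

End Rips.

(** * Complexes that share one vertex, and the topological wedge *)

Section Wedge.
Unset Implicit Arguments.
Context (R : realType) (n : nat) (Z : choiceType) (C : 'I_n -> choiceType).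
Variables (K : forall i, set (set (C i))) (cK : forall i, complex (K i)).
Variables (e : forall i, C i -> Z) (beta : forall i, C i) (x0 : Z).
Hypotheses (eI : forall i, injective (e i)) (ebeta : forall i, e i (beta i) = x0).
Hypothesis e_disjoint : forall i j (c : C i) (c' : C j), i != j -> e i c = e j c' -> e i c = x0.
Variable b : forall i, realization R (K i).
Hypothesis bE : forall i, sval (b i) (beta i) = 1.

Set Implicit Arguments.

(** The summand [full [set x0]] makes the complex a point when the family is empty. *)
Definition wedge_complex : set (set Z) :=
  full [set x0] `|` [set s | exists i, exists2 t, K i t & s = e i @` t].
Local Notation L := wedge_complex.

Lemma vertex_support (Z0 : choiceType) (K0 : set (set Z0)) (t : realization R K0) z :
  complex K0 -> sval t z = 1 -> forall z', z' != z -> sval t z' = 0.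
Proof.
move=> cK0 t1 z' z'z; have [r ur tr] := finite_uniq_seq (cK0.1 _ (realization_simplex t)).
have tr' : support_of (sval t) `<=` [set` r] by rewrite tr.
have zr : z \in r by apply: tr'; rewrite /support_of /= t1 oner_eq0.
have s1 := realization_sum1 ur tr'.
apply/eqP/negPn/negP => tz'; have z'r : z' \in r by exact: tr'.
move: s1; rewrite (bigD1_seq z) //= t1 => /eqP.
rewrite -subr_eq0 addrAC subrr add0r psumr_eq0; last by move=> *; exact: realization_ge0.
by move=> /allP/(_ z' z'r); rewrite z'z /= (negbTE tz').
Qed.

Lemma vertex_eq (Z0 : choiceType) (K0 : set (set Z0)) (t t' : realization R K0) z :
  complex K0 -> sval t z = 1 -> sval t' z = 1 -> t = t'.
Proof.
move=> cK0 t1 t1'; apply: realization_eq => z'; have [->|z'z] := eqVneq z' z.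
  by rewrite t1 t1'.
by rewrite !(vertex_support cK0 _ z'z).
Qed.

Let wedge_simplex i s : K i s -> L (e i @` s).
Proof. by move=> Ks; right; exists i, s. Qed.

Let Kbeta i : K i [set beta i].
Proof.
by apply: ((cK i).2 _ _ (realization_simplex (b i))) => _ ->; rewrite /support_of /= bE oner_eq0.
Qed.

Let f i : realization R (K i) -> realization R L :=
  embed (@eI i) (cK i) (@wedge_simplex i).

Let f_base i j : f (b i) = f (b j).
Proof.
have h k z : sval (f (b k)) z = if z == x0 then 1 else 0.
  rewrite /f /= -(ebeta k); case: eqP => [->|zb]; first by rewrite extendK.
  rewrite /extend; case E: partial_inverse => [c|] //.
  apply: vertex_support (bE k) _ _ => //; apply: contra_notN zb => /eqP cb.
  by rewrite -(partial_inverse_Some E) cb.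
by apply: realization_eq => z; rewrite !h.
Qed.

(** A point supported in two different circles is supported at [x0], hence is the vertex there, and
    the wedge identifies its two lifts. *)
Let lift_eq (t : realization R L) i j s s' (Ks : K i s) (Ks' : K j s')
    (ts : support_of (sval t) `<=` e i @` s) (ts' : support_of (sval t) `<=` e j @` s') :
  wedge_lift b (restrict (@eI i) (cK i) Ks ts) =
  wedge_lift b (restrict (@eI j) (cK j) Ks' ts') :> wedge b.
Proof.
have [ij|ij] := eqVneq i j.
  subst j; congr (wedge_lift b _); exact: realization_eq.
have base k s1 (Ks1 : K k s1) (ts1 : support_of (sval t) `<=` e k @` s1) :
    sval t x0 = 1 -> restrict (@eI k) (cK k) Ks1 ts1 = b k.
  move=> t1; apply: (vertex_eq (cK k) (z := beta k)); last exact: bE.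
  by change (sval t (e k (beta k)) = 1); rewrite ebeta.
have tx0 : support_of (sval t) `<=` [set x0].
  move=> z tz; have [c _ ez] := ts z tz; have [c' _ ez'] := ts' z tz.
  by rewrite -ez; apply: (e_disjoint _ _ _ c' ij); rewrite ez ez'.
have t1 : sval t x0 = 1.
  have := @realization_sum1 _ _ _ t [:: x0] isT; rewrite big_seq1; apply.
  by move=> z /tx0 ->; rewrite /= inE.
by rewrite !base //; exact: (wedge_liftE b (b j) (b i)).
Qed.

Hypothesis n0 : (0 < n)%N.

Let cover (t : realization R L) :
  exists p : {i : 'I_n & set (C i)},
    K (projT1 p) (projT2 p) /\ support_of (sval t) `<=` e (projT1 p) @` projT2 p.
Proof.
have [[_ tx0]|[i [s Ks ts]]] := realization_simplex t; last first.
  by exists (existT _ i s); split=> //=; rewrite ts.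
pose i0 := Ordinal n0; exists (existT _ i0 [set beta i0]); split; first exact: Kbeta.
by rewrite image_set1 ebeta.
Qed.

Let g (t : realization R L) : wedge b :=
  let c := cid (cover t) in
  wedge_lift b (restrict (@eI _) (cK _) (svalP c).1 (svalP c).2).

Let gE (t : realization R L) i s (Ks : K i s) (ts : support_of (sval t) `<=` e i @` s) :
  g t = wedge_lift b (restrict (@eI i) (cK i) Ks ts).
Proof. exact: lift_eq. Qed.

Let g_continuous : continuous g.
Proof.
apply/continuousP => U /wedge_openP oU; have : realization_open (g @^-1` U); last by [].
move=> s Ls t Ut ts.
(* Every simplex lies in one circle, even the vertex [x0] since there is a circle, so weak openness
   can be tested in that circle alone. *)
have [i [s' Ks' ss']] : exists i, exists2 s', K i s' & s `<=` e i @` s'.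
  case: Ls => [[_ sx0]|[i [s' Ks' ->]]]; last by exists i, s'.
  pose i0 := Ordinal n0; exists i0, [set beta i0]; first exact: Kbeta.
  by rewrite image_set1 ebeta.
have sub (t' : realization R L) :
    support_of (sval t') `<=` s -> support_of (sval t') `<=` e i @` s'.
  by move=> t's; exact: subset_trans ss'.
have {}Ut : U (g t) by [].
rewrite (gE Ks' (sub _ ts)) in Ut.
have oUi : realization_open (@wedge_lift _ _ b i @^-1` U) by exact: oU.
have [|d d0 hd] := oUi s' Ks' _ Ut; first by move=> c /(sub _ ts)[c' ? /eI <-].
exists d => // t' t's tt'; suff : U (g t') by [].
rewrite (gE Ks' (sub _ t's)).
apply: hd; first by move=> c /(sub _ t's)[c' ? /eI <-].
by move=> c; exact: tt'.
Qed.

Lemma wedge_complex_homotopy : homotopy_equivalent R (realization R L) (wedge b).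
Proof.
have fc : continuous (wedge_fun f : wedge b -> realization R L).
  by apply: wedge_fun_continuous => [i|//]; exact: embed_continuous.
apply: (@homeo_homotopy_equivalent R _ _ _ _ g_continuous fc) => [t|w].
  by rewrite /g; case: cid => p [Ks ts] /=; rewrite wedge_lift_funE // /f restrictK.
have [i _ [x _ <-]] : (\bigcup_i (@wedge_lift _ _ b i) @` setT) w by rewrite wedgeTE.
rewrite wedge_lift_funE //.
have ts : support_of (sval (f x)) `<=` e i @` support_of (sval x).
  by rewrite /f /= extend_support.
rewrite (gE (realization_simplex x) ts); congr (wedge_lift b _).
by apply: realization_eq => c /=; rewrite extendK.
Qed.

End Wedge.

Lemma point_complex_homotopy (R : realType) (Z : choiceType) (x0 : Z) :
  homotopy_equivalent R (realization R (full [set x0])) (discrete_topology unit : topologicalType).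
Proof.
have p0 : [/\ forall z, 0 <= ((z == x0)%:R : R),
    full [set x0] (support_of (fun z => (z == x0)%:R : R)) &
    \sum_(z \in [set: Z]) ((z == x0)%:R : R) = 1].
  have sup : support_of (fun z => (z == x0)%:R : R) `<=` [set x0].
    by move=> z; rewrite /support_of /= pnatr_eq0 eqb0 negbK => /eqP.
  split=> //; first by split=> //; exact: sub_finite_set sup (finite_set1 _).
  rewrite (@fsum_seq _ _ _ [:: x0]) ?big_seq1 ?eqxx // => z /sup ->.
  by rewrite inE.
pose p : realization R (full [set x0]) := exist _ _ p0.
have tE (t : realization R (full [set x0])) z : sval t z = sval p z.
  have [_ tx0] := realization_simplex t.
  have t1 : sval t x0 = 1.
    have := @realization_sum1 _ _ _ t [:: x0] isT; rewrite big_seq1; apply.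
    by move=> y /tx0 ->; rewrite /= inE.
  rewrite /=; case: eqP => [->//|zx]; apply/eqP/negPn/negP => /tx0; exact: zx.
pose f (_ : realization R (full [set x0])) : discrete_topology unit := tt.
pose g (_ : discrete_topology unit) := p.
apply: (@homeo_homotopy_equivalent _ _ _ f g).
- exact: cst_continuous.
- exact: cst_continuous.
- by move=> t; apply: realization_eq => z; rewrite (tE t).
- by case.
Qed.

(** * Induction over attachments *)

Section Assembly.
Context (R : realType) (V : finType) (n : nat) (k : n.-tuple nat) (r : R).
Hypothesis r1 : 1 <= r.
Variable beta : forall i : 'I_n, circle R (tnth k i).
Local Notation pt := {ffun V -> R}.
Local Notation Z := (pt + {i : 'I_n & circle R (tnth k i)})%type.
Local Notation delta := (@delta R V).
Local Notation graph_points := (@graph_points R V).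
Implicit Types (S : {set V}) (E : {set {set V}}) (d : pt -> pt -> R) (v a b : V) (j : nat).

Let r0 : 0 <= r. Proof. exact: le_trans ler01 r1. Qed.

(** The value 0 outside the left summand is a default: Rips complexes are formed only on points of a
    graph. *)
Definition lift_dist d (z w : Z) : R :=
  if z is inl x then if w is inl y then d x y else 0 else 0.

Definition graph_set S E : set Z := [set inl x | x in graph_points S E].

Definition graph_rips d S E : set (set Z) := rips (lift_dist d) r (graph_set S E).

Definition circle_rips (i : 'I_n) : set (set (circle R (tnth k i))) :=
  vietoris_rips (@circle_dist R (tnth k i)) r.

(** Base points go to the vertex [v] and all other points to a private summand, so distinct circles
    meet in [v] only. *)
Definition circle_embedding v (i : 'I_n) (c : circle R (tnth k i)) : Z :=
  if c == beta i then inl (delta v) else inr (existT _ i c).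

Arguments circle_rips : clear implicits.
Arguments circle_embedding : clear implicits.

Definition bouquet v j : set (set Z) :=
  [set s | exists i : 'I_n, (j <= i)%N /\
     exists2 t, circle_rips i t & s = circle_embedding v i @` t].

(** The graph still carries its first j cycles; those of index at least j have been detached and
    hang at [v]. *)
Definition state v j d S E : set (set Z) := graph_rips d S E `|` bouquet v j.

Lemma graph_rips_complex d S E : complex (graph_rips d S E).
Proof. exact: rips_complex. Qed.

Lemma circle_rips_complex i : complex (circle_rips i).
Proof.
split=> [s [//]|s s' /(vietoris_ripsE _ _ r0)[fs sd] s's].
apply/(vietoris_ripsE _ _ r0); split; first exact: sub_finite_set fs.
by move=> x y /s's sx /s's sy; exact: sd.
Qed.

Lemma circle_embedding_inj v i : injective (circle_embedding v i).
Proof.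
move=> c c'; rewrite /circle_embedding; case: eqP => [->|_]; case: eqP => [->|_] // [].
exact: existT_inj2.
Qed.

Lemma circle_embedding_base v i : circle_embedding v i (beta i) = inl (delta v).
Proof. by rewrite /circle_embedding eqxx. Qed.

Lemma circle_embedding_disjoint v (i i' : 'I_n) (c : circle R (tnth k i))
    (c' : circle R (tnth k i')) :
  i != i' -> circle_embedding v i c = circle_embedding v i' c' ->
  circle_embedding v i c = inl (delta v).
Proof.
rewrite /circle_embedding => /eqP ii'; case: eqP => // _; case: eqP => // _ E; case: ii'.
by have := congr1 (fun z : Z => if z is inr p then tag p else i) E.
Qed.

Lemma bouquet_complex v j : complex (bouquet v j).
Proof.
split=> [s [i [_ [t /(circle_rips_complex i).1 ft ->]]]|s s' [i [ji [t Kt ->]]] s't].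
  exact: finite_image.
exists i; split=> //; exists (circle_embedding v i @^-1` s').
  by apply: ((circle_rips_complex i).2 _ _ Kt) => c /s't[c' ? /circle_embedding_inj <-].
apply/seteqP; split=> z; last by move=> [c ? <-].
by move=> s'z; have [c _ cz] := s't _ s'z; exists c => //=; rewrite /preimage /= cz.
Qed.

(** Two points of one edge are at distance at most 1, hence at most [r], so each edge step is an
    edge of the Rips complex. *)
Lemma linked_graph_rips d S E (x y : pt) : path_metric S E d ->
  graph_points S E x -> graph_points S E y ->
  linked (graph_rips d S E) (inl x) (inl y).
Proof.
move=> dm Px Py Q Qx Qstep.
apply: (path_metric_connected dm (Q := fun x => Q (inl x)) Px Py Qx) => p q Pp Pq pq Qp.
apply: (Qstep _ _ Qp); have [_ [d0 _] ds _] := dm.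
have le_r p' q' : graph_points S E p' -> graph_points S E q' -> on_edge E p' q' -> d p' q' <= r.
  move=> Gp Gq e; apply: le_trans (ds _ _ Gp Gq e) _; apply: le_trans r1.
  exact: l1_half_le1 Gp Gq.
split.
- by rewrite finite_setU; split; exact: finite_set1.
- by move=> _ [->|->]; [exists p|exists q].
- move=> _ _ [->|->] [->|->] /=; rewrite ?d0 //; first exact: le_r.
  by apply: le_r => //; exact: on_edgeC.
Qed.

Section AttachRips.
Variables (S1 S2 : {set V}) (E1 E2 : {set {set V}}) (d1 d2 : pt -> pt -> R) (a b v : V) (j : nat).
Hypotheses (m1 : path_metric S1 E1 d1) (m2 : path_metric S2 E2 d2).
Hypothesis S12 : S1 :&: S2 = [set a; b]%SET.
Hypothesis abE : a = b \/ [set a; b]%SET \in E1 /\ [set a; b]%SET \in E2.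
Hypothesis vS1 : v \in S1.
Local Notation d := (attach_metric S1 E1 d1 d2 a b).

Lemma graph_rips_ext d' d'' S E : (forall x y, graph_points S E x -> graph_points S E y ->
  d' x y = d'' x y) -> graph_rips d' S E = graph_rips d'' S E.
Proof.
move=> dd; apply/seteqP; split=> s [fs sQ sd]; split=> // x y sx sy; have := sd x y sx sy;
  by have [p Pp <-] := sQ _ sx; have [q Pq <-] := sQ _ sy; rewrite /= dd.
Qed.

Lemma shared_points : graph_set S1 E1 `&` graph_set S2 E2 `<=`
  [set inl x | x in [set x : pt | graph_points S1 E1 x /\ gsupport x \subset [set a; b]%SET]].
Proof.
move=> _ [[x G1x <-] [y G2y [yx]]]; exists x => //; split=> //.
by rewrite yx in G2y; exact: (attach_pointsI S12 G1x G2y).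
Qed.

Lemma unmix_attach : heq R (state v j d (S1 :|: S2) (E1 :|: E2))
  (graph_rips d1 S1 E1 `|` graph_rips d2 S2 E2 `|` bouquet v j).
Proof.
have a1 x y := @attach_metric1 _ _ _ _ _ _ _ _ _ _ m1 m2 S12 abE x y.
have a2 x y := @attach_metric2 _ _ _ _ _ _ _ _ _ _ m1 m2 S12 abE x y.
rewrite -(graph_rips_ext a1) -(graph_rips_ext a2) /state /graph_rips.
have -> : graph_set (S1 :|: S2) (E1 :|: E2) = graph_set S1 E1 `|` graph_set S2 E2.
  by rewrite /graph_set (attach_pointsU m1 m2) image_setU.
have aS : a \in S1 :&: S2 by rewrite S12 !inE eqxx.
have bS : b \in S1 :&: S2 by rewrite S12 !inE eqxx orbT.
move: aS bS; rewrite !inE => /andP[aS1 aS2] /andP[bS1 bS2].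
have Ga1 := delta_points R E1 aS1; have Gb1 := delta_points R E1 bS1.
have dm := attach_path_metric m1 m2 S12 abE; have [_ [d0 _] _ _] := dm.
have [dab dba] := attach_metric_edge m1 m2 S12 abE.
have sub1 := @attach_points1 R V S1 S2 E1 E2.
apply: (@unmix _ _ _ _ _ _ _ (inl (delta a)) (inl (delta b))).
- exact: bouquet_complex.
- move=> s [i [_ [t _ ->]]] z [c _ <-] [[y _ yz] h]; apply: h; move: yz.
  by rewrite /circle_embedding; case: eqP => // _ _; exists (delta v) => //; exact: delta_points.
- by exists (delta a).
- by exists (delta a) => //; exact: delta_points.
- by exists (delta b).
- by exists (delta b) => //; exact: delta_points.
- by rewrite /= d0 //; exact: sub1 Ga1.
- by rewrite /= d0 //; exact: sub1 Gb1.
- exact: le_trans dba r1.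
- exact: le_trans dab r1.
- move=> s [fs sQ sd] [x sx [[p G1p px] nYx]] [y sy [[q G2q qy] nXy]].
  have GU := attach_pointsU m1 m2.
  have Gs z : s z -> exists2 w, graph_points (S1 :|: S2) (E1 :|: E2) w & inl w = z.
    by move=> /sQ[] [w Gw <-]; exists w => //; rewrite GU; [left|right].
  have := @attach_metric_near _ _ _ _ _ _ _ _ _ _ m1 m2 S12 abE r
    [set w | s (inl w)] p q r1 _ _ _ G1p _ _ G2q _.
  case.
  + by move=> w /Gs[w' Gw' [<-]].
  + by move=> w w' sw sw'; exact: (sd _ _ sw sw').
  + by rewrite /= px.
  + by move=> G2p; apply: nYx; exists p.
  + by rewrite /= qy.
  + by move=> G1q; apply: nXy; exists q.
  + by move=> h; left=> z sz; have [w _ wz] := Gs _ sz; rewrite -wz; apply: h; rewrite /= wz.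
  + by move=> h; right=> z sz; have [w _ wz] := Gs _ sz; rewrite -wz; apply: h; rewrite /= wz.
Qed.

End AttachRips.
(** This is an attachment with [a = b = u]. Any points of the new edge form a simplex, so its Rips
    complex is a cone and is pushed to [u]. *)
Lemma state_attach_edge d S E (u w v : V) j : path_metric S E d ->
  u \in S -> w \notin S -> v \in S ->
  exists2 d', path_metric (w |: S)%SET ([set u; w]%SET |: E)%SET d' &
    heq R (state v j d' (w |: S)%SET ([set u; w]%SET |: E)%SET) (state v j d S E).
Proof.
move=> dm uS wS vS; have uw : u != w by apply: contraNneq wS => <-.
pose S2 := [set u; w]%SET; pose E2 : {set {set V}} := [set [set u; w]%SET]%SET.
have m2 : path_metric S2 E2 (@l1_half R V) by exact: edge_path_metric.
have SU : (w |: S = S :|: S2)%SET.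
  by apply/setP => x; rewrite !inE; case: eqP => [->|_]; rewrite ?orbT //=; case: eqP => [->|_];
    rewrite ?uS ?orbF.
have EU : ([set u; w] |: E = E :|: E2)%SET by rewrite finset.setUC.
have S12 : (S :&: S2 = [set u; u])%SET.
  apply/setP => x; rewrite !inE orbb; have [->|xu] /= := eqVneq x u; first by rewrite uS.
  by apply/negbTE; apply: contra wS => /andP[xS /eqP <-].
have uuE : u = u \/ [set u; u]%SET \in E /\ [set u; u]%SET \in E2 by left.
exists (attach_metric S E d (@l1_half R V) u u).
  by rewrite SU EU; exact: attach_path_metric.
rewrite SU EU; apply: (heq_trans (unmix_attach j dm m2 S12 uuE vS)).
set X := graph_set S E; set Y := graph_set S2 E2.
have Gu := delta_points R E uS.
have Gu2 : graph_points S2 E2 (delta u) by apply: delta_points; rewrite !inE eqxx.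
have XY z : X z -> Y z -> z = inl (delta u).
  move=> Xz Yz; have [x [Gx xu] <-] := shared_points S12 (conj Xz Yz).
  by rewrite finset.setUid in xu; rewrite (points_delta Gx xu).
have bX s z : bouquet v j s -> s z -> Y z -> X z.
  move=> [i [_ [t _ ->]]] [c _ <-] [y _]; rewrite /circle_embedding.
  by case: eqP => // _ _; exists (delta v) => //; exact: delta_points.
apply: (@collapse_to _ _ (inl (delta u)) _ _ (Y `\` X) (Y `\` X)).
- by apply: complexU; [apply: complexU; exact: graph_rips_complex|exact: bouquet_complex].
- move=> s [[[fs sX sd]|[fs sY sd]]|bs] [z sz [Yz nXz]] _.
  + by case: nXz; exact: sX.
  + left; right; split.
    * by rewrite finite_setU; split=> //; exact: finite_set1.
    * by move=> x [/sY//|->]; exists (delta u).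
    * have h x : Y x -> lift_dist (@l1_half R V) x (inl (delta u)) <= r /\
                       lift_dist (@l1_half R V) (inl (delta u)) x <= r.
        move=> [y Gy <-] /=; split; apply: le_trans r1;
          [exact: l1_half_le1 Gy Gu2|exact: l1_half_le1 Gu2 Gy].
      move=> x y [sx|->] [sy|->]; first exact: sd.
      + exact: (h _ (sY _ sx)).1.
      + exact: (h _ (sY _ sy)).2.
      + by rewrite /= l1_halfxx.
  + by case: nXz; exact: bX bs sz Yz.
- by move=> [_]; apply; exists (delta u).
- by move=> [_]; apply; exists (delta u).
- move=> s; split.
    move=> [Rs|bs].
      by split; [left; left|left=> z sz [_]; apply; case: Rs => _ + _; exact].
    by split; [right|left=> z sz [Yz]; apply; exact: bX bs sz Yz].
  move=> [[[Rs|[fs sY sd]]|bs] h]; [by left| |by right].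
  have sX : s `<=` X.
    by move=> z sz; apply: contrapT => nX; case: h => h; apply: (h z sz); split=> //; exact: sY.
  left; split; [exact: fs|exact: sX|move=> x y sx sy].
  rewrite (XY x (sX _ sx) (sY _ sx)) (XY y (sX _ sy) (sY _ sy)) /=.
  by have [_ [d0 _] _ _] := dm; rewrite d0.
Qed.

Section AttachCycle.
Variables (S : {set V}) (E : {set {set V}}) (d : pt -> pt -> R) (c : seq V) (a b v : V) (j : 'I_n).
Hypotheses (dm : path_metric S E d) (c3 : (3 <= size c)%N) (uc : uniq c).
Hypothesis kj : tnth k j = size c.
Hypothesis Sc : S :&: [set x in c]%SET = [set a; b]%SET.
Hypothesis abE : a = b \/ [set a; b]%SET \in E /\ [set a; b]%SET \in cycle_edges c.
Hypothesis vS : v \in S.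
Local Notation C := [set x in c]%SET.
Local Notation EC := (cycle_edges c).
Let cm := @cycle_metric R V c v.
Let m2 : path_metric C EC cm. Proof. exact: cycle_path_metric. Qed.
(** The circles detached before belong to this side. The copy of circle [j] in the ambient type is
    still free and serves as the clone [B]. *)
Let X := graph_set S E `|`
  [set z : Z | exists p : {i : 'I_n & circle R (tnth k i)}, (j < tag p)%N /\ z = inr p].
Let Y := graph_set C EC.
Let B := [set z : Z | exists p : circle R (tnth k j), z = inr (existT _ j p)].
Let to_circle (x : pt) : circle R (tnth k j) := insubd (beta j) (cycle_pos c v x).
Let phi (z : Z) : Z := if z is inl x then inr (existT _ j (to_circle x)) else z.
Let pi (z : Z) : Z :=
  if z is inr p then if tag p == j then inl (cycle_param c v (val (tagged p))) else z else z.
Let x0 : Z := inl (delta v).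
Let y0 : Z := inl (cycle_param c v (val (beta j))).
Local Notation gam := (cycle_param c v).

Let gam_pts (p : circle R (tnth k j)) : graph_points C EC (gam (val p)).
Proof. by apply: cycle_param_points => //; case/andP: (valP p). Qed.

Let to_circleK x : graph_points C EC x -> gam (val (to_circle x)) = x.
Proof.
move=> Gx; have [xk gx] := cycle_posP v c3 uc Gx.
by rewrite /to_circle insubdK // unfold_in /= kj.
Qed.

Let gamK (p : circle R (tnth k j)) : to_circle (gam (val p)) = p.
Proof.
have pk : 0 <= val p < (size c)%:R by rewrite -kj; exact: (valP p).
by apply: val_inj; rewrite /to_circle cycle_paramK // insubdK //; exact: (valP p).
Qed.

Let gam_dist (p q : circle R (tnth k j)) : cm (gam (val p)) (gam (val q)) = circle_dist p q.
Proof.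
have h (p' : circle R (tnth k j)) : 0 <= val p' <= (size c)%:R.
  by rewrite -kj; have /andP[-> /ltW] := valP p'.
by rewrite /cm cycle_metric_param // /arc -kj.
Qed.

Let pi_B (p : circle R (tnth k j)) : pi (inr (existT _ j p)) = inl (gam (val p)).
Proof. by rewrite /pi /= eqxx. Qed.

Let phi_y0 : phi y0 = inr (existT _ j (beta j)).
Proof. by rewrite /phi /y0 gamK. Qed.

Lemma state_attach_cycle :
  heq R (state v j.+1 (attach_metric S E d cm a b) (S :|: C) (E :|: EC)) (state v j d S E).
Proof.
apply: (heq_trans (unmix_attach j.+1 dm m2 Sc abE vS)).
rewrite -setUA (setUC (graph_rips cm C EC)) setUA.
set KX := graph_rips d S E `|` bouquet v j.+1; set KY := graph_rips cm C EC.
have cX : complex KX by apply: complexU; [exact: graph_rips_complex|exact: bouquet_complex].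
have cY : complex KY by exact: graph_rips_complex.
have Gv := delta_points R E vS.
have KX_sub s : KX s -> s `<=` X.
  move=> [[_ + _]|[i [ji [t _ ->]]]]; first by move=> sX z /sX; left.
  move=> _ [p _ <-]; rewrite /circle_embedding; case: eqP => _; first by left; exists (delta v).
  by right; exists (existT _ i p).
have KY_sub s : KY s -> s `<=` Y by case.
have phiB y : Y y -> B (phi y) by move=> [x _ <-]; exists (to_circle x).
have phiK y : Y y -> pi (phi y) = y by move=> [x Gx <-]; rewrite /phi pi_B to_circleK.
have piY z : B z -> Y (pi z) by move=> [p ->]; rewrite pi_B; exists (gam (val p)).
have BX z : B z -> ~ X z.
  by move=> [p ->] [[x _ //]|[q [jq [qE]]]]; move: jq; rewrite -qE /= ltnn.
have BY z : B z -> ~ Y z by move=> [p ->] [].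
have pi_out z : ~ B z -> pi z = z.
  case: z => // -[i p] nB; rewrite /pi /=; case: eqP => // ij; case: nB.
  by subst i; exists p.
have shared z : X z -> Y z -> graph_set S E z.
  by move=> [//|[p [_ ->]]] [].
(* Shared points lie on one edge of both graphs, or coincide, so they are within [r] in either
   metric and span full simplices. *)
have near_ab x y : (graph_set S E `&` Y) x -> (graph_set S E `&` Y) y ->
    lift_dist d x y <= r /\ lift_dist cm x y <= r.
  move=> [[p Gp <-] [p' Gp' [e]]] [[q Gq <-] [q' Gq' [e']]].
  rewrite {}e in Gp'; rewrite {}e' in Gq'.
  have pab := attach_pointsI Sc Gp Gp'; have qab := attach_pointsI Sc Gq Gq'.
  rewrite /=; have [_ [d0 _] ds _] := dm; have [_ [c0 _] cs _] := m2.
  case: abE => [ab|[abE1 abE2]].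
    have pa : p = delta a by apply: (points_delta Gp); rewrite -(finset.setUid [set a]%SET) {2}ab.
    have qa : q = delta a by apply: (points_delta Gq); rewrite -(finset.setUid [set a]%SET) {2}ab.
    by rewrite pa qa in Gp Gp' *; rewrite d0 // c0.
  have pq1 : on_edge E p q by exists [set a; b]%SET.
  have pq2 : on_edge EC p q by exists [set a; b]%SET.
  have l1 := l1_half_le1 Gp Gq.
  by split; apply: le_trans r1; apply: le_trans l1; [exact: ds|exact: cs].
have fullX : full (X `&` Y) `<=` KX.
  move=> s [fs sXY]; left; split=> //.
    by move=> z /sXY[Xz Yz]; exact: shared.
  by move=> x y /sXY[Xx Yx] /sXY[Xy Yy]; apply: (near_ab _ _ _ _).1; split=> //; exact: shared.
have fullY : full (X `&` Y) `<=` KY.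
  move=> s [fs sXY]; split=> //.
    by move=> z /sXY[].
  by move=> x y /sXY[Xx Yx] /sXY[Xy Yy]; apply: (near_ab _ _ _ _).2; split=> //; exact: shared.
have : a \in S :&: C by rewrite Sc !inE eqxx.
rewrite finset.inE => /andP[aS aC].
have Ga := delta_points R E aS; have Ga2 := delta_points R EC aC.
have Xu : X (inl (delta a)) by left; exists (delta a).
have Yu : Y (inl (delta a)) by exists (delta a).
have lX : linked KX (inl (delta a)) x0.
  move=> Q Qa Qs; apply: (linked_graph_rips dm Ga Gv Qa) => x y Qx Rxy.
  by apply: (Qs _ _ Qx); left.
have lY : linked KY (inl (delta a)) y0 by apply: (linked_graph_rips m2 Ga2).
have Kx0 : KX [set x0].
  left; split; [exact: finite_set1|by move=> _ ->; exists (delta v)|].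
  by move=> _ _ -> -> /=; have [_ [d0 _] _ _] := dm; rewrite d0.
have Ky0 : KY [set y0].
  split; [exact: finite_set1|by move=> _ ->; exists (gam (val (beta j)))|].
  by move=> _ _ -> -> /=; have [_ [c0 _] _ _] := m2; rewrite (c0 _ (gam_pts _)).
apply: (heq_trans (detach R cX cY KX_sub KY_sub phiB phiK piY BX BY pi_out
  fullX fullY Xu Yu lX lY Kx0 Ky0)).
rewrite phi_y0; set q := fun z => pi _; set Q := (B `\ _) `|` _.
(* Embedding circle [j] at [v] and applying [q] recovers the parametrization of the cycle, so by
   [gam_dist] the clone is an isometric copy of the circle. *)
have qe p : q (circle_embedding v j p) = inl (gam (val p)).
  have [->|pb] := eqVneq p (beta j); first by rewrite /q circle_embedding_base eqxx pi_B.
  by rewrite /q /circle_embedding (negbTE pb) pi_B.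
suff -> : KX `|` pull q KY Q = state v j d S E by exact: homotopy_equivalent_refl.
rewrite /state /KX -setUA; congr (_ `|` _); apply/seteqP; split=> s.
  move=> [[i [ji h]]|[fs sQ [_ _ qd]]]; first by exists i; rewrite ltnW.
  have se : s = circle_embedding v j @` (circle_embedding v j @^-1` s).
    apply/seteqP; split=> z; last by move=> [p ? <-].
    move=> sz; suff [p pz] : exists p, circle_embedding v j p = z.
      by exists p => //; suff : s (circle_embedding v j p) by []; rewrite pz.
    have [[[p zp] zb]|->] := sQ _ sz; last by exists (beta j); exact: circle_embedding_base.
    exists p; rewrite zp /circle_embedding; case: eqP => // pb.
    by case: zb; rewrite zp pb.
  exists j; split=> //; exists (circle_embedding v j @^-1` s) => //.
  apply/(vietoris_ripsE _ _ r0); split.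
    by apply: finite_preimage => // p p' _ _; exact: circle_embedding_inj.
  by move=> p p' sp sp'; rewrite -gam_dist; have := qd (q (circle_embedding v j p))
    (q (circle_embedding v j p')); rewrite !qe; apply; rewrite -qe;
    [exists (circle_embedding v j p)|exists (circle_embedding v j p')].
move=> [i [ji [t Kt ->]]]; move: ji; rewrite leq_eqVlt => /predU1P[ji|ji]; last first.
  by left; exists i; split=> //; exists t.
have {}ji : j = i by exact: val_inj.
subst i; right; have [ft td] := (vietoris_ripsE _ _ r0).1 Kt; split.
- exact: finite_image.
- move=> _ [p tp <-]; rewrite /circle_embedding; case: eqP => [_|pb]; [by right|left].
  split; first by exists p.
  by move=> /= [] e; apply: pb; exact: existT_inj2 e.
- rewrite image_comp; split; first exact: finite_image.
    by move=> _ [p _ <-]; rewrite /= qe; exists (gam (val p)).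
  by move=> _ _ [p tp <-] [p' tp' <-]; rewrite /= !qe /= gam_dist; exact: td.
Qed.

End AttachCycle.

Definition prefix_of (ks : seq nat) := forall i, (i < size ks)%N -> nth 0%N ks i = nth 0%N k i.

(** The conditions on [ks] belong to the conclusion because [ks] grows along the derivation while
    [k] is fixed. The metric is built in the same induction, and [v] remains the starting vertex. *)
Lemma attachments_state S E ks : attachments S E ks ->
  exists d v, [/\ path_metric S E d, v \in S &
    (size ks <= n)%N -> prefix_of ks ->
    heq R (state v (size ks) d S E) (full [set inl (delta v) : Z] `|` bouquet v 0)].
Proof.
have prefix_rcons l m : prefix_of (rcons l m) -> prefix_of l.
  by move=> h i ik; have := h i; rewrite size_rcons nth_rcons ik => -> //; rewrite ltnS ltnW.
elim=> [v|S1 E1 l u w _ [d [v [dm vS IH]]] uS wS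
  |S1 E1 l c a _ [d [v [dm vS IH]]] c3 uc Sc|S1 E1 l c a b _ [d [v [dm vS IH]]] c3 uc abE abC Sc].
- exists (fun _ _ => 0), v; split; [exact: vertex_path_metric|by rewrite inE|move=> _ _].
  rewrite /state.
  suff -> : graph_rips (fun _ _ => 0) [set v]%SET finset.set0 = full [set inl (delta v)].
    exact: homotopy_equivalent_refl.
  apply/seteqP; split=> s.
    move=> [fs sG _]; split=> // z /sG[x Gx <-]; congr inl.
    by apply: (points_delta Gx); case: Gx.
  move=> [fs sv]; split=> //.
    by move=> z /sv ->; exists (delta v) => //; apply: delta_points; rewrite inE.
  by move=> x y /sv -> /sv ->.
- have [d' dm' h] := state_attach_edge (size l) dm uS wS vS.
  exists d', v; split=> //; first by rewrite inE vS orbT.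
  by move=> kn pk; apply: (heq_trans h); exact: IH.
- have Sc' : S1 :&: [set x in c]%SET = [set a; a]%SET by rewrite finset.setUid finset.setIC.
  have aE : a = a \/ [set a; a]%SET \in E1 /\ [set a; a]%SET \in cycle_edges c by left.
  exists (attach_metric S1 E1 d (@cycle_metric R V c v) a a), v; split.
  + exact: (attach_path_metric dm (cycle_path_metric R v c3 uc) Sc' aE).
  + by rewrite inE vS.
  + rewrite size_rcons => kn pk; have kj : tnth k (Ordinal kn) = size c.
      by rewrite (tnth_nth 0%N) /= -pk ?size_rcons // nth_rcons ltnn eqxx.
    apply: (heq_trans (state_attach_cycle dm c3 uc kj Sc' aE vS)) => /=.
    by apply: IH; [exact: ltnW|exact: prefix_rcons pk].
- have Sc' : S1 :&: [set x in c]%SET = [set a; b]%SET by rewrite finset.setIC.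
  have aE : a = b \/ [set a; b]%SET \in E1 /\ [set a; b]%SET \in cycle_edges c by right.
  exists (attach_metric S1 E1 d (@cycle_metric R V c v) a b), v; split.
  + exact: (attach_path_metric dm (cycle_path_metric R v c3 uc) Sc' aE).
  + by rewrite inE vS.
  + rewrite size_rcons => kn pk; have kj : tnth k (Ordinal kn) = size c.
      by rewrite (tnth_nth 0%N) /= -pk ?size_rcons // nth_rcons ltnn eqxx.
    apply: (heq_trans (state_attach_cycle dm c3 uc kj Sc' aE vS)) => /=.
    by apply: IH; [exact: ltnW|exact: prefix_rcons pk].
Qed.

End Assembly.

Local Close Scope classical_set_scope.

(** * The distance of the metric graph *)

Section GraphDist.
Context (R : realType) (V : finType) (E : {set {set V}}).
Variable d : {ffun V -> R} -> {ffun V -> R} -> R.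
Hypothesis dm : path_metric [set: V]%SET E d.
Local Notation pt := {ffun V -> R}.
Local Notation gp := (graph_point R E).
Local Notation P := (@graph_points R V [set: V]%SET E).
Local Notation paths x y := [set p | path (@same_edge R V E) x p /\ last x p = y]%classic.
Local Notation lengths x y := [set path_length x p | p in paths x y]%classic.
Implicit Types (x y z : gp) (p q : seq gp).

Lemma graph_point_points x : P (val x).
Proof.
by case/and3P: (valP x) => /forallP x0 /eqP x1 xE; split=> //; exact: finset.subsetT.
Qed.

Lemma graph_points_val (x : pt) : P x -> exists y : gp, val y = x.
Proof.
move=> [x0 x1 _ xE].
have h : [&& [forall v, 0 <= x v], \sum_v x v == 1 & (#|gsupport x| == 1)%N || (gsupport x \in E)].
  by rewrite x1 eqxx xE !andbT; apply/forallP.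
by exists (exist _ x h).
Qed.

Lemma path_length_cons x y p : path_length x (y :: p) = edge_dist x y + path_length y p.
Proof. by rewrite /path_length /= big_cons. Qed.

Lemma path_length_nil x : path_length x [::] = 0.
Proof. by rewrite /path_length big_nil. Qed.

Lemma path_length_cat x p q :
  path_length x (p ++ q) = path_length x p + path_length (last x p) q.
Proof.
elim: p x => [|y p IH] x /=; first by rewrite path_length_nil add0r.
by rewrite !path_length_cons IH addrA.
Qed.

Lemma path_length_ge0 x p : 0 <= path_length x p.
Proof. by apply: sumr_ge0 => s _; exact: l1_half_ge0. Qed.

Lemma same_edgeP x y : reflect (on_edge E (val x) (val y)) (same_edge x y).
Proof.
apply: (iffP existsP) => [[e /and3P[eE xe ye]]|[e eE [xe ye]]]; exists e => //.
by rewrite eE xe ye.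
Qed.

Lemma path_metric_le_path x p : path (@same_edge R V E) x p ->
  d (val x) (val (last x p)) <= path_length x p.
Proof.
have [_ [d0 dt] ds _] := dm.
elim: p x => [|y p IH] x /=; first by rewrite path_length_nil d0 //; exact: graph_point_points.
move=> /andP[/same_edgeP xy yp]; rewrite path_length_cons.
have Px := graph_point_points x; have Py := graph_point_points y.
have Pz := graph_point_points (last y p).
apply: le_trans (dt _ _ _ Px Py Pz) _; apply: lerD; last exact: IH.
exact: ds.
Qed.

(** Points reached by a path are stable under edge steps, so connectedness of the path metric
    applies; it prevents an infimum over the empty set. *)
Lemma lengths_neq0 x y : (lengths x y !=set0)%classic.
Proof.
suff [y' [yy [p xp]]] : exists y' : gp, val y' = val y /\ (paths x y' !=set0)%classic.
  by exists (path_length x p), p => //; rewrite (val_inj yy) in xp.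
pose Q (z : pt) := exists y' : gp, val y' = z /\ (paths x y' !=set0)%classic.
have Qx : Q (val x) by exists x; split=> //; exists [::].
apply: (path_metric_connected dm (graph_point_points x) (graph_point_points y) Qx).
move=> a b _ /graph_points_val[b' <-] ab [a' [a'a [p [xp pa]]]].
exists b'; split=> //; exists (rcons p b'); rewrite /= rcons_path last_rcons xp pa; split=> //.
by apply/same_edgeP; rewrite a'a.
Qed.

Lemma lengths_lbound x y : has_lbound (lengths x y).
Proof. by exists 0 => _ [p _ <-]; exact: path_length_ge0. Qed.

Lemma graph_dist_le x y p : path (@same_edge R V E) x p -> last x p = y ->
  graph_dist x y <= path_length x p.
Proof. by move=> xp py; apply: (ge_inf (lengths_lbound x y)); exists p. Qed.

Lemma graph_dist_triangle x y z : graph_dist x z <= graph_dist x y + graph_dist y z.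
Proof.
rewrite -lerBlDr; apply: lb_le_inf; first exact: lengths_neq0.
move=> _ [p [xp py] <-]; rewrite lerBlDr addrC -lerBlDr.
apply: lb_le_inf; first exact: lengths_neq0.
move=> _ [q [yq qz] <-]; rewrite lerBlDr addrC.
have := graph_dist_le (x := x) (y := z) (p := p ++ q).
by rewrite cat_path last_cat xp py yq qz path_length_cat py; apply.
Qed.

(** The triangle inequality along a path gives one bound; maximality of [d], applied to [graph_dist]
    itself, gives the other. *)
Lemma graph_distE x y : graph_dist x y = d (val x) (val y).
Proof.
apply/eqP; rewrite eq_le; apply/andP; split; last first.
  apply: lb_le_inf; first exact: lengths_neq0.
  by move=> _ [p [xp py] <-]; rewrite -py; exact: path_metric_le_path.
have [_ _ _ dmax] := dm.
(* Maximality speaks of functions on the whole ambient type, so [graph_dist] is extended by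
   [insubd], with an arbitrary default off the graph. *)
pose rho (a b : pt) := graph_dist (insubd x a) (insubd x b).
have rhoE (a b : gp) : rho (val a) (val b) = graph_dist a b by rewrite /rho !valKd.
rewrite -rhoE; apply: dmax; try exact: graph_point_points.
- split=> [a /graph_points_val[a' <-]|a b c _ _ _]; last exact: graph_dist_triangle.
  rewrite rhoE; apply/eqP; rewrite eq_le; apply/andP; split.
    by have := @graph_dist_le a' a' [::] isT erefl; rewrite path_length_nil.
  apply: lb_le_inf; first exact: lengths_neq0.
  by move=> _ [p _ <-]; exact: path_length_ge0.
- move=> a b /graph_points_val[a' <-] /graph_points_val[b' <-] ab; rewrite rhoE.
  have := @graph_dist_le a' b' [:: b']; rewrite /= andbT path_length_cons path_length_nil addr0.
  by apply=> //; apply/same_edgeP.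
Qed.

End GraphDist.

Theorem proposition4p2 (R : realType) (V : finType) (E : {set {set V}})
    (n : nat) (k : n.-tuple nat) (r : R)
    (b : forall i : 'I_n,
       realization R (vietoris_rips (@circle_dist R (tnth k i)) r)) :
  attachments [set: V] E k ->
  1 <= r ->
  (forall i, is_vertex (b i)) ->
  homotopy_equivalent R
    (realization R (vietoris_rips (@graph_dist R V E) r))
    (finite_wedge b).
Proof.
move=> att r1 bv.
have [beta bE] : exists beta : forall i, circle R (tnth k i), forall i, sval (b i) (beta i) = 1.
  by exists (fun i => sval (cid (bv i))) => i; exact: svalP (cid (bv i)).
have r0 : 0 <= r by exact: le_trans ler01 r1.
have [d [v [dm vS hs]]] := attachments_state r1 beta att.
have {}hs : heq R (state r beta v n d [set: V]%SET E)
    (full [set inl (delta R v)]%classic `|` bouquet r beta v 0)%classic.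
  by have := hs; rewrite size_tuple; apply.
(* No index reaches [n], so the initial state is the Rips complex of the whole graph. *)
have bn : bouquet r beta v n = set0.
  by apply/seteqP; split=> s // [i []]; rewrite leqNgt ltn_ord.
rewrite /state bn setU0 in hs.
refine (@homotopy_equivalent_trans R _
  (realization R (@graph_rips R V n k r d [set: V]%SET E)) _ _ _).
  have cK : complex (vietoris_rips (@graph_dist R V E) r).
    split=> [s [//]|s s' /(vietoris_ripsE _ _ r0)[fs sd] s's].
    apply/(vietoris_ripsE _ _ r0); split; first exact: sub_finite_set fs.
    by move=> x y /s's sx /s's sy; exact: sd.
  pose h (x : graph_point R E) :
    ({ffun V -> R} + {i : 'I_n & circle R (tnth k i)})%type := inl (val x).
  have hI : injective h by move=> x y [] /val_inj.
  apply: (relabel R hI cK) => s; split.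
    move=> [fs sG sd]; exists (h @^-1` s)%classic.
      apply/(vietoris_ripsE _ _ r0); split.
        by apply: finite_preimage => // x y _ _; exact: hI.
      by move=> x y sx sy; rewrite (graph_distE dm); exact: (sd _ _ sx sy).
    apply/seteqP; split=> z; last by move=> [x ? <-].
    move=> sz; have [x /graph_points_val[y yx] xz] := sG _ sz.
    by exists y; rewrite /preimage /= /h yx xz.
  move=> [t /(vietoris_ripsE _ _ r0)[ft td] ->]; split.
  - exact: finite_image.
  - by move=> _ [x _ <-]; exists (val x) => //; exact: graph_point_points.
  - by move=> _ _ [x tx <-] [y ty <-]; rewrite /= -(graph_distE dm); exact: td.
apply: (homotopy_equivalent_trans hs) => {hs bn dm d E att bv}.
(* Without cycles [finite_wedge] is the one-point space by definition; otherwise it is the library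
   wedge, and a circle exists to carry the common vertex. *)
case: n => [|n] in k b beta bE *.
  have -> : bouquet r beta v 0 = set0 by apply/seteqP; split=> s // [[]].
  rewrite setU0; exact: point_complex_homotopy.
have := @wedge_complex_homotopy R n.+1 _ _ _ (circle_rips_complex k r1)
  (circle_embedding beta v) beta (inl (delta R v)) (@circle_embedding_inj R V n.+1 k beta v)
  (@circle_embedding_base R V n.+1 k beta v) (@circle_embedding_disjoint R V n.+1 k beta v)
  b bE isT.
rewrite (_ : wedge_complex _ _ _ =
  full [set inl (delta R v)]%classic `|` bouquet r beta v 0)%classic //.
rewrite /wedge_complex; congr (_ `|` _)%classic; apply/seteqP; split=> s.
  by move=> [i h]; exists i; split.
by move=> [i [_ h]]; exists i.
Qed.
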